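(* Let $d\ge 3$ and let $D\subseteq\mathbb{R}^d$ be an open, connected, bounded domain with Lipschitz boundary. Let $\rho:D\to\mathbb{R}$ be a continuous probability density for which there are constants $0<\rho_{min}<\rho_{max}$ with $\rho_{min}\le\rho(x)\le\rho_{max}$ for all $x\in D$, let $\nu$ be the probability measure $d\nu=\rho\,dx$, and let $\mathbf{x}_1,\mathbf{x}_2,\dots$ be i.i.d. samples from $\nu$, with empirical measures $\nu_n=\frac1n\sum_{i=1}^n\delta_{\mathbf{x}_i}$. Let $\{k_n\}_{n\in\mathbb{N}}$ be a sequence of natural numbers satisfying $$\lim_{n\to\infty}\frac{k_n}{\log(n)}=+\infty,\qquad \lim_{n\to\infty}\frac{k_n}{n}=0.$$ Then the following statement holds with probability one: if $\{u_n\}_{n\in\mathbb{N}}$ is a sequence with $u_n\in L^1(\nu_n)$ for which $$\sup_{n\in\mathbb{N}}\|u_n\|_{L^1(\nu_n)}<\infty\qquad\text{and}\qquad \sup_{n\in\mathbb{N}}GTV_{n,k_n}(u_n)<\infty,$$ then $\{u_n\}_{n\in\mathbb{N}}$ is pre-compact in $TL^1(D)$; that is, every subsequence of $\{u_n\}_{n\in\mathbb{N}}$ has a further subsequence converging in $TL^1(D)$.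
   Context: **$k$-NN graph.** Let $X_n=\{\mathbf{x}_1,\dots,\mathbf{x}_n\}$. For $k\in\mathbb{N}$ write $\mathbf{x}_i\sim_k\mathbf{x}_j$ if $\mathbf{x}_i$ is among the $k$ nearest neighbors (in Euclidean distance, among the other points of $X_n$) of $\mathbf{x}_j$, or vice versa. With $r=|\mathbf{x}_i-\mathbf{x}_j|$, with probability one this is equivalent (for $i\neq j$) to: $\nu_n(B(\mathbf{x}_i,r))\le k/n$ or $\nu_n(B(\mathbf{x}_j,r))\le k/n$, where $B(x,r)$ is the open ball. Set $J_k(\mathbf{x}_i,\mathbf{x}_j)=1$ if $\mathbf{x}_i\sim_k\mathbf{x}_j$ and $0$ otherwise. **Graph total variation.** With $\bar\varepsilon_n>0$ defined by $\bar\varepsilon_n^d=k_n/n$, $$GTV_{n,k_n}(u_n):=\frac{1}{n^2\bar\varepsilon_n^{d+1}}\sum_{i,j=1}^n J_{k_n}(\mathbf{x}_i,\mathbf{x}_j)\,|u_n(\mathbf{x}_i)-u_n(\mathbf{x}_j)|,\qquad u_n\in L^1(\nu_n).$$ **$TL^1$ space.** $TL^1(D)$ is the set of pairs $(\mu,u)$ with $\mu$ a Borel probability measure on $D$ and $u\in L^1(\mu)$, with metric $$d_{TL^1}((\mu_1,u_1),(\mu_2,u_2)):=\inf_{\pi\in\Gamma(\mu_1,\mu_2)}\Big\{\int_{D\times D}|x-y|\,d\pi(x,y)+\int_{D\times D}|u_1(x)-u_2(y)|\,d\pi(x,y)\Big\},$$ where $\Gamma(\mu_1,\mu_2)$ is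 the set of couplings of $\mu_1$ and $\mu_2$. A function $u_n\in L^1(\nu_n)$ is identified with the element $(\nu_n,u_n)$ of $TL^1(D)$. *)

(* Defs.v *)
From HB Require Import structures.
From mathcomp Require Import all_boot all_order all_algebra.
From mathcomp Require Import all_classical all_reals all_analysis.
From mathcomp Require Import measurable_realfun.

Set Implicit Arguments.
Unset Strict Implicit.
Unset Printing Implicit Defensive.

Import Order.TTheory GRing.Theory Num.Theory.
Import numFieldNormedType.Exports.

Local Open Scope classical_set_scope.
Local Open Scope ring_scope.

HB.instance Definition _ (R : realType) (n : nat) :=
  @isMeasurable.Build (sigma_display (@open 'rV[R]_n)) 'rV[R]_n
    <<s @open 'rV[R]_n >> (@sigma_algebra0 _ setT _)
    (@sigma_algebraC _ _) (@sigma_algebra_bigcup _ setT _).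

Section lebesgue_rV.
Variable R : realType.

Lemma rV_open_measurable n (U : set 'rV[R]_n) : open U -> measurable U.
Proof. by move=> oU; exact: sub_sigma_algebra. Qed.

Definition rV_cons n (p : measurableTypeR R * 'rV[R]_n) : 'rV[R]_n.+1 :=
  row_mx (const_mx p.1 : 'rV[R]_1) p.2.

Definition rV_uncons n (v : 'rV[R]_n.+1) : measurableTypeR R * 'rV[R]_n :=
  (v 0 0, rsubmx (v : 'rV[R]_(1 + n))).

Lemma rV_consK n : cancel (@rV_cons n) (@rV_uncons n).
Proof.
move=> [x v]; rewrite /rV_cons /rV_uncons row_mxKr; congr pair.
by rewrite mxE; case: splitP => [j _|j /=]; [rewrite mxE|].
Qed.

Lemma rV_unconsK n : cancel (@rV_uncons n) (@rV_cons n).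
Proof.
move=> v; rewrite /rV_cons /rV_uncons /=; apply/rowP => i.
rewrite mxE; case: splitP => j ij; rewrite mxE; congr (v 0 _); apply/val_inj.
  by move: ij; case: j => -[] // ? <-.
by [].
Qed.

Lemma rV_ball_open_bigcup n (U : set 'rV[R]_n) : open U ->
  U = \bigcup_(p in [set p : 'rV[rat]_n * nat |
         ball (map_mx ratr p.1 : 'rV[R]_n) p.2.+1%:R^-1 `<=` U])
       ball (map_mx ratr p.1 : 'rV[R]_n) p.2.+1%:R^-1.
Proof.
move=> oU; apply/seteqP; split => [x Ux|x [p /= pU]]; last exact: pU.
have /nbhs_ballP[e /= e0 eU] : nbhs x U by exact: open_nbhs_nbhs.
have [k _ /(_ k (leqnn k)) /= ke] := near_infty_natSinv_lt (PosNum (divr_gt0 e0 (ltr0n R 2))).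
have k0 : (0 : R) < k.+1%:R^-1 by rewrite invr_gt0.
have q_ i : {q : rat | ball (x 0 i) k.+1%:R^-1 (ratr q : R)}.
  apply: cid; have [y [yb [q _ qy]]] : ball (x 0 i) k.+1%:R^-1 `&` (@ratr R @` setT) !=set0.
    by apply: dense_rat; [exists (x 0 i); exact: ballxx|exact: ball_open].
  by exists q; rewrite qy.
pose q : 'rV[rat]_n := \row_i sval (q_ i).
have qx : ball (map_mx ratr q : 'rV[R]_n) k.+1%:R^-1 x.
  split => // i j; rewrite !mxE ord1; apply: ball_sym.
  exact: (svalP (q_ j)).
exists (q, k) => //= y qy; apply: eU.
apply: (le_ball (ltW _)).
  2: exact: (ball_triangle (ball_sym qx) qy).
by rewrite [ltRHS](splitr e) ltrD.
Qed.

Lemma measurable_rV_cons n : measurable_fun setT (@rV_cons n).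
Proof.
apply: (@measurability _ _ _ _ _ _ (@open 'rV[R]_n.+1)) => // _ [U oU <-].
rewrite setTI (rV_ball_open_bigcup oU) preimage_bigcup.
rewrite bigcup_mkcond.
apply: countable_bigcupT_measurable => [|p]; first exact: countableP.
case: ifPn => // _.
set q := map_mx _ _; set r := _^-1.
have r0 : 0 < r by rewrite invr_gt0.
have -> : @rV_cons n @^-1` ball q r =
   ball (rV_uncons q).1 r `*` ball (rV_uncons q).2 r.
  apply/seteqP; split => -[t v] /=.
    move=> [_ bq]; split.
      have := bq 0 0; congr (ball _ _ _).
      exact: (congr1 fst (rV_consK (t, v))).
    split => // i j; have := bq i (rshift 1 j); congr (ball _ _ _).
      by rewrite [RHS]mxE.
    exact: row_mxEr.
  move=> [bt [_ bv]]; split => // i j; rewrite (ord1 i).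
  rewrite [rV_cons _ _ _]mxE; case: splitP => k jk.
    have -> : j = 0 by apply/val_inj; rewrite /= jk; case: k {jk} => -[].
    by rewrite [const_mx _ _ _]mxE.
  have -> : j = rshift 1 k :> 'I_(1 + n) by apply/val_inj.
  by have := bv 0 k; rewrite [rsubmx _ _ _]mxE.
apply: measurableX.
  by apply: open_measurable; exact: ball_open.
by apply: rV_open_measurable; exact: ball_open.
Qed.

Lemma measurable_rV_coord n (i : 'I_n) :
  measurable_fun setT (fun v : 'rV[R]_n => v 0 i : measurableTypeR R).
Proof.
apply: (measurability _ (RGenOpens.measurableE R)).
move=> _ [_ [a [b ->]] <-]; rewrite setTI; apply: rV_open_measurable.
apply: open_comp => [v _|]; last exact: interval_open.
exact: coord_continuous.
Qed.

Lemma measurable_rV_uncons n : measurable_fun setT (@rV_uncons n).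
Proof.
apply/measurable_fun_pairP; split.
  exact: measurable_rV_coord.
apply: (@measurability _ _ _ _ _ _ (@open 'rV[R]_n)) => // _ [U oU <-].
rewrite setTI; apply: rV_open_measurable.
by apply: open_comp => // v _; exact: continuous_rsubmx.
Qed.

Section cons_measure.
Local Open Scope ereal_scope.
Variables (n : nat) (m : {sigma_finite_measure set 'rV[R]_n -> \bar R}).

Definition rV_cons_measure : set 'rV[R]_n.+1 -> \bar R :=
  pushforward (lebesgue_measure \x m) (@rV_cons n).

Let cons_measure0 : rV_cons_measure set0 = 0.
Proof. by rewrite /rV_cons_measure /pushforward preimage_set0 measure0. Qed.

Let cons_measure_ge0 A : 0 <= rV_cons_measure A.
Proof. by rewrite /rV_cons_measure /pushforward; exact: measure_ge0. Qed.

Let cons_measure_sigma_additive : semi_sigma_additive rV_cons_measure.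
Proof.
move=> F mF tF mUF; rewrite /rV_cons_measure /pushforward preimage_bigcup.
have mp A : measurable A -> measurable (@rV_cons n @^-1` A).
  by move=> mA; rewrite -[X in measurable X]setTI; exact: measurable_rV_cons.
apply: measure_semi_sigma_additive => [i||]; first exact: mp.
- by apply/trivIsetP => /= i j _ _ ij; rewrite -preimage_setI;
    move/trivIsetP : tF => /(_ _ _ _ _ ij) ->//; rewrite preimage_set0.
- by rewrite -preimage_bigcup; exact: mp.
Qed.

HB.instance Definition _ := isMeasure.Build _ _ _ rV_cons_measure
  cons_measure0 cons_measure_ge0 cons_measure_sigma_additive.

Let cons_measure_sigma_finite : sigma_finite setT rV_cons_measure.
Proof.
have /sigma_finiteP[F [UF ndF Foo]] := sigma_finiteT (@lebesgue_measure R).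
have /sigma_finiteP[G [UG ndG Goo]] := sigma_finiteT m.
exists (fun k => @rV_uncons n @^-1` (F k `*` G k)).
  rewrite -preimage_bigcup (_ : \bigcup_k _ = setT) ?preimage_setT//.
  apply/seteqP; split => // -[x y] _.
  have [i _ Fix] : (\bigcup_i F i) x by rewrite -UF.
  have [j _ Gjy] : (\bigcup_i G i) y by rewrite -UG.
  exists (maxn i j) => //; split.
    by move: x Fix; exact/subsetPset/ndF/leq_maxl.
  by move: y Gjy; exact/subsetPset/ndG/leq_maxr.
move=> k; have [? ?] := Foo k; have [? ?] := Goo k; split.
  rewrite -[X in measurable X]setTI; apply: measurable_rV_uncons => //.
  exact: measurableX.
rewrite /rV_cons_measure /pushforward -comp_preimage.
rewrite (_ : _ \o _ = id) ?preimage_id; last first.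
  by apply/funext => p; exact: rV_consK.
by rewrite product_measure1E// lte_mul_pinfty// ge0_fin_numE.
Qed.

HB.instance Definition _ := Measure_isSigmaFinite.Build _ _ _ rV_cons_measure
  cons_measure_sigma_finite.

End cons_measure.

Fixpoint lebesgue_rV n : {sigma_finite_measure set 'rV[R]_n -> \bar R} :=
  if n is n'.+1 then rV_cons_measure (lebesgue_rV n') else \d_(0 : 'rV[R]_0).

Lemma lebesgue_rV_box n (a b : 'rV[R]_n) : (forall i, a 0 i <= b 0 i) ->
  lebesgue_rV n [set v | forall i, v 0 i \in `[a 0 i, b 0 i]] =
  (\prod_(i < n) (b 0 i - a 0 i))%:E.
Proof.
elim: n a b => [|n IHn] a b ab /=.
  by rewrite big_ord0 diracE mem_set// => -[].
pose tl (v : 'rV[R]_n.+1) := (rV_uncons v).2.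
have tlE v i : tl v 0 i = v 0 (lift 0 i).
  by rewrite [LHS]mxE; congr (v 0 _); exact/val_inj.
have consE t v i : @rV_cons n (t, v) 0 (lift 0 i) = v 0 i.
  by rewrite -tlE /tl rV_consK.
have cons0 t v : @rV_cons n (t, v) 0 0 = t := congr1 fst (rV_consK (t, v)).
rewrite /rV_cons_measure /pushforward.
have -> : @rV_cons n @^-1` [set v | forall i, v 0 i \in `[a 0 i, b 0 i]] =
    `[a 0 0, b 0 0]%classic `*`
    [set v : 'rV[R]_n | forall i, v 0 i \in `[tl a 0 i, tl b 0 i]].
  apply/seteqP; split => -[t v] /=.
    move=> abv; split; first by have := abv 0; rewrite cons0.
    by move=> i; have := abv (lift 0 i); rewrite consE !tlE.
  move=> [abt abv] i; have [j ->|->] := unliftP 0 i; last by rewrite cons0.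
  by have := abv j; rewrite consE !tlE.
rewrite product_measure1E//; last first.
  rewrite (_ : [set v | _] = \bigcap_(i in [set: 'I_n])
      (fun v : 'rV[R]_n => v 0 i) @^-1` `[tl a 0 i, tl b 0 i]%classic).
    apply: fin_bigcap_measurable => // i _.
    by rewrite -[X in measurable X]setTI; exact: measurable_rV_coord.
  by apply/seteqP; split => [v abv i _|v abv i]; exact: abv.
rewrite IHn => [|i]; last by rewrite !tlE.
rewrite big_ord_recl EFinM.
under [in RHS]eq_bigr do rewrite -!tlE.
congr (_ * _)%E; have := @lebesgue_measure_itv R `[a 0 0, b 0 0]; rewrite /= => ->.
rewrite lte_fin; case: ltP => // ba.
by rewrite (@le_anti _ _ (a 0 0) (b 0 0)) ?subrr ?ab.
Qed.

End lebesgue_rV.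

Section tl1.
Local Open Scope ereal_scope.
Variables (R : realType) (d : nat).
Local Notation E := 'rV[R]_d.

(* The library norm `|x| on 'rV[R]_d is the sup norm; it induces the same
   topology, bounded sets and Lipschitz functions as the Euclidean norm. *)
Definition enorm (x : E) : R := Num.sqrt (\sum_i x 0 i ^+ 2)%R.

(* Near each boundary point and in suitable orthonormal coordinates, D is the
   strict epigraph of a Lipschitz function of d - 1 variables. *)
Definition lipschitz_boundary (D : set E) : Prop :=
  forall x, (closure D `\` interior D) x ->
  exists (Q : 'M[R]_d) (i : 'I_d) (g : 'rV[R]_d.-1 -> R^o) (r : R),
    [/\ Q *m Q^T = 1%:M, lipschitz g, (0 < r)%R &
      forall y, (enorm (y - x) < r)%R ->
        D y <-> (g (col' i (y *m Q)) < (y *m Q) 0 i)%R].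

(* Functions on D are represented by functions on R^d of which only the
   restriction to D is used, and measures on D by measures on R^d that are
   concentrated on D. *)
Definition density_measure (D : set E) (rho : E -> R) (A : set E) : \bar R :=
  \int[lebesgue_rV R d]_(x in D `&` A) (rho x)%:E.

(* For n = 0 this is the zero measure. *)
Definition empirical (x : nat -> E) (n : nat) : {measure set E -> \bar R} :=
  mscale (n%:R^-1)%:nng%R (msum (fun i => \d_(x i)) n).

Definition TL1 (D : set E) : set ({measure set E -> \bar R} * (E -> R)) :=
  [set p : {measure set E -> \bar R} * (E -> R) |
    [/\ p.1 setT = 1, p.1 D = 1 & p.1.-integrable D (EFin \o p.2)]].

Definition couplings (mu1 mu2 : {measure set E -> \bar R}) :
    set (probability (E * E)%type R) :=
  [set pi | forall A, measurable A ->
    pi (A `*` setT) = mu1 A /\ pi (setT `*` A) = mu2 A].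

Definition dTL1 (D : set E) (p q : {measure set E -> \bar R} * (E -> R)) :
    \bar R :=
  ereal_inf [set \int[pi]_(z in D `*` D) (enorm (z.1 - z.2))%:E +
                 \int[pi]_(z in D `*` D) `|p.2 z.1 - q.2 z.2|%:E
            | pi in couplings p.1 q.1].

End tl1.

Section knn.
Variables (R : realType) (d : nat) (x : nat -> 'rV[R]_d) (n k : nat).

(* x_i is one of the k nearest neighbors of x_j when fewer than k of the points
   other than x_j are strictly closer to x_j (distances are a.s. distinct). *)
Definition is_knn (i j : 'I_n) : bool :=
  (i != j) &&
  (#|[set l : 'I_n | (l != j) && (enorm (x l - x j) < enorm (x i - x j))%R]|%SET
     < k)%N.

Definition knn_kernel (i j : 'I_n) : R := (is_knn i j || is_knn j i)%:R.

(* eps ^ d = k / n.  For k = 0 the prefactor is 0^-1 = 0, and all weights vanish. *)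
Definition GTV (u : 'rV[R]_d -> R) : R :=
  let eps := (k%:R / n%:R) `^ d%:R^-1 in
  (n%:R ^+ 2 * eps ^+ d.+1)^-1 *
  \sum_(i < n) \sum_(j < n) knn_kernel i j * `|u (x i) - u (x j)|.

End knn.

Section iid.
Context (R : realType) dO dT (Omega : measurableType dO) (T : measurableType dT).
Variables (P : probability Omega R) (X : nat -> {RV P >-> T}).

Definition mutually_independent : Prop :=
  forall (s : seq nat) (A : nat -> set T), uniq s ->
    (forall i, measurable (A i)) ->
    P (\bigcap_(i in [set` s]) (X i @^-1` A i)) =
    (\prod_(i <- s) P (X i @^-1` A i))%E.

Definition iid (nu : set T -> \bar R) : Prop :=
  mutually_independent /\
  forall i A, measurable A -> distribution P (X i) A = nu A.

End iid.

(* Main.v *)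
Require Import Defs.
From HB Require Import structures.
From mathcomp Require Import all_boot all_order all_algebra.
From mathcomp Require Import all_classical all_reals all_analysis.
From mathcomp Require Import measurable_realfun ring lra zify.

Set Implicit Arguments.
Unset Strict Implicit.
Unset Printing Implicit Defensive.

Import Order.TTheory GRing.Theory Num.Theory.
Import numFieldNormedType.Exports.

Local Open Scope classical_set_scope.
Local Open Scope ring_scope.

(** The sample is sorted into the cells of two grids, and the graph total
    variation is turned into a Poincare inequality between them.

    The fine grid has mesh [c0 * eps n], where [eps n ^+ d = k n / n]. Since [k n]
    dominates [log n], Chernoff's bound and the Borel-Cantelli lemma show that,
    almost surely and for all large [n], each fine cell holds at most a constant
    times [k n] points, and at least a constant times [k n] when it lies in [D]
    ([ae_microcells]). For small [c0] all pairs of points in neighbouring fine cells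
    are then joined in the graph ([knn_linked]), so that the graph total variation
    controls the sum of the differences of [u n] over such pairs.

    The coarse grid has a fixed mesh [s]. Away from the boundary, two points of a
    coarse cell are connected by a lattice path of fine cells, and telescoping
    bounds the mean oscillation of [u n] over coarse cells by a multiple of [s]
    ([poincare_cells]). Near the boundary such paths may leave [D], but little mass
    is found there: a Lipschitz boundary gives cones of uniform size whose axes are
    integer vectors of bounded length ([uniform_cone]), pushing the boundary strip
    along the axes gives [J] disjoint translates inside [D], and the mass of [u n] on
    the strip is, up to its variation, at most a multiple of [1 / J] of the total
    mass ([strip_mass]). Hence [u n] is, up to an error which is small with [s]
    uniformly in [n], constant on coarse cells ([oscillation_small]).

    The averages of [u n] over the coarse cells are bounded, hence converge along an
    ultrafilter containing the given subsequence; as [s] decreases, the limiting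
    step functions form a Cauchy sequence in L1, whose limit is the function
    sought. By the law of large numbers the frequencies of coarse cells converge, so
    that the empirical measure and the sampling measure have a coupling in which
    most of the mass stays in its coarse cell ([dTL1_le]). This gives convergence in
    TL1 along the ultrafilter, and a subsequence is extracted at the end
    ([TL1_precompact]). *)

(** * Oscillation of a function on a cloud of points sorted into cells *)

Section cells.
Context {R : realType} {Z : zmodType} {n : nat}.
Variables (q : 'I_n -> Z) (u : 'I_n -> R).

Definition occ (p : Z) : nat := #|[pred i | q i == p]|.

Definition avg (p : Z) (f : 'I_n -> R) : R :=
  (\sum_(i | q i == p) f i) / (occ p)%:R.

Definition mass (p : Z) : R := \sum_(i | q i == p) `|u i|.

Definition osc (p p' : Z) : R :=
  \sum_(i | q i == p) \sum_(j | q j == p') `|u i - u j|.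

Definition mosc (p p' : Z) : R := avg p (fun i => avg p' (fun j => `|u i - u j|)).

Lemma occE p : (occ p)%:R = \sum_(i | q i == p) 1 :> R.
Proof. by rewrite sumr_const. Qed.

Lemma le_avg p (f g : 'I_n -> R) : (forall i, f i <= g i) -> avg p f <= avg p g.
Proof.
by move=> fg; rewrite ler_wpM2r ?invr_ge0 ?ler0n//; apply: ler_sum => i _.
Qed.

Lemma avgD p f g : avg p (fun i => f i + g i) = avg p f + avg p g.
Proof. by rewrite /avg big_split/= mulrDl. Qed.

Lemma avg_cst p c : (0 < occ p)%N -> avg p (fun=> c) = c.
Proof.
move=> p0; rewrite /avg sumr_const -/(occ p) -[c *+ _]mulr_natr mulfK//.
by rewrite pnatr_eq0 -lt0n.
Qed.

Lemma avg_ge0 p f : (forall i, 0 <= f i) -> 0 <= avg p f.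
Proof. by move=> f0; rewrite divr_ge0// sumr_ge0. Qed.

Lemma exchange_avg p p' (f : 'I_n -> 'I_n -> R) :
  avg p (fun i => avg p' (f i)) = avg p' (fun j => avg p (f^~ j)).
Proof.
rewrite /avg -!mulr_suml -!mulrA [_^-1 * _]mulrC; congr (_ * _).
exact: exchange_big.
Qed.

Lemma mass_ge0 p : 0 <= mass p. Proof. exact: sumr_ge0. Qed.

Lemma mosc_ge0 p p' : 0 <= mosc p p'.
Proof. by apply: avg_ge0 => i; exact: avg_ge0. Qed.

Lemma osc_ge0 p p' : 0 <= osc p p'.
Proof. by apply: sumr_ge0 => i _; exact: sumr_ge0. Qed.

Lemma moscE p p' : mosc p p' = osc p p' / (occ p)%:R / (occ p')%:R.
Proof. by rewrite /mosc /avg -mulr_suml mulrAC. Qed.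

(** Averaging the pointwise triangle inequality over a third cell costs nothing,
    because averages are normalized. *)
Lemma mosc_triangle p0 p1 p2 :
  (0 < occ p0)%N -> (0 < occ p1)%N -> (0 < occ p2)%N ->
  mosc p0 p2 <= mosc p0 p1 + mosc p1 p2.
Proof.
move=> o0 o1 o2.
pose F i j l : R := `|u i - u l| + `|u l - u j|.
have -> : mosc p0 p1 + mosc p1 p2 =
    avg p0 (fun i => avg p2 (fun j => avg p1 (F i j))).
  under eq_fun do under eq_fun do rewrite avgD.
  under eq_fun do rewrite avgD avg_cst//.
  rewrite avgD avg_cst//; congr (_ + _).
  by rewrite exchange_avg.
rewrite /mosc; apply: le_avg => i; apply: le_avg => j.
rewrite -[leLHS](avg_cst _ o1); apply: le_avg => l.
by rewrite /F (le_trans _ (ler_normD _ _))// addrA subrK.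
Qed.

(** The cell [p] may contain very few points, so it is only compared, without
    normalization, with an adjacent cell [p']; the normalized oscillation is used
    between the well occupied cells [p'] and [p'']. *)
Lemma mass_le_mosc p p' p'' : (0 < occ p')%N -> (0 < occ p'')%N ->
  mass p <= osc p p' / (occ p')%:R + (occ p)%:R * mosc p' p''
            + (occ p)%:R * (mass p'' / (occ p'')%:R).
Proof.
move=> o1 o2.
pose F i j l : R := `|u i - u j| + `|u j - u l| + `|u l|.
have -> : osc p p' / (occ p')%:R + (occ p)%:R * mosc p' p''
    + (occ p)%:R * (mass p'' / (occ p'')%:R)
    = \sum_(i | q i == p) avg p' (fun j => avg p'' (F i j)).
  under [RHS]eq_bigr => i _.
    under eq_fun do rewrite avgD avgD avg_cst//.
    rewrite avgD avgD avg_cst//; over.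
  rewrite !big_split/= !sumr_const -/(occ p) !mulr_natl; congr (_ + _ + _).
  by rewrite /avg -mulr_suml.
apply: ler_sum => i _.
rewrite -[leLHS](avg_cst _ o1); apply: le_avg => j.
rewrite -[leLHS](avg_cst _ o2); apply: le_avg => l.
rewrite /F -[X in `|X|](subrK (u l)) (le_trans (ler_normD _ _))// lerD2r.
by rewrite (le_trans _ (ler_normD _ _))// addrA subrK.
Qed.

Lemma sum_mass_le (S : seq Z) : uniq S ->
  \sum_(p <- S) mass p <= \sum_i `|u i|.
Proof.
move=> uS; rewrite /mass; under eq_bigr do rewrite big_mkcond/=.
rewrite exchange_big/=; apply: ler_sum => i _.
under eq_bigr do rewrite eq_sym.
rewrite -big_mkcond/= big_const_seq iter_addr addr0.
by rewrite count_uniq_mem//; case: (_ \in _) => //; rewrite mulr0n.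
Qed.

Variable adj : pred Z.

(** The part of the graph total variation carried by pairs of points whose
    cells differ by an admissible offset. *)
Definition linked_var : R :=
  \sum_i \sum_(j | adj (q j - q i)) `|u i - u j|.

Lemma linked_var_ge0 : 0 <= linked_var.
Proof. by apply: sumr_ge0 => i _; exact: sumr_ge0. Qed.

(** The offset [a] being fixed, the cell of the first point of a pair determines
    [p], so that each linked pair of points is counted at most once. *)
Lemma sum_osc_shift (S : seq Z) (a b : Z) : uniq S -> adj (b - a) ->
  \sum_(p <- S) osc (p + a) (p + b) <= linked_var.
Proof.
move=> uS ab; rewrite /osc /linked_var.
under eq_bigr do rewrite big_mkcond/=.
rewrite exchange_big/=; apply: ler_sum => i _.
rewrite -big_mkcond/=.
under eq_bigr do rewrite big_mkcond/=.
rewrite exchange_big/= [leRHS]big_mkcond/=; apply: ler_sum => j _.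
rewrite -big_mkcondr/=.
case: ifPn => [_|nadj].
  rewrite (eq_bigl (fun p => (p == q i - a) && (q j == p + b))); last first.
    by move=> p; rewrite -(inj_eq (addIr a) p) subrK eq_sym.
  rewrite big_mkcondr/= (@le_trans _ _ (\sum_(p <- S | p == q i - a) `|u i - u j|))//.
    by apply: ler_sum => p _; case: ifP.
  rewrite big_const_seq iter_addr addr0 (eq_count (a2 := pred1 (q i - a)))//.
  by rewrite count_uniq_mem//; case: (_ \in _) => //; rewrite mulr0n.
rewrite big1// => p /andP[/eqP qi /eqP qj]; exfalso.
by move: nadj; rewrite qi qj opprD addrACA subrr add0r ab.
Qed.

Variables (lo hi : R).
Hypothesis lo_gt0 : 0 < lo.
Hypothesis occ_hi : forall p, (occ p)%:R <= hi.

Lemma occ_gt0 p : lo <= (occ p)%:R -> (0 < occ p)%N.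
Proof. by move=> /(lt_le_trans lo_gt0); rewrite ltr0n. Qed.

Lemma mosc_le_osc p p' : lo <= (occ p)%:R -> lo <= (occ p')%:R ->
  mosc p p' <= osc p p' / lo ^+ 2.
Proof.
move=> o1 o2; rewrite moscE expr2 invfM mulrA.
by rewrite ler_pM ?ler_pM ?divr_ge0 ?osc_ge0 ?invr_ge0 ?ler0n ?lef_pV2 ?posrE//
  ?(lt_le_trans lo_gt0).
Qed.

(** Telescoping along a chain of offsets: each step costs at most the whole
    linked variation, because a translation maps distinct cells to distinct
    cells. *)
Lemma sum_mosc_chain (S : seq Z) (c : nat -> Z) (M : nat) : uniq S -> (0 < M)%N ->
  (forall p k, p \in S -> (k <= M)%N -> lo <= (occ (p + c k))%:R) ->
  (forall k, (k < M)%N -> adj (c k.+1 - c k)) ->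
  \sum_(p <- S) mosc (p + c 0) (p + c M) <= M%:R * (linked_var / lo ^+ 2).
Proof.
move=> uS; elim: M => // M IH _ So adjc.
have step k : (k <= M)%N ->
    \sum_(p <- S) mosc (p + c k) (p + c k.+1) <= linked_var / lo ^+ 2.
  move=> kM; rewrite (@le_trans _ _ ((\sum_(p <- S) osc (p + c k) (p + c k.+1)) / lo ^+ 2))//.
    rewrite mulr_suml !big_seq; apply: ler_sum => p pS.
    by apply: mosc_le_osc; apply: So => //; rewrite ltnW.
  by rewrite ler_wpM2r ?invr_ge0 ?exprn_ge0 ?(ltW lo_gt0)// sum_osc_shift// adjc.
case: M IH So adjc step => [|M] IH So adjc step; first by rewrite mul1r step.
rewrite -[X in X%:R]addn1 natrD mulrDl mul1r.
apply: le_trans (lerD (IH _ _ _) (step M.+1 (leqnn _))) => //; last first.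
- by move=> k kM; apply: adjc; rewrite ltnS ltnW.
- by move=> p k pS kM; apply: So => //; rewrite leqW.
rewrite -big_split/= !big_seq; apply: ler_sum => p pS.
by apply: mosc_triangle; apply: occ_gt0; apply: So => //; rewrite ltnW.
Qed.

Lemma osc_le_mosc p p' : osc p p' <= hi ^+ 2 * mosc p p'.
Proof.
have hi2 : 0 <= hi ^+ 2 * mosc p p' by rewrite mulr_ge0 ?sqr_ge0 ?mosc_ge0.
have [N0|N0] := eqVneq (occ p) 0%N.
  rewrite {1}/osc big_pred0// => i.
  by move/card0_eq: N0 => /(_ i); rewrite inE.
have [N1|N1] := eqVneq (occ p') 0%N.
  rewrite {1}/osc big1// => i _.
  rewrite big_pred0// => j.
  by move/card0_eq: N1 => /(_ j); rewrite inE.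
have -> : osc p p' = (occ p)%:R * (occ p')%:R * mosc p p'.
  rewrite moscE; have := N0; have := N1; rewrite -!(pnatr_eq0 R) => P1 P0.
  by field; rewrite P0 P1.
by rewrite ler_wpM2r ?mosc_ge0// expr2 ler_pM.
Qed.

(** Up to the linked variation, the mass of the strip [S] is at most a multiple of
    that of each of its translates; as the [J] translates are disjoint, one may
    average over them, which leaves a fraction [1 / J] of the total mass. *)
Lemma strip_mass (S : seq Z) (m : Z) (J J0 : nat) : uniq S -> (1 < J0)%N ->
  adj m ->
  (forall p s, p \in S -> (0 < s <= J * J0)%N -> lo <= (occ (p + m *+ s))%:R) ->
  (forall p p' k, p \in S -> p' \in S -> (0 < k <= J)%N ->
     p' <> p + m *+ (k * J0)) ->
  J%:R * \sum_(p <- S) mass p <=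
    J%:R * (linked_var / lo + hi * ((J * J0)%:R * (linked_var / lo ^+ 2)))
    + hi / lo * \sum_i `|u i|.
Proof.
move=> uS J01 adjm So disj.
have hi0 : 0 <= hi by apply: le_trans (occ_hi 0).
have J0_gt0 : (0 < J0)%N by rewrite ltnW.
have one j : (0 < j <= J)%N -> \sum_(p <- S) mass p <=
    (linked_var / lo + hi * ((J * J0)%:R * (linked_var / lo ^+ 2)))
    + hi / lo * \sum_(p <- S) mass (p + m *+ (j * J0)).
  move=> /andP[j0 jJ].
  have jJ0 : (1 < j * J0)%N by rewrite (leq_trans J01)// leq_pmull.
  have jJJ : (j * J0 <= J * J0)%N by rewrite leq_mul2r jJ orbT.
  apply: (@le_trans _ _ (\sum_(p <- S) (osc p (p + m) / lo +
     hi * mosc (p + m) (p + m *+ (j * J0)) + hi / lo * mass (p + m *+ (j * J0))))).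
    rewrite !big_seq; apply: ler_sum => p pS.
    have o1 : lo <= (occ (p + m))%:R.
      by rewrite -[m]mulr1n So// (leq_trans _ jJJ)// ltnW.
    have o2 : lo <= (occ (p + m *+ (j * J0)))%:R.
      by rewrite So// jJJ andbT ltnW.
    apply: le_trans (mass_le_mosc p (occ_gt0 o1) (occ_gt0 o2)) _.
    rewrite !lerD//.
    - by rewrite ler_wpM2l ?osc_ge0// lef_pV2// posrE (lt_le_trans lo_gt0).
    - by rewrite ler_wpM2r ?mosc_ge0.
    - rewrite -mulrA [lo^-1 * _]mulrC ler_pM ?divr_ge0 ?mass_ge0//.
      by rewrite ler_wpM2l ?mass_ge0// lef_pV2// posrE (lt_le_trans lo_gt0).
  rewrite !big_split/= -!mulr_sumr lerD2r// lerD//.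
    rewrite -mulr_suml ler_wpM2r ?invr_ge0 ?(ltW lo_gt0)//.
    under eq_bigr do rewrite -{1}[p in osc p]addr0.
    by apply: sum_osc_shift => //; rewrite subr0.
(* The chain starts at [p + m], the first translate that is well occupied. *)
  rewrite ler_wpM2l//.
  have jp : (j * J0).-1.+1 = (j * J0)%N by rewrite prednK// ltnW.
  apply: (@le_trans _ _ ((j * J0).-1%:R * (linked_var / lo ^+ 2))); last first.
    rewrite ler_wpM2r ?divr_ge0 ?linked_var_ge0 ?exprn_ge0 ?(ltW lo_gt0)//.
    by rewrite ler_nat (leq_trans (leq_pred _)).
  have := @sum_mosc_chain S (fun k => m *+ k.+1) (j * J0).-1 uS.
  rewrite mulr1n jp; apply.
  - by rewrite -ltnS jp.
  - by move=> p k pS; rewrite -ltnS jp => kj; rewrite So//= (leq_trans kj).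
  - by move=> k _; rewrite (mulrSr m k.+1) addrAC subrr add0r.
have -> : J%:R * \sum_(p <- S) mass p = \sum_(1 <= j < J.+1) \sum_(p <- S) mass p.
  by rewrite sumr_const_nat subn1 mulr_natl.
apply: (@le_trans _ _ (\sum_(1 <= j < J.+1)
  ((linked_var / lo + hi * ((J * J0)%:R * (linked_var / lo ^+ 2)))
    + hi / lo * \sum_(p <- S) mass (p + m *+ (j * J0))))).
  rewrite !big_nat; apply: ler_sum => j; rewrite ltnS => jJ; exact: one.
rewrite big_split/= sumr_const_nat subn1 [J%:R * (_ + _)]mulr_natl lerD2l -mulr_sumr.
rewrite ler_wpM2l ?divr_ge0 ?(ltW lo_gt0)//.
pose T := [seq p + m *+ (j * J0) | j <- index_iota 1 J.+1, p <- S].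
suff uT : uniq T.
  by apply: le_trans (sum_mass_le uT); rewrite big_allpairs_dep.
apply: allpairs_uniq; rewrite ?iota_uniq//.
move=> [j p] [j' p'] /allpairsP[[j1 p1] /= [j1J p1S [-> ->]]].
move=> /allpairsP[[j2 p2] /= [j2J p2S [-> ->]]] /=.
rewrite !mem_index_iota !ltnS in j1J j2J.
have key a b a' b' : (a < a')%N -> (0 < a)%N -> (a' <= J)%N -> b \in S -> b' \in S ->
    b + m *+ (a * J0) = b' + m *+ (a' * J0) -> False.
  move=> aa' a0 a'J bS b'S e; apply: (disj b' b (a' - a)%N) => //.
    by rewrite subn_gt0 aa' (leq_trans (leq_subr _ _)).
  rewrite mulnBl mulrnBr ?leq_mul2r ?(ltnW aa') ?orbT// addrA.
  by rewrite -e addrK.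
case: (ltngtP j1 j2) => [lt12|lt21|<-] e.
- by have [] := key _ _ _ _ lt12 _ _ p1S p2S e; case/andP: j1J; case/andP: j2J.
- by have [] := key _ _ _ _ lt21 _ _ p2S p1S (esym e); case/andP: j1J; case/andP: j2J.
- by move/addIr: e => ->.
Qed.

End cells.

(** * A Poincare inequality on the integer lattice *)

Section box.
Context {d : nat}.

Definition ibox (M : nat) (z : 'rV[int]_d) : bool :=
  [forall a, `|z 0 a| <= M%:Z].

Lemma iboxP M (z : 'rV[int]_d) : reflect (forall a, `|z 0 a| <= M%:Z) (ibox M z).
Proof. exact: forallP. Qed.

(** As [k] grows, these are the vertices of a lattice path from [0] to [z] whose
    steps have all their coordinates in {-1, 0, 1}. *)
Definition clamp (k : nat) (z : 'rV[int]_d) : 'rV[int]_d :=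
  \row_a Num.max (- k%:Z) (Num.min k%:Z (z 0 a)).

Lemma clamp0 z : clamp 0 z = 0.
Proof. by apply/rowP => a; rewrite !mxE; lia. Qed.

Lemma clamp_id k z : ibox k z -> clamp k z = z.
Proof. by move=> /iboxP kz; apply/rowP => a; rewrite !mxE; have := kz a; lia. Qed.

Lemma clamp_step k z : ibox 1 (clamp k.+1 z - clamp k z).
Proof. by apply/iboxP => a; rewrite !mxE; lia. Qed.

Lemma ibox_clamp M k z : ibox M z -> ibox M (clamp k z).
Proof. by move=> /iboxP kz; apply/iboxP => a; rewrite !mxE; have := kz a; lia. Qed.

(** Indexing the box of side [2 * M + 1] by a finite type makes its cardinal, which
    enters the constants, and sums over it available. *)
Definition offset (M : nat) (f : {ffun 'I_d -> 'I_(2 * M).+1}) : 'rV[int]_d :=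
  \row_a ((f a : nat)%:Z - M%:Z).

Lemma ibox_offset M f : ibox M (@offset M f).
Proof. by apply/iboxP => a; rewrite mxE; have := ltn_ord (f a); lia. Qed.

Lemma offset_surj M z : ibox M z -> exists f, z = @offset M f.
Proof.
move=> /iboxP Mz.
exists [ffun a => inord (absz (z 0 a + M%:Z))]; apply/rowP => a.
by rewrite mxE ffunE inordK; have := Mz a; lia.
Qed.

Context {R : realType} {n : nat}.
Variables (q : 'I_n -> 'rV[int]_d) (u : 'I_n -> R) (adj : pred 'rV[int]_d).
Variables (lo hi : R).
Hypothesis lo_gt0 : 0 < lo.
Hypothesis occ_hi : forall p, (occ q p)%:R <= hi.

(** Pairs of points are sorted by the offset between their cells; all the pairs
    with a given offset are joined by translating one fixed path. *)
Lemma poincare_cells (good : pred 'I_n) (M : nat) : (0 < M)%N ->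
  (forall z, ibox 1 z -> adj z) ->
  (forall i z, good i -> ibox M z -> lo <= (occ q (q i + z))%:R) ->
  \sum_(i | good i) \sum_(j | ibox M (q j - q i)) `|u i - u j| <=
  (((2 * M).+1 ^ d)%N)%:R * (hi ^+ 2 * (M%:R * (linked_var q u adj / lo ^+ 2))).
Proof.
move=> M0 adj1 full.
pose S := undup [seq q i | i <- enum good].
have SP p : p \in S -> exists2 i, good i & p = q i.
  by rewrite mem_undup => /mapP[i]; rewrite mem_enum => gi ->; exists i.
have qS i : good i -> q i \in S.
  by move=> gi; rewrite mem_undup map_f// mem_enum.
apply: (@le_trans _ _ (\sum_(f : {ffun 'I_d -> 'I_(2 * M).+1})
   \sum_(p <- S) osc q u p (p + offset f))).
  apply: (@le_trans _ _ (\sum_(i | good i)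
     \sum_(f : {ffun 'I_d -> 'I_(2 * M).+1})
     \sum_(j | q j == q i + offset f) `|u i - u j|)).
    apply: ler_sum => i gi.
    rewrite (exchange_big_dep predT)//= big_mkcond/=; apply: ler_sum => j _.
    case: ifP => [/offset_surj[f qf]|_]; last exact: sumr_ge0.
    rewrite (bigD1 f)/=; last by rewrite -qf addrC subrK.
    by rewrite lerDl sumr_ge0.
  rewrite exchange_big/=; apply: ler_sum => f _.
  rewrite /osc [leRHS](exchange_big_dep predT)//= big_mkcond/=; apply: ler_sum => i _.
  case: ifPn => [gi|_]; last by apply: sumr_ge0 => p _; exact: sumr_ge0.
  rewrite -[leRHS]big_filter (bigD1_seq (q i))/= ?filter_uniq ?undup_uniq//.
    by rewrite lerDl sumr_ge0// => p _; exact: sumr_ge0.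
  by rewrite mem_filter eqxx qS.
have -> : ((2 * M).+1 ^ d)%N = #|{ffun 'I_d -> 'I_(2 * M).+1}|.
  by rewrite card_ffun !card_ord.
rewrite mulr_natl -sumr_const; apply: ler_sum => f _.
apply: (@le_trans _ _ (\sum_(p <- S) hi ^+ 2 * mosc q u p (p + offset f))).
  by apply: ler_sum => p _; exact: osc_le_mosc.
rewrite -mulr_sumr ler_wpM2l ?sqr_ge0//.
have := @sum_mosc_chain _ _ _ q u adj lo lo_gt0 S (clamp^~ (offset f)) M.
rewrite clamp0 clamp_id ?ibox_offset// => /(_ (undup_uniq _) M0).
under eq_bigr do rewrite addr0.
apply.
  by move=> p k /SP[i gi ->] _; apply: full => //; exact/ibox_clamp/ibox_offset.
by move=> k _; exact/adj1/clamp_step.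
Qed.

End box.

(** * The interior cone condition *)

Section geometry.
Context {R : realType} {d : nat}.
Local Notation E := 'rV[R]_d.
Implicit Types (x y : E) (D : set E).

Definition supclose (r : R) (y y' : E) := forall a, `|y 0 a - y' 0 a| <= r.

Lemma supclose_sym r y y' : supclose r y y' -> supclose r y' y.
Proof. by move=> yy' a; rewrite distrC. Qed.

Lemma supclose_trans r r' y y' y'' :
  supclose r y y' -> supclose r' y' y'' -> supclose (r + r') y y''.
Proof.
move=> h h' a; rewrite (le_trans (ler_distD (y' 0 a) _ _))//.
by rewrite lerD.
Qed.

Lemma supcloseW r r' y y' : r <= r' -> supclose r y y' -> supclose r' y y'.
Proof. by move=> rr' h a; exact: le_trans (h a) rr'. Qed.

Lemma coord_le_enorm (v : E) a : `|v 0 a| <= enorm v.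
Proof.
rewrite -sqrtr_sqr ler_wsqrtr// (bigD1 a)//= lerDl.
by apply: sumr_ge0 => i _; exact: sqr_ge0.
Qed.

Lemma enorm_le (v : E) r : (forall a, `|v 0 a| <= r) -> 0 <= r ->
  enorm v <= d%:R * r.
Proof.
move=> vr r0; have dr : 0 <= d%:R * r by rewrite mulr_ge0.
rewrite -[leRHS]ger0_norm// -sqrtr_sqr ler_wsqrtr//.
apply: (@le_trans _ _ (\sum_(i < d) r ^+ 2)).
  by apply: ler_sum => i _; rewrite -[leLHS]real_normK ?num_real// lerXn2r ?nnegrE.
rewrite sumr_const card_ord -[leLHS]mulr_natl exprMn ler_wpM2r ?sqr_ge0//.
rewrite expr2 -natrM ler_nat; case: (d) => // k; exact: leq_pmull.
Qed.

Lemma enorm_ge0 (v : E) : 0 <= enorm v. Proof. exact: sqrtr_ge0. Qed.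

(** A form of the interior cone condition in which the axis of the cone is an
    integer vector, so that moving along it preserves a grid. Asking for cones at
    all the points near [y] makes the condition stable under displacements of
    [y]. *)
Definition cone D (r : R) (y : E) (m : 'rV[int]_d) :=
  forall (y' y'' : E) (t : R), D y' -> supclose r y' y -> 0 < t <= r ->
    (forall a, `|y'' 0 a - y' 0 a - t * (m 0 a)%:~R| <= t) -> D y''.

Lemma coneW D r r' r'' x y m : r' + r'' <= r -> 0 <= r'' ->
  supclose r'' y x -> cone D r x m -> cone D r' y m.
Proof.
move=> r'r r''0 yx Dxm y' y'' t Dy' y'y /andP[t0 tr'].
have r'0 : 0 < r' by exact: lt_le_trans tr'.
apply: Dxm => //.
  exact/(supcloseW r'r)/(supclose_trans y'y).
by rewrite t0 (le_trans tr')// (le_trans _ r'r)// lerDl.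
Qed.

(** Away from the boundary the axis [0] is enough, since the points considered
    stay in a ball around [x]. *)
Lemma cone_interior D x : open D -> D x -> exists2 r : R, 0 < r & cone D r x 0.
Proof.
move=> oD Dx.
have /nbhs_ballP[e /= e0 eD] : nbhs x D by exact: open_nbhs_nbhs.
exists (e / 3); first by rewrite divr_gt0.
move=> y' y'' t _ y'x /andP[t0 te] y''y'; apply: eD.
split => // i a; rewrite (ord1 i) /ball/=.
have := y''y' a; have := y'x a; rewrite mxE mulr0 subr0 => h1 h2.
rewrite distrC (le_lt_trans (ler_distD (y' 0 a) _ _))//.
rewrite (le_lt_trans (lerD h2 h1))// (@le_lt_trans _ _ (e / 3 + e / 3)) ?lerD//.
lra.
Qed.

Lemma lipschitz_cst (e : nat) (g : 'rV[R]_e -> R^o) : lipschitz g ->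
  exists2 L : R, 0 <= L & forall a b, `|g a - g b| <= L * `|a - b|.
Proof.
move=> [M [_ Mg]]; exists (`|M| + 1); first by rewrite addr_ge0.
have /Mg h : M < `|M| + 1 by rewrite (le_lt_trans (ler_norm M))// ltrDl.
by move=> a b; apply: (h (a, b)).
Qed.

Lemma mx_norm_le (e : nat) (v : 'rV[R]_e) r : 0 <= r ->
  (forall a, `|v 0 a| <= r) -> `|v| <= r.
Proof.
move=> r0 vr; rewrite [leLHS]/Num.Def.normr /= mx_normrE; apply/bigmax_leP.
by split => //= -[i a] _; rewrite (ord1 i).
Qed.

Lemma mx_norm_coord (e : nat) (v : 'rV[R]_e) a : `|v 0 a| <= `|v|.
Proof.
rewrite [leRHS]/Num.Def.normr /= mx_normrE; apply/bigmax_geP; right => /=.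
by exists (0, a).
Qed.

(** Rounding a long multiple of the inner axis of the epigraph to an integer
    vector perturbs it by a bounded amount, which the Lipschitz bound absorbs. *)
Lemma cone_boundary D x : lipschitz_boundary D -> (closure D `\` interior D) x ->
  exists2 r : R, 0 < r & exists m, cone D r x m.
Proof.
move=> lD /lD[Q [i [g [r [QQ /lipschitz_cst[L L0 gL] r0 Dg]]]]].
pose C : R := \sum_a \sum_b `|Q a b|.
have C0 : 0 <= C by apply: sumr_ge0 => a _; exact: sumr_ge0.
(* The rounding error moves a point by at most [t * (C *+ 2)] in the rotated
   coordinates, hence the graph of [g] by [L] times that; [N] makes up for both. *)
pose N := C *+ 2 * (1 + L).
pose m : 'rV[int]_d := \row_a Num.floor (N * Q a i).
pose Mx : R := \sum_a `|(m 0 a)%:~R : R|.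
have Mx0 : 0 <= Mx by exact: sumr_ge0.
have mMx a : `|(m 0 a)%:~R : R| <= Mx.
  by rewrite /Mx (bigD1 a)//= lerDl sumr_ge0.
have dM0 : 0 < d%:R * (2 + Mx) + 1.
  by rewrite ltr_wpDl// mulr_ge0// addr_ge0.
pose r' := r / (d%:R * (2 + Mx) + 1).
have r'0 : 0 < r' by rewrite divr_gt0.
have near_x y : supclose (r' * (2 + Mx)) y x -> enorm (y - x) < r.
  move=> yx; apply: (@le_lt_trans _ _ (d%:R * (r' * (2 + Mx)))).
    apply: enorm_le; first by move=> a; rewrite !mxE; exact: yx.
    by rewrite mulr_ge0 ?addr_ge0// ltW.
  rewrite mulrCA /r' -mulrA gtr_pMr// mulrC ltr_pdivrMr// mul1r ltrDl ltr01//.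
exists r' => //; exists m => y' y'' t Dy' y'x /andP[t0 tr'] y''y'.
have {}y'x : supclose r' y' x := y'x.
have y'r : enorm (y' - x) < r.
  by apply/near_x; apply: supcloseW y'x; rewrite ler_peMr ?ltW//; lra.
have y''r : enorm (y'' - x) < r.
  apply/near_x => a.
  have := y''y' a; have := y'x a; have := mMx a.
  set M := (m 0 a)%:~R => h1 h2 h3.
  have h4 : `|t * M| <= r' * Mx by rewrite normrM (gtr0_norm t0) ler_pM// ltW.
  move: h1 h2 h3 h4; rewrite !ler_norml; lra.
apply/(Dg _ y''r).
pose w : E := y'' - y' - (t * N) *: row i Q^T.
have wt a : `|w 0 a| <= t *+ 2.
  have := y''y' a; rewrite !mxE.
  have := floor_itv (N * Q a i); set F := (Num.floor _)%:~R.
  rewrite intrD -/F => /andP[h1 h2].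
  have h3 : `|t * F - t * N * Q a i| <= t.
    rewrite -mulrA -mulrBr normrM (gtr0_norm t0) ger_pMr// ler_norml; lra.
  move: h3; rewrite !ler_norml; lra.
have wQ b : `|(w *m Q) 0 b| <= t * (C *+ 2).
  rewrite mxE (le_trans (ler_norm_sum _ _ _))//.
  apply: (@le_trans _ _ (\sum_a (t *+ 2) * `|Q a b|)).
    by apply: ler_sum => a _; rewrite normrM ler_wpM2r.
  rewrite -mulr_sumr mulrnAr -mulrnAl ler_wpM2l ?mulrn_wge0 ?(ltW t0)//.
  by rewrite /C; apply: ler_sum => a _; rewrite (bigD1 b)//= lerDl sumr_ge0.
have y''Q : y'' *m Q = y' *m Q + (t * N) *: delta_mx 0 i + w *m Q.
  have -> : delta_mx 0 i = row i Q^T *m Q.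
    by rewrite -row_mul (mulmx1C QQ) row1.
  rewrite scalemxAl -!mulmxDl; congr (_ *m Q).
  by rewrite /w; apply/rowP => a; rewrite !mxE; ring.
have := (Dg _ y'r).1 Dy'; rewrite {}y''Q.
set v' := y' *m Q; set wq := w *m Q.
move: wQ; rewrite -/wq => wQ; clearbody v' wq.
have -> : (v' + (t * N) *: delta_mx 0 i + wq) 0 i = v' 0 i + t * N + wq 0 i.
  by rewrite !mxE !eqxx mulr1.
have gle : `|g (col' i (v' + (t * N) *: delta_mx 0 i + wq)) - g (col' i v')| <=
    L * (t * (C *+ 2)).
  apply: le_trans (gL _ _) _; apply: ler_wpM2l => //.
  apply: mx_norm_le; first by rewrite mulr_ge0 ?mulrn_wge0// ltW.
  move=> a; rewrite !mxE eqxx/= eq_sym (negbTE (neq_lift i a)) mulr0 addr0.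
  by rewrite addrAC subrr add0r wQ.
have := wQ i.
move: gle; rewrite !ler_norml /N; lra.
Qed.

(** Compactness of the closure makes the size of the cones and the length of
    their axes uniform. *)
Lemma uniform_cone D : open D -> bounded_set D -> lipschitz_boundary D ->
  exists2 N : nat, (0 < N)%N &
    forall y, D y -> exists2 m, ibox N m & cone D N%:R^-1 y m.
Proof.
move=> oD [M [Mreal DM]] lD.
have cD : compact (closure D).
  pose K := [set v : E | forall a, `[(- (M + 1)), (M + 1)]%classic (v 0 a)].
  have cK : compact K by apply: (rV_compact (fun=> @segment_compact _ _ _)).
  apply: (subclosed_compact (@closed_closure _ _) cK).
  rewrite closureE => y; apply; split.
    by apply: compact_closed => //; exact: norm_hausdorff.
  move=> z /DM zM a; rewrite /= in_itv/= -ler_norml.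
  by apply: le_trans (mx_norm_coord _ _) (zM _ _); rewrite ltrDl.
have local x : closure D x -> exists2 r : R, 0 < r & exists m, cone D r x m.
  move=> cDx; have [Dx|nDx] := pselect (D x).
    by have [r r0 rx] := cone_interior oD Dx; exists r => //; exists 0.
  apply: cone_boundary => //; split => //; move/interior_id: oD => -> //.
have /compact_near_coveringP := cD.
move=> /(_ nat \oo (fun N y => exists2 m, ibox N m & cone D N%:R^-1 y m) _) h.
have /h[N _ Nh] : forall x, closure D x ->
    \forall x' \near x & N \near \oo, exists2 m, ibox N m & cone D N%:R^-1 x' m.
  move=> x /local[r r0 [m rm]].
  have [k _ kr] := near_infty_natSinv_lt (PosNum (divr_gt0 r0 (ltr0n R 2))).
  pose K := maxn k.+1 (\max_a absz (m 0%R a)).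
  exists (ball x k.+1%:R^-1, [set N | (K <= N)%N]).
    by split; [exact: nbhsx_ballx|exists K].
  move=> [y N] [/= xy KN]; exists m.
    apply/iboxP => a; have : (absz (m 0%R a) <= K)%N.
      by rewrite leq_max; apply/orP; right; exact: leq_bigmax.
    lia.
  have kN : (k <= N.-1)%N by move: KN; rewrite /K; lia.
  have N0 : (0 < N)%N by move: KN; rewrite /K; lia.
  have := kr _ kN; rewrite /= prednK// => Nr.
  have := kr _ (leqnn k); rewrite /= => kr2.
  apply: (coneW _ _ _ rm); last first.
  - move=> a; rewrite distrC ltW//; case: xy => _ /(_ 0 a); exact.
  - by rewrite invr_ge0.
  - by rewrite [leRHS](splitr r) lerD// ltW.
exists N.+1 => // y Dy; apply: (Nh N.+1) => //=.
exact: subset_closure.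
Qed.

End geometry.

(** * Mass and oscillation near the boundary *)

Section grid.
Context {R : realType} {d : nat}.
Local Notation E := 'rV[R]_d.
Implicit Types (y : E) (D : set E) (p m : 'rV[int]_d).

Definition cell (h : R) (y : E) : 'rV[int]_d := \row_a Num.floor (y 0 a / h).

Lemma cell_diff h y y' a : 0 < h ->
  `|y 0 a - y' 0 a - h * ((cell h y - cell h y') 0 a)%:~R| < h.
Proof.
move=> h0; rewrite !mxE rmorphB/=.
have := floor_itv (y 0 a / h); have := floor_itv (y' 0 a / h).
rewrite !intrD; set F := (Num.floor _)%:~R; set F' := (Num.floor _)%:~R.
rewrite !ler_pdivlMr// !ltr_pdivrMr// => /andP[h1 h2] /andP[h3 h4].
rewrite ltr_norml; lra.
Qed.

Lemma supclose_cell h K y y' : 0 < h -> supclose (K%:R * h) y y' ->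
  ibox K (cell h y - cell h y').
Proof.
move=> h0 yy'; apply/iboxP => a.
have := cell_diff y y' a h0; have := yy' a.
set z := (cell h y - cell h y') 0 a => h1 h2.
suff : `|z|%:~R < K%:R + 1 :> R.
  by rewrite -[K%:R]/(K%:Z%:~R) -(intrD _ _ 1) ltr_int; lia.
rewrite -(ltr_pM2l h0) intr_norm -[X in X * `|_|](gtr0_norm h0) -normrM.
rewrite -[X in `|X|](subrK (y 0 a - y' 0 a)) (le_lt_trans (ler_normD _ _))//.
rewrite distrC; lra.
Qed.

Lemma cell_mulr h p : 0 < h -> cell h (\row_a (h * (p 0 a)%:~R)) = p.
Proof.
by move=> h0; apply/rowP => a; rewrite !mxE mulrC mulKf ?gt_eqF// intrKfloor.
Qed.

Lemma mulrn_coord m k a : ((m *+ k) 0 a)%:~R = (m 0 a)%:~R * k%:R :> R.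
Proof. by rewrite mulmxnE rmorphMn/= mulr_natr. Qed.

Definition full D h p := forall y, cell h y = p -> D y.

(** The strip of depth [J0] cells along the part of the boundary where [m] is an
    inner axis. Measuring depth along the axis, rather than by the distance to the
    boundary, is what makes its translates by multiples of [m *+ J0] disjoint. *)
Definition strip D (r h : R) (J0 : nat) m p :=
  (exists y, [/\ D y, cell h y = p & cone D r y m]) /\
  (forall y, cell h y = p - m *+ J0 -> ~ D y).

(** At distance [s * h] along the axis the cone is [s * h] thick, hence contains
    a whole cell. *)
Lemma cone_full D r h y m (s : nat) : 0 < h -> (0 < s)%N -> s%:R * h <= r ->
  D y -> cone D r y m -> full D h (cell h y + m *+ s).
Proof.
move=> h0 s0 shr Dy ym y'' y''E; apply: (ym y y'' (s%:R * h)) => //.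
- move=> a; rewrite subrr normr0 (le_trans _ shr)// mulr_ge0// ltW//.
- by rewrite shr mulr_gt0// ltr0n.
- move=> a; have := cell_diff y'' y a h0.
  have -> : cell h y'' - cell h y = m *+ s by rewrite y''E addrAC subrr add0r.
  rewrite mulrn_coord [h * _]mulrCA [_ * (h * _)]mulrC [h * _]mulrC => /ltW/le_trans; apply.
  by rewrite ler_peMl ?(ltW h0)// ler1n.
Qed.

(** Going back [J0] steps from [p + m *+ (k * J0)] leads to [p] itself or to a cell
    which is full by [cone_full]; both meet [D], which the strip excludes. *)
Lemma strip_disjoint D r h J0 m p p' k : 0 < h -> (0 < J0)%N -> (0 < k)%N ->
  (k * J0)%:R * h <= r -> strip D r h J0 m p -> strip D r h J0 m p' ->
  p' <> p + m *+ (k * J0).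
Proof.
move=> h0 J00 k0 kr [[y [Dy yp ym]] _] [_ np'] p'E.
have {}np' y' : cell h y' = p + m *+ (k.-1 * J0) -> ~ D y'.
  move=> y'E; apply: np'; rewrite y'E p'E -addrA; congr (_ + _).
  by rewrite -{2}(prednK k0) mulSn mulrnDr addrAC subrr add0r.
have [k1|k1] := posnP (k.-1 * J0)%N.
  by apply: (np' y) => //; rewrite k1 mulr0n addr0.
have := @cone_full D r h y m (k.-1 * J0) h0 k1 _ Dy ym.
rewrite yp => fl; apply: (np' _ (cell_mulr _ h0)); apply: fl.
  rewrite (le_trans _ kr)// ler_pM2r// ler_nat leq_mul2r leq_pred orbT//.
exact: cell_mulr.
Qed.

(** If going back along the axis does not leave [D], the cone issued from there
    contains a box around [y] whose size is proportional to [J0]. *)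
Lemma strip_or_deep D (r h : R) (N J0 : nat) y m : 0 < h -> (0 < J0)%N ->
  h + J0%:R * h * N%:R <= r -> J0%:R * h <= r ->
  D y -> ibox N m -> cone D r y m ->
  strip D r h J0 m (cell h y) \/
  (forall v, supclose ((J0%:R - 1) * h) v y -> D v).
Proof.
move=> h0 J00 hr1 hr2 Dy /iboxP Nm ym.
have [[y' [Dy' y'E]]|ex] :=
  pselect (exists y', D y' /\ cell h y' = cell h y - m *+ J0); last first.
  by left; split => [|y' y'E Dy']; [exists y|apply: ex; exists y'].
right => v vy; apply: (ym y' v (J0%:R * h)) => //.
- move=> a; have := cell_diff y' y a h0.
  have -> : cell h y' - cell h y = - (m *+ J0) by rewrite y'E addrAC subrr add0r.
  rewrite mxE rmorphN/= mulrn_coord.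
  have Na : `|(m 0 a)%:~R * J0%:R| <= N%:R * J0%:R :> R.
    rewrite normrM [X in _ * X]ger0_norm// ler_pM2r ?ltr0n// -intr_norm.
    by rewrite -[N%:R]/(N%:Z%:~R) ler_int.
  have : `|h * ((m 0 a)%:~R * J0%:R)| <= h * (N%:R * J0%:R).
    by rewrite normrM gtr0_norm// ler_pM2l.
  move: hr1; rewrite ltr_norml !ler_norml; nra.
- by rewrite hr2 mulr_gt0// ltr0n.
- move=> a; have := vy a; have := cell_diff y' y a h0.
  have -> : cell h y' - cell h y = - (m *+ J0) by rewrite y'E addrAC subrr add0r.
  rewrite mxE rmorphN/= mulrn_coord.
  rewrite ltr_norml !ler_norml; lra.
Qed.

End grid.

(** In what follows, [h] is the mesh of the fine grid, [s] the diameter of the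
    classes, [J0] the depth of the boundary strip in fine cells, [J] the number of
    translates of the strip that are averaged, and [M] the length of the lattice
    paths inside a class. *)
Section estimate.
Context {R : realType} {d : nat} {n : nat} {T : eqType}.
Variables (D : set 'rV[R]_d) (N : nat) (x : 'I_n -> 'rV[R]_d) (u : 'I_n -> R).
Variables (c : 'I_n -> T) (h s lo hi gam : R) (J J0 M : nat).
Let q i := cell h (x i).
Let G := linked_var q u (ibox N).
Let same i j := c j == c i.
Let cnt i : nat := #|[pred j | same i j]|.

Hypothesis N_gt0 : (0 < N)%N.
Hypothesis coneD : forall y, D y -> exists2 m, ibox N m & cone D N%:R^-1 y m.
Hypothesis xD : forall i, D (x i).
Hypothesis h_gt0 : 0 < h.
Hypothesis lo_gt0 : 0 < lo.
Hypothesis gam_gt0 : 0 < gam.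
Hypothesis occ_hi : forall p, (occ q p)%:R <= hi.
Hypothesis occ_lo : forall p, full D h p -> lo <= (occ q p)%:R.
Hypothesis same_close : forall i j, same i j -> supclose s (x j) (x i).
Hypothesis cnt_lo : forall i, (forall v, supclose (s + s) v (x i) -> D v) ->
  gam <= (cnt i)%:R.
Hypothesis J_gt0 : (0 < J)%N.
Hypothesis J0_gt1 : (1 < J0)%N.
Hypothesis M_gt0 : (0 < M)%N.
Hypothesis sJ0 : s + s + s <= (J0%:R - 1) * h.
Hypothesis JJ0 : (J * J0)%:R * h <= N%:R^-1.
Hypothesis J0N : h + J0%:R * h * N%:R <= N%:R^-1.
Hypothesis sM : s <= M%:R * h.
Hypothesis Ms : (M%:R + 1) * h <= s + s.

Let inS i := `[< exists2 m, ibox N m & strip D N%:R^-1 h J0 m (q i) >].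
Let deep i := `[< forall v, supclose (s + s) v (x i) -> D v >].

Let stripB : R := G / lo + hi * ((J * J0)%:R * (G / lo ^+ 2))
  + hi / lo * (\sum_i `|u i|) / J%:R.

(** The axis of the cone depends on the point but takes finitely many values, and
    [strip_mass] applies to the strip of each of them. *)
Lemma strip_total : \sum_(i | inS i) `|u i| <= ((2 * N).+1 ^ d)%N%:R * stripB.
Proof.
pose S f := undup [seq q i | i <- enum 'I_n &
  `[< strip D N%:R^-1 h J0 (@offset d N f) (q i) >]].
have SP f p : p \in S f -> strip D N%:R^-1 h J0 (offset f) p.
  by rewrite mem_undup => /mapP[i]; rewrite mem_filter => /andP[/asboolP + _] ->.
apply: (@le_trans _ _ (\sum_(f : {ffun 'I_d -> 'I_(2 * N).+1})
    \sum_(p <- S f) mass q u p)).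
  rewrite /mass.
  have -> : \sum_(f : {ffun 'I_d -> 'I_(2 * N).+1})
      \sum_(p <- S f) \sum_(i | q i == p) `|u i| =
      \sum_(f : {ffun 'I_d -> 'I_(2 * N).+1})
      \sum_i \sum_(p <- S f | q i == p) `|u i|.
    by apply: eq_bigr => f _; rewrite (exchange_big_dep predT).
  rewrite exchange_big/= big_mkcond/=; apply: ler_sum => i _.
  case: ifPn => [/asboolP[m /offset_surj[f ->] ms]|_]; last first.
    by apply: sumr_ge0 => f _; exact: sumr_ge0.
  rewrite (bigD1 f)//= -[leLHS]addr0 lerD//; last first.
    by apply: sumr_ge0 => g _; exact: sumr_ge0.
  rewrite -[leRHS]big_filter (bigD1_seq (q i))/= ?filter_uniq ?undup_uniq//.
    by rewrite lerDl sumr_ge0.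
  rewrite mem_filter eqxx mem_undup map_f// mem_filter mem_enum andbT.
  exact/asboolP.
have -> : ((2 * N).+1 ^ d)%N = #|{ffun 'I_d -> 'I_(2 * N).+1}|.
  by rewrite card_ffun !card_ord.
rewrite mulr_natl -sumr_const; apply: ler_sum => f _.
rewrite -(ler_pM2l (_ : 0 < J%:R)) ?ltr0n// /stripB mulrDr.
rewrite [J%:R * (_ / J%:R)]mulrC divfK ?pnatr_eq0 -?lt0n//.
have J00 : (0 < J0)%N by exact: ltnW.
have kh k : (k <= J * J0)%N -> k%:R * h <= N%:R^-1.
  by move=> kJ; rewrite (le_trans _ JJ0)// ler_pM2r// ler_nat.
apply: strip_mass => //.
- exact: undup_uniq.
- exact: ibox_offset.
- move=> p k /SP[[y [Dy yp ym]] _] /andP[k0 kJ]; apply: occ_lo.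
  by rewrite -yp; apply: cone_full ym => //; exact: kh.
- move=> p p' k /SP pS /SP p'S /andP[k0 kJ].
  by apply: strip_disjoint pS p'S => //; rewrite kh// leq_mul2r kJ orbT.
Qed.

Lemma deep_pairs : \sum_(i | deep i) \sum_(j | same i j) `|u i - u j| <=
  ((2 * M).+1 ^ d)%N%:R * (hi ^+ 2 * (M%:R * (G / lo ^+ 2))).
Proof.
apply: (@le_trans _ _ (\sum_(i | deep i) \sum_(j | ibox M (q j - q i)) `|u i - u j|)).
  apply: ler_sum => i di; rewrite big_mkcond [leRHS]big_mkcond/=.
  apply: ler_sum => j _; case: ifPn => [ij|_]; last by case: ifP.
  rewrite ifT//; apply: supclose_cell => //.
  exact: supcloseW sM (same_close ij).
apply: poincare_cells => //.
  by move=> z /iboxP z1; apply/iboxP => a; have := z1 a; lia.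
move=> i z /asboolP di /iboxP Mz; apply: occ_lo => v vE; apply: di => a.
have := cell_diff v (x i) a h_gt0.
have -> : cell h v - cell h (x i) = z by rewrite vE addrAC subrr add0r.
have Ma : `|h * (z 0 a)%:~R| <= h * M%:R.
  by rewrite normrM gtr0_norm// ler_pM2l// -intr_norm -[M%:R]/(M%:Z%:~R) ler_int.
move: Ma Ms; rewrite ltr_norml !ler_norml; lra.
Qed.

(** The strip is at least three class diameters thick, so that a class which
    comes close to the boundary lies in it as a whole. *)
Lemma not_deep_strip i j : same i j -> ~~ deep i -> inS i && inS j.
Proof.
move=> ij /asboolP ndi.
have J00 : (0 < J0)%N by exact: ltnW.
have J0h : J0%:R * h <= N%:R^-1.
  by rewrite (le_trans _ JJ0)// ler_pM2r// ler_nat leq_pmull.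
have key k : supclose s (x k) (x i) -> inS k.
  move=> ki; have [m Nm km] := coneD (xD k).
  have [st|dp] := strip_or_deep h_gt0 J00 J0N J0h (xD k) Nm km.
    by apply/asboolP; exists m.
  exfalso; apply: ndi => v vi; apply: dp.
  exact/(supcloseW sJ0)/(supclose_trans vi)/supclose_sym.
have s0 : 0 <= s.
  move: Ms; have : 0 < (M%:R + 1) * h by rewrite mulr_gt0// ltr_wpDl.
  lra.
apply/andP; split; apply: key; last exact: same_close.
by move=> a; rewrite subrr normr0.
Qed.

(** Classes away from the boundary are controlled by the Poincare inequality along
    lattice paths, the others by the smallness of the mass on the strip. *)
Lemma coarse_oscillation :
  \sum_i (cnt i)%:R^-1 * \sum_(j | same i j) `|u i - u j| <=
  gam^-1 * (((2 * M).+1 ^ d)%N%:R * (hi ^+ 2 * (M%:R * (G / lo ^+ 2))))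
  + (((2 * N).+1 ^ d)%N%:R * stripB) *+ 2.
Proof.
have same_sym i j : same i j = same j i by rewrite /same eq_sym.
have cntE i j : same i j -> cnt i = cnt j.
  by move=> /eqP ij; apply: eq_card => k; rewrite !inE /same ij.
have cnt0 i : (0 < cnt i)%N.
  by apply/card_gt0P; exists i; rewrite inE /same.
rewrite (bigID deep)/=; apply: lerD.
  apply: le_trans (ler_wpM2l _ deep_pairs); last by rewrite invr_ge0 ltW.
  rewrite mulr_sumr; apply: ler_sum => i /asboolP di.
  rewrite ler_wpM2r ?sumr_ge0// lef_pV2 ?posrE ?ltr0n// cnt_lo//.
(* Symmetric weights whose rows sum to at most one: pairs inside the strip then
   contribute at most twice the mass of the strip. *)
pose w i j : R := if same i j && inS i && inS j then (cnt i)%:R^-1 else 0.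
have w0 i j : 0 <= w i j by rewrite /w; case: ifP; rewrite ?invr_ge0.
have ws i j : w i j = w j i.
  rewrite /w (same_sym j i); have [ij|] := boolP (same i j) => //=.
  by rewrite andbC (cntE _ _ ij).
have wle i : \sum_j w i j <= (inS i)%:R.
  apply: (@le_trans _ _ (\sum_(j | same i j) (inS i)%:R * (cnt i)%:R^-1)).
    rewrite [leRHS]big_mkcond/=; apply: ler_sum => j _; rewrite /w.
    case: (same i j) => //=; case: (inS i) => /=; rewrite ?mul0r ?mul1r//.
    by case: ifP; rewrite ?invr_ge0.
  rewrite sumr_const -[leLHS]mulr_natr -mulrA mulVf ?mulr1//.
  by rewrite pnatr_eq0 -lt0n.
apply: (@le_trans _ _ (\sum_i \sum_j w i j * (`|u i| + `|u j|))).
  rewrite [leLHS]big_mkcond/=; apply: ler_sum => i _.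
  case: ifPn => [ndi|_]; last by apply: sumr_ge0 => j _; rewrite mulr_ge0 ?addr_ge0.
  rewrite mulr_sumr [leLHS]big_mkcond/=; apply: ler_sum => j _.
  case: ifPn => [ij|_]; last by rewrite mulr_ge0 ?addr_ge0.
  have /andP[Si Sj] := not_deep_strip ij ndi.
  by rewrite /w ij Si Sj/= ler_wpM2l ?invr_ge0// ler_normB.
under eq_bigr do (under eq_bigr do rewrite mulrDr; rewrite big_split/=).
rewrite big_split/= [X in _ + X]exchange_big/=.
have -> : \sum_j \sum_i w i j * `|u j| = \sum_i \sum_j w i j * `|u i|.
  by apply: eq_bigr => i _; apply: eq_bigr => j _; rewrite ws.
rewrite -mulr2n lerMn2r/=; apply: le_trans strip_total.
rewrite [leRHS]big_mkcond/=; apply: ler_sum => i _; rewrite -mulr_suml.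
have := wle i; case: (inS i) => /= wi.
  by rewrite -[leRHS]mul1r ler_wpM2r.
by rewrite -[leRHS](mul0r `|u i|) ler_wpM2r.
Qed.

End estimate.

(** * Binomial tails and the Borel-Cantelli lemma *)

Lemma measure_fin_union_le d (T : measurableType d) (R : realType)
    (mu : {measure set T -> \bar R}) (I : finType) (Q : pred I) (F : I -> set T) :
  (forall i, measurable (F i)) ->
  (mu (\bigcup_(i in [set` Q]) F i) <= \sum_(i | Q i) mu (F i))%E.
Proof.
move=> mF; rewrite bigcup_pred.
suff [] : measurable (\big[setU/set0]_(t in Q) F t) /\
  (mu (\big[setU/set0]_(t in Q) F t) <= \sum_(i | Q i) mu (F i))%E by [].
apply: (big_ind2 (fun A b => measurable A /\ (mu A <= b)%E)) => //.
- by rewrite measure0.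
- move=> A a B b [mA Aa] [mB Bb]; split; first exact: measurableU.
  by apply: (@le_trans _ _ (mu A + mu B)%E); [exact: measureU2|exact: leeD].
Qed.

Section counting.
Context (R : realType) dO dT (Omega : measurableType dO) (T : measurableType dT).
Variables (P : probability Omega R) (X : nat -> {RV P >-> T}).
Variable nu : set T -> \bar R.
Hypothesis X_iid : iid X nu.

Definition count_in (n : nat) (A : set T) (w : Omega) : nat :=
  #|[pred i : 'I_n | X i w \in A]|.

(** The event that the indices of the sample points falling in [A] are exactly
    those of [S]. Its probability is given by independence, and the tails of the
    count are finite unions of such events. *)
Let pattern n (A : set T) (S : {set 'I_n}) : set Omega :=
  \bigcap_(i in [set` iota 0 n])
    (X i @^-1` (if [exists j in S, val j == i] then A else ~` A)).

Lemma RV_preimage_measurable i A : measurable A -> measurable (X i @^-1` A).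
Proof. by move=> mA; rewrite -[X in measurable X]setTI; exact: measurable_funPT. Qed.

Let pattern_measurable n A S : measurable A -> measurable (@pattern n A S).
Proof.
move=> mA; apply: fin_bigcap_measurable => // i _.
by apply: RV_preimage_measurable; case: ifP => // _; exact: measurableC.
Qed.

Let patternP n A S w :
  @pattern n A S w <-> S = [set i : 'I_n | X i w \in A]%SET.
Proof.
have exE (i : 'I_n) : [exists j in S, val j == val i] = (i \in S).
  apply/existsP/idP => [[j /andP[jS /eqP/val_inj <-//]]|iS].
  by exists i; rewrite iS eqxx.
split=> [Sw|-> i].
  apply/setP => i; rewrite inE.
  have := Sw (val i); rewrite /= mem_iota/= add0n ltn_ord exE => /(_ isT).
  by case: ifP => _ wA; [rewrite mem_set|rewrite memNset].
rewrite /= mem_iota/= add0n => ilt.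
case: ifPn => [/existsP[j /andP[]]|].
  by rewrite inE => /[swap] /eqP <- /set_mem.
move=> /existsPn /(_ (Ordinal ilt)); rewrite inE eqxx andbT => + wA.
by rewrite mem_set.
Qed.

Lemma setC_in_measure A p : measurable A -> nu A = p%:E -> nu (~` A) = (1 - p)%:E.
Proof.
move=> mA nuA; have [_ h] := X_iid.
rewrite -(h 0%N); last exact: measurableC.
rewrite /distribution /pushforward preimage_setC.
rewrite probability_setC; last exact: RV_preimage_measurable.
by rewrite -[P _]/(distribution P (X 0) A) h// nuA EFinB.
Qed.

Let pattern_prob n A p S : measurable A -> nu A = p%:E ->
  P (@pattern n A S) = (\prod_(i < n) (if i \in S then p else 1 - p))%:E.
Proof.
move=> mA nuA; have [ind h] := X_iid.
rewrite /pattern ind ?iota_uniq//; last first.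
  by move=> i; case: ifP => // _; exact: measurableC.
have -> : iota 0 n = index_iota 0 n by rewrite /index_iota subn0.
rewrite big_mkord -prodEFin; apply: eq_bigr => i _.
have -> : [exists j in S, val j == i] = (i \in S).
  apply/existsP/idP => [[j /andP[jS /eqP/val_inj <-//]]|iS].
  by exists i; rewrite iS eqxx.
rewrite -[P _]/(distribution P (X i) _) h; last first.
  by case: ifP => // _; exact: measurableC.
by case: ifP => _ //; exact: setC_in_measure.
Qed.

(** Chernoff's bound; a positive [t] controls the upper tail of the count and
    a negative one its lower tail. *)
Lemma chernoff_count n A (p t m : R) : measurable A -> nu A = p%:E ->
  measurable [set w | t * m <= t * (count_in n A w)%:R] /\
  (P [set w | (t * m <= t * (count_in n A w)%:R)%R]
    <= (expR (n%:R * (p * (expR t - 1)) - t * m))%:E)%E.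
Proof.
move=> mA nuA; have [ind h] := X_iid.
have p01 : 0 <= p <= 1.
  rewrite -!lee_fin -nuA -(h 0%N)// /distribution /pushforward measure_ge0/=.
  exact/probability_le1/RV_preimage_measurable.
have cS w : count_in n A w = #|[set i : 'I_n | X i w \in A]%SET|.
  by rewrite cardsE.
have evE : [set w | t * m <= t * (count_in n A w)%:R] =
   \bigcup_(S in [set S : {set 'I_n} | t * m <= t * #|S|%:R]) @pattern n A S.
  apply/seteqP; split => w /=.
    rewrite cS => wm; exists [set i : 'I_n | X i w \in A]%SET => //.
    exact/patternP.
  by move=> [S /= Sm /patternP SE]; rewrite cS -SE.
have mev : measurable [set w | t * m <= t * (count_in n A w)%:R].
  rewrite evE; apply: fin_bigcup_measurable => // S _; exact: pattern_measurable.
split => //.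
have := @measure_fin_union_le _ _ _ P _ [pred S : {set 'I_n} | t * m <= t * #|S|%:R]
  (@pattern n A) (fun S => pattern_measurable S mA).
rewrite evE => /le_trans; apply.
rewrite (eq_bigr _ (fun S _ => pattern_prob S mA nuA)).
rewrite sumEFin lee_fin.
have p1 : 0 <= 1 - p by rewrite subr_ge0; case/andP: p01.
have p0 : 0 <= p by case/andP: p01.
pose pr (S : {set 'I_n}) := \prod_(i < n) (if i \in S then p * expR t else 1 - p).
have prE S : pr S = expR (t * #|S|%:R) * \prod_(i < n) (if i \in S then p else 1 - p).
  have -> : expR (t * #|S|%:R) = \prod_(i < n) (if i \in S then expR t else 1).
    by rewrite [t * _]mulrC expRM_natl -big_mkcond/= prodr_const.
  rewrite /pr -big_split/=; apply: eq_bigr => i _.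
  by case: ifP => _; rewrite ?mul1r// mulrC.
have pr0 S : 0 <= \prod_(i < n) (if i \in S then p else 1 - p).
  by apply: prodr_ge0 => i _; case: ifP.
apply: (@le_trans _ _ (\sum_(S : {set 'I_n}) expR (- (t * m)) * pr S)).
  rewrite [leLHS]big_mkcond/=; apply: ler_sum => S _; rewrite prE mulrA -expRD.
  case: ifP => tm; last by rewrite mulr_ge0// expR_ge0.
  rewrite ler_peMl//.
  by rewrite -[leLHS]expR0 ler_expR addrC subr_ge0.
rewrite -mulr_sumr /pr -bigA_distr prodr_const card_ord [X in _ <= expR X]addrC expRD.
rewrite ler_wpM2l ?expR_ge0// expRM_natl.
rewrite lerXn2r ?nnegrE ?expR_ge0//; first by rewrite addr_ge0// mulr_ge0// expR_ge0.
apply: le_trans (expR_ge1Dx _); rewrite le_eqVlt; apply/orP; left; apply/eqP => /=.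
by ring.
Qed.

End counting.

Section borel_cantelli.
Context (R : realType) dO (Omega : measurableType dO) (P : probability Omega R).

(** The Borel-Cantelli lemma, the series of the [C / n ^ 2] being bounded by a
    telescoping one. *)
Lemma ae_eventually_not (F : nat -> set Omega) (C : R) :
  (forall n, measurable (F n)) ->
  (\forall n \near \oo, (P (F n) <= (C / n%:R ^+ 2)%:E)%E) ->
  \forall w \ae P, \forall n \near \oo, ~ F n w.
Proof.
move=> mF [N _ NF].
pose F' n := if (n <= N)%N then set0 else F n.
have mF' n : measurable (F' n) by rewrite /F'; case: ifP.
have C0 : 0 <= C.
  have /(_ (leqnSn N)) := NF N.+1; rewrite -/(_ <= _)%E => /(le_trans (measure_ge0 _ _)).
  by rewrite lee_fin pmulr_lge0// invr_gt0 exprn_gt0.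
have bnd n : (P (F' n) <= (6 * C * (n.+1%:R^-1 - n.+2%:R^-1))%:E)%E.
  have n0 : (0 : R) <= n.+1%:R^-1 - n.+2%:R^-1.
    by rewrite subr_ge0 lef_pV2 ?posrE// ler_nat.
  rewrite /F'; case: leqP => [_|Nn]; first by rewrite measure0 lee_fin !mulr_ge0.
  have n1 : (1 : R) <= n%:R by rewrite ler1n (leq_trans _ Nn).
  apply: (le_trans (NF n (ltnW Nn))); rewrite lee_fin -mulrA mulrCA ler_wpM2l//.
  rewrite -(natr1 n.+1) -(natr1 n).
  have -> : 6 * ((n%:R + 1)^-1 - (n%:R + 1 + 1)^-1) =
     6 / ((n%:R + 1) * (n%:R + 2)) :> R by field; lra.
  rewrite ler_pdivlMr; last by nra.
  rewrite mulrC ler_pdivrMr; last by rewrite exprn_gt0//; lra.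
  nra.
have : P (lim_sup_set F') = 0%E.
  apply: lim_sup_set_cvg0 => //.
  apply: (@le_lt_trans _ _ (6 * C)%:E); last exact: ltry.
  apply: lime_le; first exact: is_cvg_nneseries.
  apply: nearW => n; apply: (@le_trans _ _ (\sum_(0 <= i < n)
     (6 * C * (i.+1%:R^-1 - i.+2%:R^-1))%:E)%E).
    by apply: lee_sum => i _; exact: bnd.
  rewrite sumEFin lee_fin -mulr_sumr ler_piMr ?mulr_ge0//.
  have -> : \sum_(0 <= i < n) (i.+1%:R^-1 - i.+2%:R^-1 : R) =
    - (\sum_(0 <= i < n) (i.+2%:R^-1 - i.+1%:R^-1)).
    by rewrite -sumrN; apply: eq_bigr => i _; rewrite opprB.
  rewrite (telescope_sumr (fun i => i.+1%:R^-1 : R))// opprB invr1.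
  by rewrite gerBl.
move=> F'0; exists (lim_sup_set F'); split => //.
  apply: bigcap_measurable => // k _.
  by apply: bigcup_measurable => j _.
move=> w /= h k _; apply: contrapT => nk; apply: h.
exists (maxn k N.+1) => // n /= kn Fn; apply: nk; exists n => /=.
  by rewrite (leq_trans _ kn)// leq_maxl.
rewrite /F' ifF//; apply/negbTE; rewrite -ltnNge (leq_trans _ kn)//.
by rewrite leq_max ltnSn orbT.
Qed.
End borel_cantelli.

(** * The law of large numbers for one event *)

Section asymptotics.
Context {R : realType}.

Lemma near_infty_ratio_ge (k : nat -> nat) (c : R) :
  (k n)%:R / ln (n%:R : R) @[n --> \oo] --> +oo ->
  \forall n \near \oo, c * ln (n%:R : R) <= (k n)%:R.
Proof.
move=> /cvgryPge /(_ c) ck.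
near=> n; have n2 : (2 <= n)%N by near: n; exists 2%N.
rewrite -ler_pdivlMr; first by near: n.
by rewrite ln_gt0// ltr1n.
Unshelve. all: by end_near. Qed.

Lemma expR_log_decay (k : nat -> nat) (c : R) : 0 < c ->
  (k n)%:R / ln (n%:R : R) @[n --> \oo] --> +oo ->
  \forall n \near \oo, expR (- (c * (k n)%:R)) <= n%:R ^- 3.
Proof.
move=> c0 /(near_infty_ratio_ge (3 / c)) kc.
near=> n; have n2 : (2 <= n)%N by near: n; exists 2%N.
have n0 : (0 : R) < n%:R by rewrite ltr0n ltnW.
rewrite -[leRHS]lnK ?posrE ?invr_gt0 ?exprn_gt0// ler_expR lnV ?posrE ?exprn_gt0//.
rewrite lerN2 lnXn// -[_ *+ 3]mulr_natl -ler_pdivrMl// [leLHS]mulrCA mulrA.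
by near: n.
Unshelve. all: by end_near. Qed.

Lemma expR_quad_decay (c x : R) : 0 < c -> 0 < x ->
  expR (- (x * c)) <= 2 / c ^+ 2 / x ^+ 2.
Proof.
move=> c0 x0; have xc : 0 < x * c by rewrite mulr_gt0.
have q0 : 0 < 2 / c ^+ 2 / x ^+ 2 by rewrite !divr_gt0 ?exprn_gt0.
rewrite expRN -[leRHS]invrK lef_pV2 ?posrE ?expR_gt0 ?invr_gt0//.
apply: le_trans (@expR_ge1Dxn R (x * c) 1 (ltW xc)).
have -> : (2 / c ^+ 2 / x ^+ 2)^-1 = (x * c) ^+ 2 / 2 by field; lra.
by rewrite lerDr.
Qed.

Lemma expR_le_quad (t : R) : `|t| <= 1 / 2 -> expR t - 1 - t <= 2 * t ^+ 2.
Proof.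
rewrite ler_norml => /andP[t1 t2].
have := expR_ge1Dx (- t); have := expR_gt0 t; rewrite expRN => e0.
have h : 0 < 1 - t by lra.
rewrite -(ler_pM2r e0) mulVf ?gt_eqF// => e1.
have : expR t * (1 - t) <= (1 + t + 2 * t ^+ 2) * (1 - t).
  by rewrite mulrC (le_trans e1)//; nra.
rewrite ler_pM2r//; lra.
Qed.

Lemma expR1_le4 : expR 1 <= 4 :> R.
Proof.
have := expR_ge1Dx (- (2^-1) : R); rewrite expRN.
have e0 := expR_gt0 (2^-1 : R).
rewrite -(ler_pM2r e0) mulVf ?gt_eqF// => e1.
have -> : (1 : R) = 2^-1 + 2^-1 by field.
rewrite expRD; nra.
Qed.

Lemma expRN1_le : expR (-1) <= 2^-1 :> R.
Proof.
rewrite expRN lef_pV2 ?posrE ?expR_gt0//.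
by apply: le_trans (expR_ge1Dx _); lra.
Qed.
End asymptotics.

Section lln.
Context (R : realType) dO dT (Omega : measurableType dO) (T : measurableType dT).
Variables (P : probability Omega R) (X : nat -> {RV P >-> T}).
Variable nu : set T -> \bar R.
Hypothesis X_iid : iid X nu.

(** By Chernoff's bound with parameter [e / 4], deviations by [e] have exponentially
    small probabilities, so that almost surely they occur finitely often. *)
Lemma frequency_cvg A (p : R) : measurable A -> nu A = p%:E ->
  \forall w \ae P, (count_in X n A w)%:R / n%:R @[n --> \oo] --> p.
Proof.
move=> mA nuA; have [_ h] := X_iid.
have p01 : 0 <= p <= 1.
  rewrite -!lee_fin -nuA -(h 0%N)// /distribution /pushforward measure_ge0/=.
  exact/probability_le1/RV_preimage_measurable.
pose ev (t m : R) n := [set w | t * m <= t * (count_in X n A w)%:R].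
have tail (e : R) (s : R) : 0 < e <= 1 -> s = 1 \/ s = - 1 ->
    \forall w \ae P, \forall n \near \oo,
      ~ ev (s * (e / 4)) (n%:R * (p + s * e)) n w.
  move=> /andP[e0 e1] s1.
  apply: (@ae_eventually_not _ _ _ _ _ (2 / (e ^+ 2 / 8) ^+ 2)).
    by move=> n; case: (chernoff_count X_iid n (s * (e / 4)) (n%:R * (p + s * e)) mA nuA).
  exists 1%N => // n /= n0; have n0' : (0 : R) < n%:R by rewrite ltr0n.
  have [_] := chernoff_count X_iid n (s * (e / 4)) (n%:R * (p + s * e)) mA nuA.
  move=> /le_trans; apply; rewrite lee_fin.
  apply: le_trans (expR_quad_decay _ n0'); last by rewrite divr_gt0 ?exprn_gt0.
  rewrite ler_expR.
  have := @expR_le_quad R (s * (e / 4)); set E := expR _.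
  have s2 : s ^+ 2 = 1 by case: s1 => ->; rewrite ?expr1n ?sqrrN ?expr1n.
  have sn : `|s * (e / 4)| <= 1 / 2.
    rewrite normrM (_ : `|s| = 1) ?mul1r; last first.
      by case: s1 => ->; rewrite ?normrN normr1.
    by rewrite ger0_norm; lra.
  move=> /(_ sn); rewrite exprMn s2 mul1r => Ee.
  have -> : n%:R * (p * (E - 1)) - s * (e / 4) * (n%:R * (p + s * e)) =
     n%:R * (p * (E - 1 - s * (e / 4)) - s ^+ 2 * (e ^+ 2 / 4)) by field.
  rewrite -[leRHS]mulrN ler_pM2l//.
  rewrite s2 mul1r.
  case/andP: p01 => p0 p1; have e20 : 0 <= e ^+ 2 by exact: sqr_ge0.
  have : p * (E - 1 - s * (e / 4)) <= 2 * (e / 4) ^+ 2.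
    apply: (@le_trans _ _ (p * (2 * (e / 4) ^+ 2))); first exact: ler_wpM2l.
    by rewrite ler_piMl// mulr_ge0// sqr_ge0.
  rewrite expr_div_n; lra.
have {}tail : \forall w \ae P, forall j : nat, \forall n \near \oo,
    ~ ev (j.+1%:R^-1 / 4) (n%:R * (p + j.+1%:R^-1)) n w /\
    ~ ev (- (j.+1%:R^-1 / 4)) (n%:R * (p - j.+1%:R^-1)) n w.
  apply: ae_foralln => j.
  have j1 : 0 < (j.+1%:R^-1 : R) <= 1 by rewrite invr_gt0 ltr0n/= invf_le1 ?ler1n.
  have := tail _ 1 j1 (or_introl erefl); have := tail _ (-1) j1 (or_intror erefl).
  apply: filterS2 => w h1 h2; apply: filterS2 h1 h2 => n.
  by rewrite !mul1r !mulN1r.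
apply: filterS tail => w tail; apply/cvgrPdist_lt => e e0.
have [j _ je] := near_infty_natSinv_lt (PosNum e0).
have := tail j; apply: filterS2 (nbhs_infty_gt 0) => n n0 [h1 h2].
have n0' : (0 : R) < n%:R by rewrite ltr0n.
apply: le_lt_trans (je j (leqnn j)); rewrite /= ler_distl.
have j4 : 0 < j.+1%:R^-1 / 4 :> R by rewrite divr_gt0.
move: h1 h2; rewrite /ev /= ler_pM2l// ler_nM2l ?oppr_lt0//.
move=> /negP; rewrite -ltNge => h1 /negP; rewrite -ltNge => h2.
have a1 : (count_in X n A w)%:R / n%:R < p + j.+1%:R^-1.
  by rewrite ltr_pdivrMr// mulrC.
have a2 : p - j.+1%:R^-1 < (count_in X n A w)%:R / n%:R.
  by rewrite ltr_pdivlMr// mulrC.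
by rewrite lerBlDr ltW//= -lerBlDr ltW.
Qed.

Lemma ae_notin_null A : measurable A -> nu A = 0%E ->
  \forall w \ae P, forall i, ~ A (X i w).
Proof.
move=> mA A0; have [_ h] := X_iid.
apply: ae_foralln => i; exists (X i @^-1` A); split.
- exact: RV_preimage_measurable.
- by have := h i A mA; rewrite A0.
- by move=> w /= /contrapT.
Qed.
End lln.

(** * The mass of grid cells *)

Section boxes.
Context {R : realType} {d : nat}.
Local Notation E := 'rV[R]_d.
Implicit Types (A D : set E).

Definition cellset (h : R) (p : 'rV[int]_d) : set E := [set y | cell h y = p].

Lemma cellP h p (y : E) : 0 < h -> cell h y = p <->
  forall a, (p 0 a)%:~R * h <= y 0 a < ((p 0 a)%:~R + 1) * h.
Proof.
move=> h0; split => [<- a|yp].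
  rewrite mxE -ler_pdivlMr// -ltr_pdivrMr//.
  by have := floor_itv (y 0 a / h); rewrite intrD.
apply/rowP => a; rewrite mxE; apply: floor_def.
by rewrite intrD ler_pdivlMr// ltr_pdivrMr// yp.
Qed.

Lemma measurable_coord_box (I : 'I_d -> interval R) :
  measurable [set y : E | forall a, y 0 a \in I a].
Proof.
rewrite (_ : [set y | _] = \bigcap_(a in [set: 'I_d])
    (fun y : E => y 0 a) @^-1` [set` I a]).
  apply: fin_bigcap_measurable => // a _.
  by rewrite -[X in measurable X]setTI; exact: measurable_rV_coord.
by apply/seteqP; split => [y yI a _|y yI a]; exact: yI.
Qed.

Lemma measurable_cellset h p : 0 < h -> measurable (cellset h p).
Proof.
move=> h0; have := @measurable_coord_box (fun a =>
  `[(p 0 a)%:~R * h, ((p 0 a)%:~R + 1) * h[).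
congr (measurable _); apply/seteqP; split => y /=.
  move=> yp; rewrite /cellset/=; apply/(cellP _ _ h0) => a.
  by have := yp a; rewrite in_itv.
by rewrite /cellset/= => /(cellP _ _ h0) yp a; rewrite in_itv/=; exact: yp.
Qed.

Lemma measurable_fun_continuous_on D (rho : E -> R) : open D ->
  {within D, continuous rho} -> measurable_fun D (rho : E -> measurableTypeR R).
Proof.
move=> oD /continuousP crho.
apply: (measurability _ (RGenOpens.measurableE R)).
move=> _ [_ [a [b ->]] <-].
have /crho : open (`]a, b[%classic : set R) by exact: interval_open.
move=> /open_subspaceP[V oV VD].
by rewrite setIC -VD; apply: rV_open_measurable; exact: openI.
Qed.

End boxes.

Section density.
Context {R : realType} {d : nat}.
Local Notation E := 'rV[R]_d.
Variables (D : set E) (rho : E -> R) (rho_min rho_max : R).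
Hypothesis D_open : open D.
Hypothesis rho_cont : {within D, continuous rho}.
Hypothesis rho_min0 : 0 < rho_min.
Hypothesis rho_min_max : rho_min <= rho_max.
Hypothesis rho_bounded : forall x, D x -> rho_min <= rho x <= rho_max.
Local Notation leb := (lebesgue_rV R d).

Let box (a : E) (h : R) : set E := [set y | forall i, y 0 i \in `[a 0 i, a 0 i + h]].

Let box_measure a h : 0 <= h -> leb (box a h) = (h ^+ d)%:E.
Proof.
move=> h0; pose b : E := \row_i (a 0 i + h).
rewrite (_ : box a h = [set y | forall i, y 0 i \in `[a 0 i, b 0 i]]); last first.
  by apply/seteqP; split => y /= yb i; have := yb i; rewrite mxE.
rewrite lebesgue_rV_box; last by move=> i; rewrite mxE lerDl.
congr EFin; rewrite (eq_bigr (fun=> h)) ?prodr_const ?card_ord// => i _.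
by rewrite mxE addrAC subrr add0r.
Qed.

Let mD : measurable D := rV_open_measurable D_open.

Let rho_meas B : measurable B -> measurable_fun (D `&` B) (EFin \o rho).
Proof.
move=> mB; apply/measurable_EFinP.
apply: measurable_funS (measurable_fun_continuous_on D_open rho_cont) => //.
Qed.

Let rho_ge0 x : D x -> 0 <= rho x.
Proof. by move=> /rho_bounded/andP[+ _]; exact/le_trans/ltW. Qed.

Let box_meas a h : measurable (box a h). Proof. exact: measurable_coord_box. Qed.

Lemma density_measure_D : density_measure D rho D = density_measure D rho setT.
Proof. by rewrite /density_measure setIid setIT. Qed.

Lemma density_le_box A a h : 0 <= h -> measurable A -> A `<=` box a h ->
  (density_measure D rho A <= (rho_max * h ^+ d)%:E)%E.
Proof.
move=> h0 mA Ab; rewrite /density_measure.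
have rm0 : 0 <= rho_max by exact: le_trans (ltW rho_min0) _.
apply: (@le_trans _ _ (\int[leb]_(x in D `&` A) (cst rho_max%:E) x)%E).
  apply: ge0_le_integral => //; first exact: measurableI.
  - by move=> x [Dx _]; rewrite lee_fin rho_ge0.
  - exact: rho_meas.
  - by move=> x [Dx _]; rewrite lee_fin; case/andP: (rho_bounded Dx).
rewrite integral_cst; last exact: measurableI.
rewrite EFinM lee_pmul//.
rewrite -(box_measure a h0); apply: le_measure; rewrite ?inE//.
- exact: measurableI.
- by move=> x [_ /Ab].
Qed.

Lemma density_ge_box A a h : 0 <= h -> measurable A -> box a h `<=` D `&` A ->
  ((rho_min * h ^+ d)%:E <= density_measure D rho A)%E.
Proof.
move=> h0 mA bA; rewrite /density_measure.
apply: (@le_trans _ _ (\int[leb]_(x in box a h) (rho x)%:E)%E); last first.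
  apply: ge0_subset_integral => //; first exact: measurableI.
  - exact: rho_meas.
  - by move=> x [Dx _]; rewrite lee_fin rho_ge0.
apply: (@le_trans _ _ (\int[leb]_(x in box a h) (cst rho_min%:E) x)%E).
  rewrite integral_cst; last exact: box_meas.
  by rewrite EFinM -(box_measure a h0); exact: lexx.
have bD : box a h `<=` D by move=> x /bA[].
apply: ge0_le_integral => //.
- by move=> x _; rewrite lee_fin ltW.
- have := rho_meas (box_meas a h); congr (measurable_fun _ _).
  by rewrite setIC; apply/setIidPl.
- by move=> x /bD /rho_bounded/andP[].
Qed.

Lemma cell_density_le h p : 0 < h -> (density_measure D rho (cellset h p)
  <= (rho_max * h ^+ d)%:E)%E.
Proof.
move=> h0; apply: (@density_le_box _ (\row_a ((p 0 a)%:~R * h))); first exact: ltW.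
  exact: measurable_cellset.
move=> y /(cellP _ _ h0) yp a; have /andP[h1 h2] := yp a.
by rewrite in_itv/= mxE h1/= (le_trans (ltW h2))// mulrDl mul1r.
Qed.

(** The factor [1 / 2] comes from comparing the half-open cell with a closed box
    that it contains. *)
Lemma cell_density_ge h p : 0 < h -> full D h p ->
  ((rho_min * (h / 2) ^+ d)%:E <= density_measure D rho (cellset h p))%E.
Proof.
move=> h0 fp; apply: (@density_ge_box _ (\row_a ((p 0 a)%:~R * h))).
- by rewrite divr_ge0// ltW.
- exact: measurable_cellset.
move=> y yb; suff yp : cell h y = p by split => //; exact: fp.
apply/(cellP _ _ h0) => a; have := yb a; rewrite in_itv/= mxE => /andP[-> h1]/=.
by rewrite (le_lt_trans h1)// mulrDl mul1r ltrD2l ltr_pdivrMr// ltr_pMr// ltr1n.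
Qed.

End density.

(** * Occupation of the cells of a fine grid *)

Section microcells.
Context {R : realType} {d : nat}.
Local Notation E := 'rV[R]_d.
Variables (D : set E) (rho : E -> R) (rho_min rho_max : R).
Hypothesis d_gt0 : (0 < d)%N.
Hypothesis D_open : open D.
Hypothesis D_bounded : bounded_set D.
Hypothesis rho_cont : {within D, continuous rho}.
Hypothesis rho_min0 : 0 < rho_min.
Hypothesis rho_min_max : rho_min <= rho_max.
Hypothesis rho_bounded : forall x, D x -> rho_min <= rho x <= rho_max.
Hypothesis rho_density : density_measure D rho setT = 1%E.
Context (dO : measure_display) (Omega : measurableType dO) (P : probability Omega R).
Variable X : nat -> {RV P >-> 'rV[R]_d}.
Hypothesis X_iid : iid X (density_measure D rho).
Local Notation nu := (density_measure D rho).

Lemma nu_fin A : measurable A -> nu A = (fine (nu A))%:E.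
Proof.
move=> mA; have [_ h] := X_iid; rewrite -(h 0%N)// fineK// fin_num_measure//.
Qed.

Lemma nu_compl_D : nu (~` D) = 0%E.
Proof.
have -> : 0%E = (1 - 1)%:E :> \bar R by rewrite subrr.
apply: (setC_in_measure X_iid); first exact: rV_open_measurable.
by rewrite density_measure_D.
Qed.

Lemma ae_in_D : \forall w \ae P, forall i, D (X i w).
Proof.
have mD : measurable (~` D) by apply: measurableC; exact: rV_open_measurable.
by apply: filterS (ae_notin_null X_iid mD nu_compl_D) => w h i; apply: contrapT; exact: h.
Qed.

Lemma bounded_coord : exists B : nat,
  forall y, D y -> forall a, `|y 0 a| <= B%:R.
Proof.
have [M [Mreal DM]] := D_bounded.
exists (Num.truncn (`|M| + 1)).+1 => // y Dy a.
rewrite (le_trans (mx_norm_coord y a))//.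
apply: le_trans (DM (`|M| + 1) _ y Dy) _.
  by rewrite (le_lt_trans (ler_norm M))// ltrDl.
exact/ltW/truncnS_gt.
Qed.

Variable k : nat -> nat.
Hypothesis k_log : (k n)%:R / ln (n%:R : R) @[n --> \oo] --> +oo.
Hypothesis k_lin : (k n)%:R / n%:R @[n --> \oo] --> (0 : R).

Definition eps n : R := ((k n)%:R / n%:R) `^ d%:R^-1.

Lemma eps_pow n : eps n ^+ d = (k n)%:R / n%:R.
Proof.
rewrite -powR_mulrn ?powR_ge0// -powRrM mulVf ?pnatr_eq0 -?lt0n//.
by rewrite powRr1// divr_ge0.
Qed.

Lemma k_gt0_near : \forall n \near \oo, (0 < k n)%N.
Proof.
have := near_infty_ratio_ge 1 k_log; apply: filterS2 (nbhs_infty_gt 1) => n n1.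
rewrite mul1r => h; rewrite -(ltr_nat R) (lt_le_trans _ h)//.
by rewrite ln_gt0// ltr1n.
Qed.

Lemma eps_lt_near (e : R) : 0 < e -> \forall n \near \oo, eps n < e.
Proof.
move=> e0; have ed0 : 0 < e ^+ d by rewrite exprn_gt0.
have /cvgrPdist_lt/(_ _ ed0) := k_lin; apply: filterS => n.
rewrite sub0r normrN ger0_norm ?divr_ge0// -eps_pow.
by rewrite (ltr_pXn2r d_gt0) ?nnegrE ?powR_ge0 ?(ltW e0).
Qed.

(** A cell of mesh [c0 * eps n] has mass of order [k n / n]. As [k n] dominates
    [log n], Chernoff's bound makes its count abnormal with probability at most
    [n ^- 3], and [D], being bounded, meets only O(n) cells. *)
Lemma ae_microcells (c0 : R) : 0 < c0 ->
  \forall w \ae P, \forall n \near \oo, forall p,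
    (count_in X n (cellset (c0 * eps n) p) w)%:R <=
       4 * rho_max * c0 ^+ d * (k n)%:R /\
    (full D (c0 * eps n) p -> rho_min * (c0 / 2) ^+ d / 4 * (k n)%:R <=
       (count_in X n (cellset (c0 * eps n) p) w)%:R).
Proof.
move=> c00; have [B DB] := bounded_coord.
pose h n := c0 * eps n.
pose M n := (Num.truncn (B%:R / h n)).+1.
pose A n (f : {ffun 'I_d -> 'I_(2 * M n).+1}) := cellset (h n) (offset f) : set E.
pose mlo n := n%:R * (rho_min * (h n / 2) ^+ d / 4).
pose mhi n := n%:R * (4 * rho_max * h n ^+ d).
pose up n f := [set w | 1 * mhi n <= 1 * (count_in X n (@A n f) w)%:R].
pose low n f := [set w | -1 * mlo n <= -1 * (count_in X n (@A n f) w)%:R].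
pose F n := if 0 < h n then \bigcup_(f in [set` predT])
   (up n f `|` (if `[< full D (h n) (offset f) >] then low n f else set0)) else set0.
pose kap := rho_min * (c0 / 2) ^+ d / 4.
have kap0 : 0 < kap by rewrite !(mulr_gt0, divr_gt0, exprn_gt0, invr_gt0).
have rmax0 : 0 < rho_max by exact: lt_le_trans rho_min_max.
have kap_le : kap <= rho_max * c0 ^+ d.
  rewrite /kap expr_div_n.
  have : c0 ^+ d / 2 ^+ d <= c0 ^+ d.
    by rewrite ler_pdivrMr ?exprn_gt0// ler_peMr ?exprn_ge0 ?(ltW c00)// exprn_ege1// ler1n.
  have : 0 <= c0 ^+ d / 2 ^+ d by rewrite divr_ge0 ?exprn_ge0// ltW.
  set a := c0 ^+ d / 2 ^+ d; set b := c0 ^+ d => a0 ab.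
  have : rho_min * a <= rho_max * b by rewrite ler_pM// ltW.
  have : 0 <= rho_min * a by rewrite mulr_ge0// ltW.
  lra.
have hd n : (0 < n)%N -> n%:R * h n ^+ d = c0 ^+ d * (k n)%:R.
  move=> n0; rewrite exprMn eps_pow mulrCA; congr (_ * _).
  by rewrite mulrCA mulfV ?mulr1// pnatr_eq0 -lt0n.
have mup n f : 0 < h n -> measurable (up n f).
  move=> h0; have [+ _] := chernoff_count X_iid n 1 (mhi n)
    (measurable_cellset (offset f) h0) (nu_fin (measurable_cellset (offset f) h0)).
  exact.
have mlow n f : 0 < h n -> measurable (low n f).
  move=> h0; have [+ _] := chernoff_count X_iid n (-1) (mlo n)
    (measurable_cellset (offset f) h0) (nu_fin (measurable_cellset (offset f) h0)).
  exact.
have Pup n f : (0 < n)%N -> 0 < h n -> (P (up n f) <= (expR (- (kap * (k n)%:R)))%:E)%E.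
  move=> n0 h0; have mA := measurable_cellset (offset f) h0.
  have [_ /le_trans] := chernoff_count X_iid n 1 (mhi n) mA (nu_fin mA).
  apply; rewrite lee_fin ler_expR mul1r.
  have : fine (nu (cellset (h n) (offset f))) <= rho_max * h n ^+ d.
    rewrite -lee_fin -(nu_fin mA).
    exact: (cell_density_le D_open rho_cont rho_min0 rho_min_max rho_bounded
      (offset f) h0).
  set p := fine _ => ph.
  have p0 : 0 <= p.
    by rewrite -lee_fin -(nu_fin mA); have [_ hX] := X_iid; rewrite -(hX 0%N).
  have e4 : expR 1 <= 4 :> R := expR1_le4.
  have : p * (expR 1 - 1) <= rho_max * h n ^+ d * 3.
    have e1 : 0 <= expR 1 - 1 :> R by rewrite subr_ge0 -[leLHS]expR0 ler_expR.
    by apply: ler_pM => //; lra.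
  have n0' : (0 : R) < n%:R by rewrite ltr0n.
  rewrite -(ler_pM2l n0') => h1.
  have h2 : mhi n = 4 * (rho_max * (c0 ^+ d * (k n)%:R)).
    by rewrite /mhi -hd//; ring.
  have h3 : n%:R * (rho_max * h n ^+ d * 3) = 3 * (rho_max * (c0 ^+ d * (k n)%:R)).
    by rewrite -hd//; ring.
  have h4 : kap * (k n)%:R <= rho_max * (c0 ^+ d * (k n)%:R).
    by rewrite mulrA ler_wpM2r.
  move: h1 h4; rewrite h2 h3; lra.
have Plow n f : (0 < n)%N -> 0 < h n -> full D (h n) (offset f) ->
    (P (low n f) <= (expR (- (kap * (k n)%:R)))%:E)%E.
  move=> n0 h0 ff; have mA := measurable_cellset (offset f) h0.
  have [_ /le_trans] := chernoff_count X_iid n (-1) (mlo n) mA (nu_fin mA).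
  apply; rewrite lee_fin ler_expR mulN1r opprK.
  have : rho_min * (h n / 2) ^+ d <= fine (nu (cellset (h n) (offset f))).
    rewrite -lee_fin -(nu_fin mA).
    exact: (cell_density_ge D_open rho_cont rho_min0 rho_bounded h0 ff).
  set p := fine _ => ph.
  have e2 : expR (-1) <= 2^-1 :> R := expRN1_le.
  have h5 : 0 <= rho_min * (h n / 2) ^+ d.
    by rewrite mulr_ge0 ?exprn_ge0 ?divr_ge0// ltW.
  have : p * (expR (-1) - 1) <= rho_min * (h n / 2) ^+ d * (- 2^-1).
    rewrite -subr_ge0; set a := rho_min * _ in ph h5 *.
    have -> : a * (- 2^-1) - p * (expR (-1) - 1) =
      (p - a) * 2^-1 + p * (2^-1 - expR (-1)) by field.
    rewrite addr_ge0// mulr_ge0 ?subr_ge0//; [exact: le_trans ph].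
  have n0' : (0 : R) < n%:R by rewrite ltr0n.
  rewrite -(ler_pM2l n0') => h1.
  have h2 : n%:R * (rho_min * (h n / 2) ^+ d) = 4 * (kap * (k n)%:R).
    have -> : n%:R * (rho_min * (h n / 2) ^+ d) =
      rho_min / 2 ^+ d * (n%:R * h n ^+ d).
      by rewrite expr_div_n; ring.
    by rewrite hd// /kap expr_div_n; field; rewrite expf_neq0.
  move: h1; rewrite /mlo mulrA.
  have -> : n%:R * (rho_min * (h n / 2) ^+ d * - 2^-1) =
    - (n%:R * (rho_min * (h n / 2) ^+ d)) / 2 by field.
  have -> : n%:R * (rho_min * (h n / 2) ^+ d / 4) =
    n%:R * (rho_min * (h n / 2) ^+ d) / 4 by field.
  rewrite h2; lra.
have mUL n f : 0 < h n -> measurable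
    (up n f `|` (if `[< full D (h n) (offset f) >] then low n f else set0)).
  move=> h0; apply: measurableU; first exact: mup.
  by case: ifP => _ //; exact: mlow.
have PUL n f : (0 < n)%N -> 0 < h n -> (P
    (up n f `|` (if `[< full D (h n) (offset f) >] then low n f else set0))
    <= (2 * expR (- (kap * (k n)%:R)))%:E)%E.
  move=> n0 h0; have -> : 2 * expR (- (kap * (k n)%:R)) =
    expR (- (kap * (k n)%:R)) + expR (- (kap * (k n)%:R)) by ring.
  case: ifPn => [/asboolP ff|_]; last first.
    by rewrite setU0 (le_trans (Pup n f n0 h0))// lee_fin lerDl expR_ge0.
  apply: (@le_trans _ _ (P (up n f) + P (low n f))%E).
    by apply: measureU2; [exact: mup|exact: mlow].
  by rewrite EFinD leeD ?Pup ?Plow.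
pose C : R := 2 * (((2 * B)%:R + 3) / c0) ^+ d.
have aeF : \forall w \ae P, \forall n \near \oo, ~ F n w.
  apply: (@ae_eventually_not _ _ _ _ _ C).
    move=> n; rewrite /F; case: ifPn => // h0.
    by apply: fin_bigcup_measurable => // f _; exact: mUL.
  have c0i : 0 < c0^-1 by rewrite invr_gt0.
  near=> n.
  have n0 : (0 < n)%N by near: n; exact: nbhs_infty_gt.
  have k0 : (0 < k n)%N by near: n; exact: k_gt0_near.
  have h1 : eps n < c0^-1 by near: n; exact: eps_lt_near.
  have dec : expR (- (kap * (k n)%:R)) <= n%:R ^- 3.
    by near: n; exact: expR_log_decay.
  have n0' : (0 : R) < n%:R by rewrite ltr0n.
  have h0 : 0 < h n by rewrite mulr_gt0// powR_gt0// divr_gt0// ltr0n.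
  have {}h1 : h n < 1 by rewrite /h mulrC -ltr_pdivlMr// mul1r.
  rewrite /F h0; apply: le_trans (measure_fin_union_le _ _ (fun f => mUL n f h0)) _.
  apply: (@le_trans _ _ (\sum_(f : {ffun 'I_d -> 'I_(2 * M n).+1})
     (2 * n%:R ^- 3)%:E)%E).
    apply: lee_sum => f _; apply: le_trans (PUL n f n0 h0) _.
    by rewrite lee_fin ler_pM2l.
  rewrite sumEFin lee_fin sumr_const card_ffun !card_ord -[leLHS]mulr_natr natrX.
  have Mh : (2 * M n).+1%:R <= ((2 * B)%:R + 3) / h n.
    have : (Num.truncn (B%:R / h n))%:R <= B%:R / h n.
      by rewrite truncn_le divr_ge0// ltW.
    rewrite ler_pdivlMr// => tr; rewrite ler_pdivlMr//.
    rewrite /M -addn1 natrD natrM -addn1 natrD (natrM _ 2 B); nra.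
  have : (2 * M n).+1%:R ^+ d <= (((2 * B)%:R + 3) / c0) ^+ d * n%:R.
    apply: (@le_trans _ _ ((((2 * B)%:R + 3) / h n) ^+ d)).
      by apply: lerXn2r => //; rewrite nnegrE ?ler0n// (le_trans _ Mh)// ler0n.
    rewrite !expr_div_n -mulrA ler_wpM2l ?exprn_ge0 ?addr_ge0//.
    rewrite exprMn eps_pow invfM invf_div ler_wpM2l ?invr_ge0 ?exprn_ge0 ?(ltW c00)//.
    by rewrite ler_pdivrMr ?ltr0n// ler_peMr ?ler1n.
  move=> hM; apply: (@le_trans _ _ (2 * n%:R ^- 3 * ((((2 * B)%:R + 3) / c0) ^+ d * n%:R))).
    by rewrite ler_wpM2l// mulr_ge0// invr_ge0 exprn_ge0.
  by rewrite le_eqVlt; apply/orP; left; apply/eqP; rewrite /C; field; lra.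
have := ae_in_D; apply: filterS2 aeF => w Fw Dw.
apply: filterS3 (nbhs_infty_gt 0) k_gt0_near Fw => n n0 k0 Fn p.
have n0' : (0 : R) < n%:R by rewrite ltr0n.
have h0 : 0 < h n by rewrite mulr_gt0// powR_gt0// divr_gt0// ltr0n.
have box y : D y -> ibox (M n) (cell (h n) y).
  move=> Dy; have c00' : cell (h n) (0 : E) = 0.
    by apply/rowP => a; rewrite !mxE mul0r floor0.
  rewrite -[cell _ y]subr0 -c00'; apply: supclose_cell => // a.
  rewrite mxE subr0 (le_trans (DB _ Dy a))// -ler_pdivrMr// ltW//.
  exact: truncnS_gt.
rewrite -/(h n).
have [pb|npb] := boolP (ibox (M n) p); last first.
  have -> : count_in X n (cellset (h n) p) w = 0%N.
    apply: eq_card0 => i; rewrite inE; apply/negbTE/negP => /set_mem pE.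
    by move: npb; rewrite -pE box.
  split; first by rewrite !mulr_ge0// ?exprn_ge0// ltW.
  move=> fp; have := fp _ (cell_mulr p h0) => /box; rewrite cell_mulr//.
  by rewrite (negbTE npb).
have [f pf] := offset_surj pb.
have {Fn} : ~ (up n f `|` (if `[< full D (h n) (offset f) >] then low n f else set0)) w.
  by move=> h1; apply: Fn; rewrite /F h0; exists f.
rewrite /A -pf => /not_orP[nup nlow]; split.
  rewrite leNgt; apply/negP => h1; apply: nup; rewrite /up /= /A !mul1r -pf.
  apply: le_trans (ltW h1); rewrite /mhi.
  by rewrite mulrCA hd// mulrA.
move=> fp; rewrite leNgt; apply/negP => h1; apply: nlow.
rewrite (asboolT fp) /low /= /A !mulN1r lerN2 -pf.
apply: le_trans (ltW h1) _; rewrite /mlo.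
have -> : n%:R * (rho_min * (h n / 2) ^+ d / 4) =
  rho_min / 2 ^+ d / 4 * (n%:R * h n ^+ d) by rewrite expr_div_n; ring.
by rewrite hd// expr_div_n; rewrite le_eqVlt; apply/orP; left; apply/eqP; ring.
Unshelve. all: by end_near. Qed.

End microcells.

(** * Nearest-neighbour links between fine cells *)

Section knn_link.
Context {R : realType} {d : nat}.
Local Notation E := 'rV[R]_d.

Lemma card_box_le n (q : 'I_n -> 'rV[int]_d) (hi : R) (K : nat) (p : 'rV[int]_d) :
  (forall p, (occ q p)%:R <= hi) ->
  #|[pred l | ibox K (q l - p)]|%:R <= ((2 * K).+1 ^ d)%N%:R * hi.
Proof.
move=> qhi; rewrite -sum1_card natr_sum.
apply: (@le_trans _ _ (\sum_(f : {ffun 'I_d -> 'I_(2 * K).+1})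
  (occ q (p + offset f))%:R)).
  under [leRHS]eq_bigr do rewrite occE big_mkcond/=.
  rewrite exchange_big/= big_mkcond/=; apply: ler_sum => l _; rewrite inE.
  case: ifPn => [/offset_surj[f qf]|_].
    rewrite (bigD1 f)//= -qf [p + _]addrC subrK eqxx lerDl sumr_ge0// => g _.
    by case: ifP.
  by apply: sumr_ge0 => f _; case: ifP.
have -> : ((2 * K).+1 ^ d)%N = #|{ffun 'I_d -> 'I_(2 * K).+1}|.
  by rewrite card_ffun !card_ord.
by rewrite mulr_natl -sumr_const; apply: ler_sum.
Qed.

(** A point closer to [x j] than [x i] lies in a cell at bounded offset from that
    of [x j]. When all these cells together hold at most [k] points, [x i] has to
    be one of the [k] nearest neighbours of [x j]. *)
Lemma knn_linked (x : nat -> E) (n k N : nat) (h hi : R) (i j : 'I_n) : 0 < h ->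
  (forall p, (occ (fun i : 'I_n => cell h (x i)) p)%:R <= hi) ->
  ((2 * (d * N.+1)).+1 ^ d)%N%:R * hi <= k%:R ->
  i != j -> ibox N (cell h (x j) - cell h (x i)) -> knn_kernel x k i j = 1.
Proof.
move=> h0 qhi hik ij /iboxP ijN; rewrite /knn_kernel.
suff -> : is_knn x k i j by [].
rewrite /is_knn ij/=.
have dij : enorm (x i - x j) <= d%:R * (N.+1%:R * h).
  apply: enorm_le; last by rewrite mulr_ge0// ltW.
  move=> a; rewrite !mxE; have := cell_diff (x j) (x i) a h0.
  have := ijN a; set z := (cell h (x j) - cell h (x i)) 0 a => za.
  have : `|h * z%:~R| <= h * N%:R.
    by rewrite normrM gtr0_norm// ler_pM2l// -intr_norm -[N%:R]/(N%:Z%:~R) ler_int.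
  rewrite -[N.+1]addn1 natrD ltr_norml !ler_norml; lra.
rewrite -(ltr_nat R); apply: lt_le_trans hik.
apply: lt_le_trans (card_box_le (d * N.+1) (cell h (x j)) qhi).
rewrite ltr_nat; apply: proper_card; apply/properP; split.
  apply/fintype.subsetP => l; rewrite !inE => /andP[lj dl].
  apply: supclose_cell => // a.
  have := coord_le_enorm (x l - x j) a; rewrite !mxE => /le_trans; apply.
  by rewrite (le_trans (ltW dl))// (le_trans dij)// natrM mulrA.
exists j; last by rewrite !inE eqxx.
by rewrite inE subrr; apply/iboxP => a; rewrite mxE normr0.
Qed.

Lemma linked_var_le_GTV (x : nat -> E) (n k N : nat) (h hi : R) (u : E -> R) (C : R) :
  (0 < n)%N -> (0 < k)%N -> 0 < h ->
  (forall p, (occ (fun i : 'I_n => cell h (x i)) p)%:R <= hi) ->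
  ((2 * (d * N.+1)).+1 ^ d)%N%:R * hi <= k%:R ->
  GTV x n k u <= C ->
  linked_var (fun i : 'I_n => cell h (x i)) (fun i : 'I_n => u (x i)) (ibox N) <=
    C * (n%:R ^+ 2 * ((k%:R / n%:R) `^ d%:R^-1) ^+ d.+1).
Proof.
move=> n0 k0 h0 qhi hik; rewrite /GTV mulrC ler_pdivrMr; last first.
  by rewrite mulr_gt0 ?exprn_gt0 ?powR_gt0 ?divr_gt0 ?ltr0n.
apply: le_trans; rewrite /linked_var; apply: ler_sum => i _.
rewrite big_mkcond/=; apply: ler_sum => j _.
have [->|ij] := eqVneq i j; first by rewrite !subrr normr0 mulr0; case: ifP.
case: ifPn => [ijN|_]; last by rewrite mulr_ge0// /knn_kernel ler0n.
by rewrite (knn_linked h0 qhi hik ij ijN) mul1r.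
Qed.

End knn_link.

Section oscillation.
Context {R : realType} {d : nat}.
Local Notation E := 'rV[R]_d.
Variables (D : set E) (N : nat).
Hypothesis N_gt0 : (0 < N)%N.
Hypothesis coneD : forall y, D y -> exists2 m, ibox N m & cone D N%:R^-1 y m.
Variables (c0 bhi blo g0 C0 C1 : R).
Hypothesis c0_gt0 : 0 < c0.
Hypothesis bhi_gt0 : 0 < bhi.
Hypothesis blo_gt0 : 0 < blo.
Hypothesis g0_gt0 : 0 < g0.
Hypothesis C1_ge0 : 0 <= C1.

Definition class_osc {n} {T : eqType} (c : 'I_n -> T) (u : 'I_n -> R) : R :=
  n%:R^-1 * \sum_(i < n) #|[pred j | c j == c i]|%:R^-1 *
     \sum_(j | c j == c i) `|u i - u j|.

Let A1 : R := (bhi / blo) ^+ 2 / g0 * 3 ^+ d * (2 / c0) ^+ d.+1.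
Let A2 : R := (((2 * N).+1 ^ d)%N%:R) *+ 2.

(** [coarse_oscillation] with counts proportional to [k]: the powers of [n] and [e]
    cancel, and only the class diameter [s] and the number [J] of translates of
    the boundary strip remain. *)
Lemma oscillation_bound n (T : eqType) (c : 'I_n -> T) (x : 'I_n -> E)
    (u : 'I_n -> R) (e s : R) (J : nat) :
  (0 < n)%N -> 0 < e -> (forall i, D (x i)) ->
  let h := c0 * e in let q i := cell h (x i) in
  let k := n%:R * e ^+ d in
  (forall p, (occ q p)%:R <= bhi * k) ->
  (forall p, full D h p -> blo * k <= (occ q p)%:R) ->
  (forall i j, c j == c i -> supclose s (x j) (x i)) ->
  (forall i, (forall v, supclose (s + s) v (x i) -> D v) ->
     g0 * s ^+ d * n%:R <= #|[pred j | c j == c i]|%:R) ->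
  linked_var q u (ibox N) <= C1 * (n%:R ^+ 2 * e ^+ d.+1) ->
  \sum_i `|u i| <= C0 * n%:R ->
  (0 < J)%N -> h + h <= s -> 4 * J%:R * s <= N%:R^-1 -> s + 4 * s * N%:R <= N%:R^-1 ->
  class_osc c u <= s * (C1 * (A1 + A2 * (1 / (c0 * blo) + 4 * J%:R * bhi / (c0 * blo ^+ 2))))
    + A2 * bhi / blo * C0 / J%:R.
Proof.
move=> n0 e0 xD h q k qhi qlo same cnt linkC uC J0 hs Js Ns.
have h0 : 0 < h by rewrite mulr_gt0.
have n0' : (0 : R) < n%:R by rewrite ltr0n.
have k0 : 0 < k by rewrite mulr_gt0 ?exprn_gt0.
have s0 : 0 < s by move: hs; lra.
have J0' : (0 : R) < J%:R by rewrite ltr0n.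
pose M := (Num.truncn (s / h)).+1.
pose Jz := (Num.truncn (3 * s / h)).+2.
have Mh1 : s <= M%:R * h.
  by rewrite -ler_pdivrMr// ltW// truncnS_gt.
have Mh2 : M%:R * h <= s + h.
  rewrite /M -natr1 mulrDl mul1r lerD2r -ler_pdivlMr// truncn_le.
  by rewrite divr_ge0// ltW.
have Jh1 : 3 * s <= (Jz%:R - 1) * h.
  rewrite (_ : Jz%:R = (Num.truncn (3 * s / h)).+1%:R + 1 :> R); last by rewrite natr1.
  rewrite addrK.
  by rewrite -ler_pdivrMr// ltW// truncnS_gt.
have Jh2 : Jz%:R * h <= 3 * s + h + h.
  rewrite (_ : Jz%:R = (Num.truncn (3 * s / h))%:R + 1 + 1 :> R); last first.
    by rewrite !natr1.
  have : (Num.truncn (3 * s / h))%:R * h <= 3 * s.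
    by rewrite -ler_pdivlMr// truncn_le divr_ge0// ?mulr_ge0// ltW.
  lra.
have Jh3 : Jz%:R * h <= 4 * s by lra.
have M0 : (0 < M)%N by [].
have Jz1 : (1 < Jz)%N by [].
clearbody M Jz.
have M0' : (0 : R) < M%:R by rewrite ltr0n.
have gam0 : 0 < g0 * s ^+ d * n%:R by rewrite !mulr_gt0 ?exprn_gt0.
have lo0 : 0 < blo * k by rewrite mulr_gt0.
have := @coarse_oscillation R d n T D N x u c h s (blo * k) (bhi * k)
  (g0 * s ^+ d * n%:R) J Jz M N_gt0 coneD xD h0 lo0 gam0 qhi qlo same cnt J0 Jz1 M0.
have a1 : s + s + s <= (Jz%:R - 1) * h by lra.
have a2 : (J * Jz)%:R * h <= N%:R^-1.
  rewrite natrM -mulrA (le_trans _ Js)// [4 * _]mulrC -mulrA ler_pM2l//.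
have a3 : h + Jz%:R * h * N%:R <= N%:R^-1.
  apply: le_trans Ns; apply: lerD; first by lra.
  by rewrite ler_wpM2r.
have a4 : (M%:R + 1) * h <= s + s by lra.
move=> /(_ a1 a2 a3 Mh1 a4) main.
rewrite /class_osc mulrC ler_pdivrMr//; apply: le_trans main _.
rewrite -/q; set G := linked_var q u (ibox N) in linkC *.
have G0 : 0 <= G := linked_var_ge0 _ _ _.
have term1 : (g0 * s ^+ d * n%:R)^-1 * (((2 * M).+1 ^ d)%N%:R *
    ((bhi * k) ^+ 2 * (M%:R * (G / (blo * k) ^+ 2)))) <= s * (C1 * A1) * n%:R.
  have Me : M%:R * e <= 2 * s / c0.
    rewrite ler_pdivlMr// -mulrA [e * _]mulrC -/h; lra.
  have M3 : ((2 * M).+1 ^ d)%N%:R * M%:R * e ^+ d.+1 <= 3 ^+ d * (2 * s / c0) ^+ d.+1 :> R.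
    apply: (@le_trans _ _ (3 ^+ d * (M%:R * e) ^+ d.+1)).
      rewrite exprMn [M%:R ^+ d.+1]exprSr !mulrA.
      rewrite ler_wpM2r ?exprn_ge0 ?(ltW e0)// ler_wpM2r// -exprMn natrX.
      apply: lerXn2r; rewrite ?nnegrE ?mulr_ge0//.
      by rewrite -natrM ler_nat [(3 * M)%N]mulSn -add1n leq_add2r.
    rewrite ler_wpM2l ?exprn_ge0//; apply: lerXn2r => //; rewrite nnegrE.
      by rewrite mulr_ge0// ltW.
    by rewrite divr_ge0 ?mulr_ge0// ltW.
  have -> : (g0 * s ^+ d * n%:R)^-1 * (((2 * M).+1 ^ d)%N%:R *
    ((bhi * k) ^+ 2 * (M%:R * (G / (blo * k) ^+ 2)))) =
     (bhi / blo) ^+ 2 / g0 / s ^+ d / n%:R * (((2 * M).+1 ^ d)%N%:R * M%:R) * G.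
    by field; rewrite !gt_eqF ?exprn_gt0.
  apply: (@le_trans _ _ ((bhi / blo) ^+ 2 / g0 / s ^+ d / n%:R *
    (((2 * M).+1 ^ d)%N%:R * M%:R) * (C1 * (n%:R ^+ 2 * e ^+ d.+1)))).
    by rewrite ler_wpM2l// mulr_ge0// !divr_ge0 ?exprn_ge0 ?divr_ge0// ltW.
  have -> : (bhi / blo) ^+ 2 / g0 / s ^+ d / n%:R *
    (((2 * M).+1 ^ d)%N%:R * M%:R) * (C1 * (n%:R ^+ 2 * e ^+ d.+1)) =
    (bhi / blo) ^+ 2 / g0 / s ^+ d * n%:R * C1 *
    (((2 * M).+1 ^ d)%N%:R * M%:R * e ^+ d.+1).
    by field; rewrite !gt_eqF ?exprn_gt0.
  have -> : s * (C1 * A1) * n%:R = (bhi / blo) ^+ 2 / g0 / s ^+ d * n%:R * C1 *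
     (3 ^+ d * (2 * s / c0) ^+ d.+1).
    rewrite /A1 !expr_div_n !exprMn [s ^+ d.+1]exprSr.
    by field; rewrite !gt_eqF ?exprn_gt0.
  by rewrite ler_wpM2l// !mulr_ge0 ?invr_ge0 ?exprn_ge0 ?divr_ge0// ltW.
have eh : e = h / c0 by rewrite /h mulrC mulKf ?gt_eqF.
have es : e <= s / c0 by rewrite eh ler_pM2r ?invr_gt0//; lra.
have term2 : G / (blo * k) + bhi * k * ((J * Jz)%:R * (G / (blo * k) ^+ 2)) +
    bhi * k / (blo * k) * (\sum_i `|u i|) / J%:R <=
    (s * (C1 * (1 / (c0 * blo) + 4 * J%:R * bhi / (c0 * blo ^+ 2)))
      + bhi / blo * C0 / J%:R) * n%:R.
  have t1 : G / (blo * k) <= s * C1 / (c0 * blo) * n%:R.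
    apply: (@le_trans _ _ (C1 * (n%:R ^+ 2 * e ^+ d.+1) / (blo * k))).
      by rewrite ler_pM2r ?invr_gt0.
    have -> : C1 * (n%:R ^+ 2 * e ^+ d.+1) / (blo * k) = C1 / blo * n%:R * e.
      by rewrite /k [e ^+ d.+1]exprSr; field; rewrite !gt_eqF ?exprn_gt0.
    have -> : s * C1 / (c0 * blo) * n%:R = C1 / blo * n%:R * (s / c0).
      by field; rewrite !gt_eqF.
    by rewrite ler_wpM2l// !mulr_ge0 ?invr_ge0 ?(ltW blo_gt0).
  have t2 : bhi * k * ((J * Jz)%:R * (G / (blo * k) ^+ 2)) <=
     s * C1 * (4 * J%:R * bhi / (c0 * blo ^+ 2)) * n%:R.
    apply: (@le_trans _ _ (bhi * k * ((J * Jz)%:R *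
      (C1 * (n%:R ^+ 2 * e ^+ d.+1) / (blo * k) ^+ 2)))).
      apply: ler_wpM2l; first by rewrite mulr_ge0// ltW.
      by apply: ler_wpM2l => //; rewrite ler_pM2r// invr_gt0 exprn_gt0.
    have -> : bhi * k * ((J * Jz)%:R *
      (C1 * (n%:R ^+ 2 * e ^+ d.+1) / (blo * k) ^+ 2)) =
      bhi / blo ^+ 2 * C1 * n%:R * J%:R / c0 * (Jz%:R * h).
      by rewrite /k /h [e ^+ d.+1]exprSr natrM; field; rewrite !gt_eqF ?exprn_gt0.
    have -> : s * C1 * (4 * J%:R * bhi / (c0 * blo ^+ 2)) * n%:R =
      bhi / blo ^+ 2 * C1 * n%:R * J%:R / c0 * (4 * s).
      by field; rewrite !gt_eqF.
    by rewrite ler_wpM2l// !mulr_ge0 ?invr_ge0 ?exprn_ge0// ltW.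
  have t3 : bhi * k / (blo * k) * (\sum_i `|u i|) / J%:R <= bhi / blo * C0 / J%:R * n%:R.
    have -> : bhi * k / (blo * k) * (\sum_i `|u i|) / J%:R =
      bhi / blo / J%:R * (\sum_i `|u i|) by field; rewrite !gt_eqF.
    have -> : bhi / blo * C0 / J%:R * n%:R = bhi / blo / J%:R * (C0 * n%:R).
      by field; rewrite !gt_eqF.
    by rewrite ler_wpM2l// !divr_ge0// ltW.
  apply: le_trans (lerD (lerD t1 t2) t3) _.
  rewrite le_eqVlt; apply/orP; left; apply/eqP.
  by field; rewrite !gt_eqF.
apply: le_trans (lerD term1 (lexx _)) _.
have A20 : 0 <= A2 by rewrite /A2 mulrn_wge0.
have -> : forall a : R, (((2 * N).+1 ^ d)%N%:R * a) *+ 2 = A2 * a.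
  by move=> a; rewrite /A2 [RHS]mulrnAl.
apply: le_trans (lerD (lexx _) (ler_wpM2l A20 term2)) _.
rewrite le_eqVlt; apply/orP; left; apply/eqP.
by field; rewrite !gt_eqF.
Qed.

End oscillation.

(** * Oscillation over coarse cells *)

Section small_oscillation.
Context {R : realType} {d : nat}.
Local Notation E := 'rV[R]_d.
Variables (D : set E) (N : nat).
Hypothesis d_gt0 : (0 < d)%N.
Hypothesis N_gt0 : (0 < N)%N.
Hypothesis coneD : forall y, D y -> exists2 m, ibox N m & cone D N%:R^-1 y m.
Variables (c0 bhi blo g0 : R).
Hypothesis c0_gt0 : 0 < c0.
Hypothesis bhi_gt0 : 0 < bhi.
Hypothesis blo_gt0 : 0 < blo.
Hypothesis g0_gt0 : 0 < g0.
Hypothesis bhi_small : ((2 * (d * N.+1)).+1 ^ d)%N%:R * bhi <= 1.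
Variable k : nat -> nat.
Hypothesis k_log : (k n)%:R / ln (n%:R : R) @[n --> \oo] --> +oo.
Hypothesis k_lin : (k n)%:R / n%:R @[n --> \oo] --> (0 : R).
Variables (T : nat -> eqType) (cls : forall t, E -> T t).
Hypothesis cls_close : forall t y y', D y -> D y' -> cls t y = cls t y' ->
  supclose t.+1%:R^-1 y y'.
Variable x : nat -> E.
Hypothesis xD : forall i, D (x i).
Local Notation h n := (c0 * @eps R d k n).
Hypothesis micro : \forall n \near \oo, forall p,
  (occ (fun i : 'I_n => cell (h n) (x i)) p)%:R <= bhi * (k n)%:R /\
  (full D (h n) p -> blo * (k n)%:R <= (occ (fun i : 'I_n => cell (h n) (x i)) p)%:R).
Hypothesis macro : forall t, \forall n \near \oo, forall i : 'I_n,
  (forall v, supclose (t.+1%:R^-1 + t.+1%:R^-1) v (x i) -> D v) ->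
  g0 * t.+1%:R^-1 ^+ d * n%:R <= #|[pred j : 'I_n | cls t (x j) == cls t (x i)]|%:R.
Variables (u : nat -> E -> R) (C0 C1 : R).
Hypothesis C1_ge0 : 0 <= C1.
Hypothesis u_bound : forall n, (0 < n)%N -> \sum_(i < n) `|u n (x i)| <= C0 * n%:R.
Hypothesis GTV_bound : forall n, (0 < n)%N -> GTV x n (k n) (u n) <= C1.

(** First [J] is taken large, to control the mass on the boundary strip, then the
    class diameter small in terms of [J]; the mesh of the fine grid is eventually
    smaller still. *)
Lemma oscillation_small (eta : R) : 0 < eta ->
  \forall t \near \oo, \forall n \near \oo,
  class_osc (fun i : 'I_n => cls t (x i)) (fun i : 'I_n => u n (x i)) <= eta.
Proof.
move=> eta0.
pose A1 : R := (bhi / blo) ^+ 2 / g0 * 3 ^+ d * (2 / c0) ^+ d.+1.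
pose A2 : R := (((2 * N).+1 ^ d)%N%:R) *+ 2.
pose J := (Num.truncn (2 * (A2 * bhi / blo * C0) / eta)).+1.
have J0 : (0 : R) < J%:R by rewrite ltr0n.
have Jeta : A2 * bhi / blo * C0 / J%:R <= eta / 2.
  have : 2 * (A2 * bhi / blo * C0) / eta < J%:R by exact: truncnS_gt.
  rewrite ltr_pdivrMr// => JX; rewrite ler_pdivrMr//; lra.
pose K := C1 * (A1 + A2 * (1 / (c0 * blo) + 4 * J%:R * bhi / (c0 * blo ^+ 2))).
have A10 : 0 <= A1.
  by rewrite /A1 !(mulr_ge0, divr_ge0, invr_ge0, exprn_ge0)// ltW.
have A20 : 0 <= A2 by rewrite mulrn_wge0.
have J1 : (0 < J)%N by [].
clearbody J.
have K0 : 0 <= K.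
  rewrite /K mulr_ge0// addr_ge0// mulr_ge0// addr_ge0//.
    by rewrite divr_ge0// mulr_ge0// ltW.
  by rewrite divr_ge0 ?mulr_ge0 ?exprn_ge0// ltW.
pose smax := Num.min (eta / 2 / (K + 1)) (N%:R^-1 / (4 * J%:R + 1 + 4 * N%:R)).
have N0 : (0 : R) < N%:R by rewrite ltr0n.
have q0 : 0 < 4 * J%:R + 1 + 4 * N%:R :> R by lra.
have K1 : 0 < K + 1 by lra.
have smax0 : 0 < smax.
  by rewrite /smax lt_min !divr_gt0// invr_gt0.
have [t0 _ t0P] := near_infty_natSinv_lt (PosNum smax0).
exists t0 => // t /= /t0P /=; set s : R := t.+1%:R^-1.
rewrite /smax lt_min => /andP[s1 s2].
have s0 : 0 < s by rewrite invr_gt0.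
have {}s1 : s * K <= eta / 2.
  move: s1; rewrite ltr_pdivlMr// => s1; apply: le_trans (ltW s1).
  by rewrite ler_pM2l// lerDl.
have {}s2 : s * (4 * J%:R + 1 + 4 * N%:R) <= N%:R^-1.
  by move: s2; rewrite ltr_pdivlMr// => /ltW.
near=> n.
have n0 : (0 < n)%N by near: n; exact: nbhs_infty_gt.
have n0' : (0 : R) < n%:R by rewrite ltr0n.
have k0 : (0 < k n)%N by near: n; exact: (@k_gt0_near R k k_log).
have e0 : 0 < @eps R d k n by rewrite powR_gt0// divr_gt0// ltr0n.
have h0 : 0 < h n by rewrite mulr_gt0.
have es : @eps R d k n < s / 2 / c0.
  by near: n; apply: eps_lt_near => //; rewrite !divr_gt0.
have hs : h n + h n <= s.
  move: es; rewrite ltr_pdivlMr// mulrC; lra.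
have kE : n%:R * @eps R d k n ^+ d = (k n)%:R :> R.
  by rewrite eps_pow// mulrC divfK// gt_eqF.
have mi : forall p, (occ (fun i : 'I_n => cell (h n) (x i)) p)%:R <= bhi * (k n)%:R /\
  (full D (h n) p -> blo * (k n)%:R <= (occ (fun i : 'I_n => cell (h n) (x i)) p)%:R).
  by near: n.
have ma : forall i : 'I_n,
  (forall v, supclose (s + s) v (x i) -> D v) ->
  g0 * s ^+ d * n%:R <= #|[pred j : 'I_n | cls t (x j) == cls t (x i)]|%:R.
  by near: n; exact: macro.
have J4 : 4 * J%:R * s <= N%:R^-1.
  apply: le_trans s2; rewrite mulrC ler_pM2l//; lra.
have N4 : s + 4 * s * N%:R <= N%:R^-1.
  apply: le_trans s2; have : 0 <= s * J%:R by rewrite mulr_ge0// ltW.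
  lra.
have := @oscillation_bound R d D N N_gt0 coneD c0 bhi blo g0 C0 C1 c0_gt0
  bhi_gt0 blo_gt0 g0_gt0 C1_ge0 n (T t) (fun i => cls t (x i)) (fun i => x i)
  (fun i => u n (x i)) (@eps R d k n) s J n0 e0 (fun i => xD i).
rewrite /= kE => /(_ (fun p => (mi p).1) (fun p => (mi p).2)).
have hik : ((2 * (d * N.+1)).+1 ^ d)%N%:R * (bhi * (k n)%:R) <= (k n)%:R :> R.
  by rewrite mulrA ler_piMl.
have cl (i j : 'I_n) : cls t (x j) == cls t (x i) -> supclose s (x j) (x i).
  by move=> /eqP; exact: cls_close.
have lk := linked_var_le_GTV n0 k0 h0 (fun p => (mi p).1) hik (GTV_bound n0).
move=> /(_ cl ma lk (u_bound n0) J1 hs J4 N4) /le_trans; apply.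
by rewrite [eta]splitr lerD.
Unshelve. all: by end_near. Qed.

End small_oscillation.

Section coarse_classes.
Context {R : realType} {d : nat}.
Local Notation E := 'rV[R]_d.
Variables (D : set E) (B : nat).
Hypothesis DB : forall y, D y -> forall a, `|y 0 a| <= B%:R.

(** The coarse cells that meet the bounded set [D] are coded by a finite type, so
    that assertions which hold eventually for each of them do so uniformly. *)
Definition coarse (t : nat) (y : E) : {ffun 'I_d -> 'I_(2 * (B * t.+1).+1).+1} :=
  [ffun a => inord (absz (cell t.+1%:R^-1 y 0 a + (B * t.+1).+1%:Z))].

Lemma coarse_cell t y : D y -> cell t.+1%:R^-1 y = offset (coarse t y).
Proof.
move=> Dy.
have s0 : (0 : R) < t.+1%:R^-1 by rewrite invr_gt0.
have /iboxP yb : ibox (B * t.+1).+1 (cell t.+1%:R^-1 y).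
  have c00 : cell t.+1%:R^-1 (0 : E) = 0.
    by apply/rowP => a; rewrite !mxE mul0r floor0.
  rewrite -[cell _ y]subr0 -c00; apply: supclose_cell => // a.
  rewrite mxE subr0 (le_trans (DB Dy a))//.
  by rewrite -ler_pdivrMr// invrK -natrM ler_nat.
apply/rowP => a; rewrite [RHS]mxE /coarse ffunE.
by have := yb a; set z := cell _ _ _ _; set K := (B * t.+1).+1 => zK; rewrite inordK; lia.
Qed.

Lemma coarse_supclose t y y' : D y -> D y' -> coarse t y = coarse t y' ->
  supclose t.+1%:R^-1 y y'.
Proof.
move=> Dy Dy' yy' a.
have s0 : (0 : R) < t.+1%:R^-1 by rewrite invr_gt0.
have := cell_diff y y' a s0; rewrite !coarse_cell// yy' subrr mxE mulr0 subr0.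
exact: ltW.
Qed.

Lemma coarse_preimage t (f : {ffun 'I_d -> 'I_(2 * (B * t.+1).+1).+1}) :
  D `&` [set y | coarse t y = f] = D `&` cellset t.+1%:R^-1 (offset f).
Proof.
have off_inj (g g' : {ffun 'I_d -> 'I_(2 * (B * t.+1).+1).+1}) :
    offset g = offset g' -> g = g'.
  move=> gg'; apply/ffunP => a; apply/val_inj; have /rowP/(_ a) := gg'.
  by rewrite !mxE => /addIr[].
apply/seteqP; split => y [Dy]; rewrite /cellset/= => yf; split => //.
  by rewrite (coarse_cell t Dy) yf.
by apply: off_inj; rewrite -coarse_cell.
Qed.

Lemma measurable_coarse t f : measurable D ->
  measurable (D `&` [set y | coarse t y = f]).
Proof.
move=> mD; rewrite coarse_preimage; apply: measurableI => //.
by apply: measurable_cellset; rewrite invr_gt0.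
Qed.

End coarse_classes.

(** * Coupling two measures block by block *)

Section slice_measure.
Local Open Scope ereal_scope.
Context d (T : measurableType d) (R : realType).
Variables (m : {measure set T -> \bar R}) (a : T).

Let mpair : measurable_fun [set: T] (pair a : T -> T * T).
Proof. exact: measurable_fun_pair. Qed.

(** The product of the Dirac mass at [a] with [m]. *)
Definition slice : set (T * T) -> \bar R := pushforward m (pair a).

Let slice_preimage (A : set (T * T)) : measurable A -> measurable (pair a @^-1` A).
Proof. by move=> mA; rewrite -[X in measurable X]setTI; exact: mpair. Qed.

Let slice0 : slice set0 = 0.
Proof. by rewrite /slice /pushforward preimage_set0 measure0. Qed.

Let slice_ge0 A : 0 <= slice A.
Proof. by rewrite /slice /pushforward; exact: measure_ge0. Qed.

Let slice_sigma_additive : semi_sigma_additive slice.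
Proof.
move=> F mF tF mUF; rewrite /slice /pushforward preimage_bigcup.
apply: measure_semi_sigma_additive => [i||]; first exact: slice_preimage.
- apply/trivIsetP => /= i j _ _ ij; rewrite -preimage_setI;
    by move/trivIsetP : tF => /(_ _ _ _ _ ij) ->//; rewrite preimage_set0.
- by rewrite -preimage_bigcup; exact: slice_preimage.
Qed.

HB.instance Definition _ := isMeasure.Build _ _ _ slice
  slice0 slice_ge0 slice_sigma_additive.

Lemma ge0_integral_slice (A : set (T * T)) (f : T * T -> \bar R) :
  measurable A -> measurable_fun A f -> (forall z, A z -> 0 <= f z) ->
  \int[slice]_(z in A) f z = \int[m]_(y in pair a @^-1` A) f (a, y).
Proof.
move=> mA mf f0; rewrite /slice ge0_integral_pushforward// => z /set_mem.
exact: f0.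
Qed.

End slice_measure.

Section mrestr_integral.
Local Open Scope ereal_scope.
Context d (T : measurableType d) (R : realType).
Variables (m : {measure set T -> \bar R}) (Q : set T) (mQ : measurable Q).

Lemma ge0_integral_mrestr (D : set T) (f : T -> \bar R) : measurable D ->
  Q `<=` D -> measurable_fun D f -> (forall y, D y -> 0 <= f y) ->
  \int[mrestr m mQ]_(y in D) f y = \int[m]_(y in Q) f y.
Proof.
move=> mD QD mf f0; have DE : D = Q `|` (D `\` Q) by rewrite setDUK.
rewrite {1}DE ge0_integral_setU//.
- rewrite [X in _ + X](_ : _ = 0) ?adde0.
    by apply: eq_measure_integral => A mA AQ; rewrite /= /mrestr setIidl.
  rewrite (@eq_measure_integral _ _ _ _ mzero) ?integral_measure_zero//.
  move=> A mA ADQ; rewrite /= /mrestr (_ : A `&` Q = set0) ?measure0//.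
  by apply/seteqP; split => // y [/ADQ[_ nQ] Qy].
- exact: measurableD.
- by rewrite -DE.
- by rewrite -DE.
- by apply/disj_setPS => y [Qy [_]].
Qed.

End mrestr_integral.

Section coupling.
Local Open Scope ereal_scope.
Context d (T : measurableType d) (R : realType).
Variables (nu : probability T R) (D : set T) (mD : measurable D).
Hypothesis nuD : nu D = 1.
Variables (n : nat) (x : nat -> T) (c : T -> nat) (K : nat).
Hypothesis n_gt0 : (0 < n)%N.
Hypothesis xD : forall i, D (x i).
Hypothesis cK : forall y, D y -> (c y < K)%N.
Let Q j : set T := D `&` [set y | c y = j].
Hypothesis mQ : forall j, measurable (Q j).
Let p j : R := (#|[pred i : 'I_n | c (x i) == j]|%:R / n%:R)%R.
Let q j : R := fine (nu (Q j)).
Variable tau : R.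
Hypothesis tau01 : (0 <= tau <= 1)%R.
Hypothesis pq : forall j, (j < K)%N -> (`|p j - q j| <= tau * q j)%R.
Let lam : R := (1 + tau)^-1%R.

Let lam0 : (0 < lam)%R.
Proof. by rewrite invr_gt0; case/andP: tau01 => ? _; lra. Qed.

Let lam1 : (lam <= 1)%R.
Proof. by rewrite invf_le1; case/andP: tau01 => ? _; lra. Qed.

Let q_ge0 j : (0 <= q j)%R. Proof. exact: fine_ge0. Qed.

Let nuQ j : nu (Q j) = (q j)%:E.
Proof. by rewrite /q fineK// fin_num_measure. Qed.

Let r j : R := (if q j == 0 then 0 else 1 - lam * (p j / q j))%R.

Let pq_ratio j : (j < K)%N -> (p j / q j <= 1 + tau)%R.
Proof.
move=> jK; have := pq jK; have := q_ge0 j; rewrite le_eqVlt => /predU1P[<- _|q0].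
  by rewrite invr0 mulr0; case/andP: tau01 => ? _; lra.
by rewrite ler_pdivrMr// ler_norml; lra.
Qed.

Let p_null j : (j < K)%N -> q j = 0%R -> p j = 0%R.
Proof.
move=> jK q0; have := pq jK; rewrite q0 mulr0 subr0 => p0.
by apply/eqP; rewrite -normr_eq0; apply/eqP/le_anti; rewrite p0 normr_ge0.
Qed.

Let r_ge0 j : (j < K)%N -> (0 <= r j)%R.
Proof.
move=> jK; rewrite /r; case: ifP => // _; rewrite subr_ge0 (@le_trans _ _ (lam * (1 + tau))%R)//.
  by rewrite ler_wpM2l ?pq_ratio// ltW.
by rewrite mulVf// gt_eqF//; case/andP: tau01 => ? _; lra.
Qed.

Let r_le j : (j < K)%N -> (r j <= 2 * tau)%R.
Proof.
case/andP: tau01 => t0 t1.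
move=> jK; rewrite /r; case: eqVneq => [_|qn0]; first by rewrite mulr_ge0.
have q0 : (0 < q j)%R by rewrite lt_neqAle eq_sym qn0 q_ge0.
have := pq jK; rewrite ler_norml => /andP[h1 _].
have t2 : (0 < 1 + tau)%R by lra.
rewrite /lam -(ler_pM2l t2).
have -> : ((1 + tau) * (1 - (1 + tau)^-1 * (p j / q j)) = 1 + tau - p j / q j)%R.
  by rewrite mulrBr mulr1 mulrA mulfV ?gt_eqF// mul1r.
have : (1 - tau <= p j / q j)%R by rewrite ler_pdivlMr//; lra.
nra.
Qed.

(** The density with respect to [nu], on the [j]-th cell, of the mass carried by the
    [i]-th point. A fraction [lam] of the mass of each point is spread over its own
    cell, which never exceeds [nu] because [p <= (1 + tau) * q]; the rest is spread
    over all the cells so as to restore the second marginal. *)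
Let w i j : R := (n%:R^-1 * (lam * (c (x i) == j)%:R / q j + r j))%R.

Let n0 : (0 < n%:R :> R)%R. Proof. by rewrite ltr0n. Qed.

Let w_ge0 i j : (j < K)%N -> (0 <= w i j)%R.
Proof.
move=> jK; rewrite mulr_ge0 ?invr_ge0// addr_ge0 ?r_ge0//.
by rewrite divr_ge0// mulr_ge0// ltW.
Qed.

Let max_w_ge0 i j : (0 <= Num.max 0 (w i j))%R.
Proof. by rewrite le_max lexx. Qed.

(** The truncation only makes [weight] total: [w i j] is nonnegative for [j < K]. *)
Let weight i j : {nonneg R} := NngNum (max_w_ge0 i j).

Let weightE i j : (j < K)%N -> (weight i j)%:num = w i j.
Proof. by move=> jK; rewrite /= max_r// w_ge0. Qed.

Let conditional i : {measure set T -> \bar R} :=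
  msum (fun j => mscale (weight i j) (mrestr nu (mQ j))) K.

Definition block_coupling : {measure set (T * T) -> \bar R} :=
  msum (fun i => slice (conditional i) (x i)) n.

Let D_bigsetU : D = \big[setU/set0]_(j <- iota 0 K) Q j.
Proof.
rewrite -bigcup_seq; apply/seteqP; split => [y Dy|y [j _ []]//].
by exists (c y) => //=; rewrite mem_iota add0n cK.
Qed.

Let trivQ : trivIset [set` iota 0 K] Q.
Proof.
apply/trivIsetP => i j _ _ ij; apply/seteqP; split => // y [[_ /= yi] [_ /= yj]].
by move: ij; rewrite -yi -yj eqxx.
Qed.

Let sum_integral (f : T -> \bar R) : measurable_fun D f -> (forall y, D y -> 0 <= f y) ->
  \int[nu]_(y in D) f y = \sum_(j < K) \int[nu]_(y in Q j) f y.
Proof.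
move=> mf f0; rewrite {1}D_bigsetU ge0_integral_bigsetU ?iota_uniq -?D_bigsetU//.
have -> : iota 0 K = index_iota 0 K by rewrite /index_iota subn0.
by rewrite big_mkord.
Qed.

Let nuI A : measurable A -> nu A = \sum_(j < K) nu (Q j `&` A).
Proof.
move=> mA.
have nuDc : nu (~` D) = 0.
  by rewrite probability_setC// nuD subee.
have -> : nu A = nu (D `&` A).
  rewrite -[in LHS](setIT A) -(setUv D) setIUr measureU//.
  - rewrite [X in _ + X](_ : _ = 0) ?adde0 1?setIC//.
    apply/eqP; rewrite -measure_le0 -nuDc; apply: le_measure => //; rewrite ?inE.
    + by apply: measurableI => //; exact: measurableC.
    + exact: measurableC.
  - exact: measurableI.
  - by apply: measurableI => //; exact: measurableC.
  - by rewrite setIACA setICr setI0.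
rewrite {1}D_bigsetU big_distrl/=.
have -> : iota 0 K = index_iota 0 K by rewrite /index_iota subn0.
rewrite big_mkord measure_bigsetU_ord//.
- by move=> j; exact: measurableI.
- apply/trivIsetP => i j _ _ ij; apply/seteqP; split => // y.
  move=> [[[_ /= yi] _] [[_ /= yj] _]].
  by move: ij; rewrite -val_eqE/= -yi -yj eqxx.
Qed.

Let sum_q : (\sum_(j < K) q j = 1)%R.
Proof.
apply: EFin_inj; rewrite -sumEFin -(@probability_setT _ _ _ nu) nuI//.
by apply: eq_bigr => j _; rewrite setIT nuQ.
Qed.

Let sum_ind i : (i < n)%N -> (\sum_(j < K) (c (x i) == j)%:R = 1 :> R)%R.
Proof.
move=> _; rewrite (bigD1 (Ordinal (cK (xD i))))//= eqxx big1 ?addr0// => j.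
by rewrite -val_eqE/= eq_sym => /negbTE ->.
Qed.

Let pE j : (p j = n%:R^-1 * \sum_(i < n) (c (x i) == j)%:R)%R.
Proof.
rewrite /p mulrC; congr (_ * _)%R; rewrite -sum1_card natr_sum big_mkcond/=.
by apply: eq_bigr => i _; rewrite inE; case: ifP.
Qed.

Let sum_p : (\sum_(j < K) p j = 1)%R.
Proof.
under eq_bigr do rewrite pE.
rewrite -mulr_sumr exchange_big/= (eq_bigr (fun=> 1%R)); last by move=> i _; exact: sum_ind.
by rewrite sumr_const card_ord mulVf// gt_eqF.
Qed.

Let p_gt0 i : (i < n)%N -> (0 < p (c (x i)))%R.
Proof.
move=> ilt; rewrite divr_gt0// ltr0n; apply/card_gt0P.
by exists (Ordinal ilt); rewrite inE.
Qed.

Let q_gt0 i : (i < n)%N -> (0 < q (c (x i)))%R.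
Proof.
move=> ilt; rewrite lt_neqAle q_ge0 andbT; apply/eqP => q0.
by have := p_gt0 ilt; rewrite p_null ?ltxx// cK.
Qed.

(** The condition for the first marginal; [sum_w_points] is the one for the
    second. *)
Let sum_w_cells i : (i < n)%N -> (\sum_(j < K) w i j * q j = n%:R^-1)%R.
Proof.
move=> ilt.
rewrite (eq_bigr (fun j : 'I_K => n%:R^-1 *
   ((lam * (c (x i) == j)%:R / q j + r j) * q j))%R); last first.
  by move=> j _; rewrite /w mulrA.
rewrite -mulr_sumr -[RHS]mulr1; congr (_ * _)%R.
have E (j : 'I_K) : ((lam * (c (x i) == j)%:R / q j + r j) * q j =
   lam * (c (x i) == j)%:R + (q j - lam * p j))%R.
  have [q0|q0] := eqVneq (q j) 0%R.
    rewrite q0 mulr0 p_null// mulr0 subr0 addr0.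
    case: eqP => [ij|_]; last by rewrite mulr0.
    by have := q_gt0 ilt; rewrite ij q0 ltxx.
  rewrite mulrDl divfK// /r (negbTE q0) mulrBl mul1r; congr (_ + (_ - _))%R.
  by rewrite -!mulrA mulVf// mulr1.
under eq_bigr do rewrite E.
rewrite big_split/= sumrB -!mulr_sumr sum_ind// sum_q sum_p; ring.
Qed.

Let sum_w_points j : (j < K)%N -> (\sum_(i < n) w i j * q j = q j)%R.
Proof.
move=> jK; have [->|q0] := eqVneq (q j) 0%R; first by rewrite big1// => i _; rewrite mulr0.
rewrite -mulr_suml -[RHS]mul1r; congr (_ * _)%R; rewrite /w -mulr_sumr big_split/=.
rewrite sumr_const card_ord -mulr_suml -mulr_sumr mulrDr.
have -> : (n%:R^-1 * (lam * (\sum_(i < n) (c (x i) == j)%:R) / q j) = lam * (p j / q j))%R.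
  by rewrite pE; ring.
have -> : (n%:R^-1 * (r j *+ n) = r j)%R.
  by rewrite -[(r j *+ n)%R]mulr_natr mulrCA mulVf ?gt_eqF// mulr1.
by rewrite /r (negbTE q0); ring.
Qed.

Let block_couplingE (A : set (T * T)) : measurable A ->
  block_coupling A = \sum_(i < n) \sum_(j < K)
    (w i j)%:E * nu (Q j `&` (pair (x i) @^-1` A)).
Proof.
move=> mA; apply: eq_bigr => i _; apply: eq_bigr => j _.
rewrite -(weightE i (ltn_ord j)) setIC.
by [].
Qed.

Lemma block_coupling_left A : measurable A ->
  block_coupling (A `*` setT) = (n%:R^-1)%:E * \sum_(i < n) \d_(x i) A.
Proof.
move=> mA; rewrite block_couplingE; last exact: measurableX.
rewrite ge0_sume_distrr//.
apply: eq_bigr => i _; rewrite diracE.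
have [xA|xA] := boolP (x i \in A).
  rewrite mule1 -(sum_w_cells (ltn_ord i)) -sumEFin; apply: eq_bigr => j _.
  rewrite [RHS]EFinM -nuQ; congr (_ * nu _).
  by apply/seteqP; split => [y [] //|y Qy]; split => //; split => //; exact: set_mem.
rewrite mule0 big1// => j _; rewrite (_ : _ `&` _ = set0) ?measure0 ?mule0//.
by apply/seteqP; split => // y [_ [/= xiA _]]; move: xA; rewrite mem_set.
Qed.

Lemma block_coupling_right A : measurable A ->
  block_coupling (setT `*` A) = nu A.
Proof.
move=> mA; rewrite block_couplingE; last exact: measurableX.
rewrite exchange_big/= nuI//; apply: eq_bigr => j _.
have -> : \sum_(i < n) (w i j)%:E * nu (Q j `&` pair (x i) @^-1` (setT `*` A)) =
    \sum_(i < n) (w i j)%:E * nu (Q j `&` A).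
  apply: eq_bigr => i _; congr (_ * nu _).
  by apply/seteqP; split => y; [move=> [Qy [_ Ay]]|move=> [Qy Ay]].
have mQA : measurable (Q j `&` A) by exact: measurableI.
have [q0|q0] := eqVneq (q j) 0%R.
  have -> : nu (Q j `&` A) = 0.
    apply/eqP; rewrite -measure_le0 -[leRHS]/(0%R%:E) -q0 -nuQ.
    by apply: le_measure; rewrite ?inE.
  by rewrite big1// => i _; rewrite mule0.
rewrite -ge0_sume_distrl; last by move=> i _; rewrite lee_fin w_ge0.
rewrite sumEFin (_ : (\sum_(i < n) w i j = 1)%R) ?mul1e//.
by apply: (mulIf q0); rewrite mulr_suml sum_w_points// mul1r.
Qed.

Lemma block_coupling_setT : block_coupling setT = 1.
Proof. by rewrite -setXTT block_coupling_right// probability_setT. Qed.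

Let block_prob : set (T * T) -> \bar R := block_coupling.
HB.instance Definition _ := Measure.on block_prob.
HB.instance Definition _ :=
  @Measure_isProbability.Build _ _ R block_prob block_coupling_setT.

Lemma block_coupling_probability : exists pi : probability (T * T)%type R,
  pi = block_coupling :> (set (T * T) -> \bar R).
Proof. by exists block_prob. Qed.

Lemma block_coupling_integral (f : T * T -> \bar R) :
  measurable_fun (D `*` D) f -> (forall z, (D `*` D) z -> 0 <= f z) ->
  \int[block_coupling]_(z in D `*` D) f z =
  \sum_(i < n) \sum_(j < K) (w i j)%:E * \int[nu]_(y in Q j) f (x i, y).
Proof.
move=> mf f0; have mDD : measurable (D `*` D) by exact: measurableX.
rewrite ge0_integral_measure_sum//; apply: eq_bigr => i _.
rewrite ge0_integral_slice//.
have preE : pair (x i) @^-1` (D `*` D) = D.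
  by apply/seteqP; split => [y []|y Dy] //; split => //=.
rewrite preE.
have mfi : measurable_fun D (fun y => f (x i, y)).
  apply: (measurable_comp (F := D `*` D)) mf _ => //.
    by move=> _ [y Dy <-]; split => //; exact: xD.
  by apply: measurable_funTS; exact: measurable_fun_pair.
have fi0 y : D y -> 0 <= f (x i, y) by move=> Dy; apply: f0; split => //; exact: xD.
rewrite ge0_integral_measure_sum//; apply: eq_bigr => j _.
rewrite ge0_integral_mscale// weightE//; congr (_ * _).
by apply: ge0_integral_mrestr => // y [].
Qed.

(** Mass that stays in its cell is charged by [al] and [be]; at most [2 * tau] of
    the mass changes cell, and it is charged by [ga] and [ep]. *)
Let block_cost (f : T * T -> \bar R) (al be ga ep : nat -> R) :
  measurable_fun (D `*` D) f -> (forall z, (D `*` D) z -> 0 <= f z) ->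
  (forall i, 0 <= al i)%R -> (forall j, 0 <= be j)%R ->
  (forall i, 0 <= ga i)%R -> (forall j, 0 <= ep j)%R ->
  (forall i j, c (x i) = j ->
    \int[nu]_(y in Q j) f (x i, y) <= (al i * q j + be j)%:E) ->
  (forall i j, \int[nu]_(y in Q j) f (x i, y) <= (ga i * q j + ep j)%:E) ->
  \int[block_coupling]_(z in D `*` D) f z <=
  (n%:R^-1 * (\sum_(i < n) al i) + \sum_(j < K) be j
   + 2 * tau * (n%:R^-1 * (\sum_(i < n) ga i) + \sum_(j < K) ep j))%:E.
Proof.
move=> mf f0 al0 be0 ga0 ep0 diag off; rewrite block_coupling_integral//.
case/andP: tau01 => t0 t1.
have lamle j : (j < K)%N -> (lam * (p j / q j) <= 1)%R.
  move=> jK; rewrite /lam mulrC ler_pdivrMr ?mul1r ?pq_ratio//; lra.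
pose ind i j : R := (c (x i) == j)%:R.
apply: (@le_trans _ _ (\sum_(i < n) \sum_(j < K)
   (n%:R^-1 * (lam * ind i j / q j * (al i * q j + be j)
     + r j * (ga i * q j + ep j)))%:E)).
  apply: lee_sum => i _; apply: lee_sum => j _.
  have a0 : (0 <= lam * ind i j / q j)%R by rewrite divr_ge0// mulr_ge0// ltW.
  rewrite /w -/(ind i j) !EFinM -muleA lee_pmul2l// ?lte_fin ?invr_gt0//.
  rewrite !EFinD ge0_muleDl ?lee_fin ?r_ge0//; apply: leeD; last first.
    by rewrite EFinM lee_wpmul2l// lee_fin r_ge0.
  rewrite [leRHS]EFinM; have [ij|ij] := eqVneq (c (x i)) j.
    by rewrite lee_wpmul2l// diag.
  by rewrite /ind (negbTE ij) mulr0 mul0r !mul0e.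
rewrite (eq_bigr (fun i : 'I_n => (\sum_(j < K)
   (n%:R^-1 * (lam * ind i j / q j * (al i * q j + be j)
     + r j * (ga i * q j + ep j))))%:E)); last by move=> i _; rewrite sumEFin.
rewrite sumEFin lee_fin.
apply: (@le_trans _ _ (\sum_(i < n) \sum_(j < K)
   (n%:R^-1 * (ind i j * al i) + n%:R^-1 * (lam * ind i j / q j * be j)
     + (2 * tau) * (n%:R^-1 * (ga i * q j)) + 2 * tau * (n%:R^-1 * ep j)))%R).
  apply: ler_sum => i _; apply: ler_sum => j _.
  rewrite -mulrDr [(2 * tau * (n%:R^-1 * (ga i * q j)))%R]mulrCA -mulrDr.
  rewrite [(2 * tau * (n%:R^-1 * ep j))%R]mulrCA -mulrDr ler_pM2l ?invr_gt0//.
  rewrite -addrA -mulrDr; apply: lerD; last first.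
    by rewrite ler_wpM2r ?r_le// addr_ge0// mulr_ge0.
  rewrite mulrDr lerD2r mulrCA [(ind i j * _)%R]mulrC ler_wpM2l//.
  have i0 : (0 <= ind i j)%R by rewrite ler0n.
  have [->|q0] := eqVneq (q j) 0%R; first by rewrite mulr0.
  by rewrite divfK// ler_piMl.
under eq_bigr do rewrite !big_split/=.
rewrite !big_split/= mulrDr addrA; apply: lerD; first apply: lerD; first apply: lerD.
- rewrite mulr_sumr; apply: ler_sum => i _; rewrite -mulr_sumr -mulr_suml.
  by rewrite sum_ind// mul1r.
- rewrite exchange_big/=; apply: ler_sum => j _.
  have -> : (\sum_(i < n) n%:R^-1 * (lam * ind i j / q j * be j) =
      lam * (p j / q j) * be j)%R.
    rewrite (eq_bigr (fun i : 'I_n => n%:R^-1 * lam / q j * be j * ind i j)%R).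
      by rewrite -mulr_sumr pE; ring.
    by move=> i _; ring.
  by rewrite ler_piMl// lamle.
- rewrite !mulr_sumr; apply: ler_sum => i _.
  by rewrite -!mulr_sumr sum_q mulr1.
- rewrite exchange_big/= mulr_sumr; apply: ler_sum => j _.
  rewrite sumr_const card_ord -[leLHS]mulr_natr le_eqVlt; apply/orP; left.
  by apply/eqP; field; rewrite gt_eqF.
Qed.

Lemma block_coupling_dist (dst : T * T -> R) (delta Delta : R) :
  (0 <= delta)%R -> (0 <= Delta)%R -> (forall z, 0 <= dst z)%R ->
  measurable_fun (D `*` D) dst ->
  (forall y y', D y -> D y' -> c y = c y' -> dst (y, y') <= delta)%R ->
  (forall y y', D y -> D y' -> dst (y, y') <= Delta)%R ->
  \int[block_coupling]_(z in D `*` D) (dst z)%:E <= (delta + 2 * tau * Delta)%:E.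
Proof.
move=> d0 D0 dst0 mdst dd DD.
have mi i j : measurable_fun (Q j) (fun y => (dst (x i, y))%:E).
  apply/measurable_EFinP; apply: (measurable_comp (F := D `*` D)) mdst _ => //.
  - exact: measurableX.
  - by move=> _ [y [Dy _] <-]; split => //; exact: xD.
  - by apply: measurable_funTS; exact: measurable_fun_pair.
have bd i j (C : R) : (0 <= C)%R -> (forall y, Q j y -> dst (x i, y) <= C)%R ->
    \int[nu]_(y in Q j) (dst (x i, y))%:E <= (C * q j + 0)%:E.
  move=> C0 h; rewrite addr0 EFinM -nuQ -integral_cst//.
  by apply: ge0_le_integral => // y Qy; rewrite lee_fin ?h.
have h := @block_cost (EFin \o dst) (fun=> delta) (fun=> 0%R) (fun=> Delta) (fun=> 0%R).
have mf : measurable_fun (D `*` D) (EFin \o dst) by exact/measurable_EFinP.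
have f0 z : (D `*` D) z -> 0 <= (EFin \o dst) z by move=> _; rewrite lee_fin.
have diag i j : c (x i) = j ->
    \int[nu]_(y in Q j) (EFin \o dst) (x i, y) <= (delta * q j + 0)%:E.
  by move=> ij; apply: bd => // y [Dy cy]; apply: dd => //; rewrite ij.
have off i j : \int[nu]_(y in Q j) (EFin \o dst) (x i, y) <= (Delta * q j + 0)%:E.
  by apply: bd => // y [Dy _]; exact: DD.
have := h mf f0 (fun=> d0) (fun=> lexx _) (fun=> D0) (fun=> lexx _) diag off.
rewrite !sumr_const !card_ord !mul0rn !addr0.
have nK (a : R) : (n%:R^-1 * (a *+ n) = a)%R.
  by rewrite -[(a *+ n)%R]mulr_natl mulKf ?gt_eqF.
by rewrite !nK.
Qed.

Lemma measurable_classes (b : nat -> R) : measurable_fun D (b \o c).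
Proof.
have -> : D = \bigcup_j Q j.
  by apply/seteqP; split => [y Dy|y [j _ []]//]; exists (c y).
apply/measurable_fun_bigcup => // j.
apply: (eq_measurable_fun (cst (b j))) => //.
by move=> y /set_mem[_ /= ->].
Qed.

Lemma block_coupling_fun (u v : T -> R) (b : nat -> R) :
  measurable_fun D u -> nu.-integrable D (EFin \o v) ->
  \int[block_coupling]_(z in D `*` D) `|u z.1 - v z.2|%:E <=
  (n%:R^-1 * (\sum_(i < n) `|u (x i) - b (c (x i))|)
   + fine (\int[nu]_(y in D) `|b (c y) - v y|%:E)
   + 2 * tau * (n%:R^-1 * (\sum_(i < n) `|u (x i)|) + fine (\int[nu]_(y in D) `|v y|%:E)))%:E.
Proof.
move=> mu iv.
have mv : measurable_fun D v by apply/measurable_EFinP; exact: measurable_int iv.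
have QD j : Q j `<=` D by move=> y [].
have mvQ j : measurable_fun (Q j) v by exact: measurable_funS mv.
pose be j := fine (\int[nu]_(y in Q j) `|b j - v y|%:E).
pose ep j := fine (\int[nu]_(y in Q j) `|v y|%:E).
have ivQ j : nu.-integrable (Q j) (EFin \o v) by exact: integrableS iv.
have finQ j (a : R) : \int[nu]_(y in Q j) `|a - v y|%:E \is a fin_num.
  rewrite ge0_fin_numE; last by apply: integral_ge0 => y _; rewrite lee_fin.
  have ia : nu.-integrable (Q j) (EFin \o cst a).
    by apply: finite_measure_integrable_cst.
  have /integrableP[_] := integrableB (mQ j) ia (ivQ j).
  by under eq_integral do rewrite -EFinB abse_EFin.
have beE j : \int[nu]_(y in Q j) `|b j - v y|%:E = (be j)%:E by rewrite fineK.
have epE j : \int[nu]_(y in Q j) `|v y|%:E = (ep j)%:E.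
  have := finQ j 0%R; under eq_integral do rewrite sub0r normrN.
  by move=> ?; rewrite fineK.
have tri i j (a : R) (B : R) : \int[nu]_(y in Q j) `|a - v y|%:E = B%:E ->
    \int[nu]_(y in Q j) `|u (x i) - v y|%:E <= (`|u (x i) - a| * q j + B)%:E.
  move=> aB; have mB a' : measurable_fun (Q j) (fun y => `|a' - v y|%:E).
    by apply/measurable_EFinP; apply: measurableT_comp => //; exact: measurable_funB.
  rewrite EFinD EFinM -nuQ -aB -integral_cst// -ge0_integralD//.
    apply: ge0_le_integral; first exact: mQ.
    + by move=> y _; rewrite lee_fin.
    + exact: mB.
    + by apply: emeasurable_funD => //; exact: mB.
    + by move=> y _; rewrite -EFinD lee_fin ler_distD.
  by move=> y _; rewrite lee_fin.
have h := @block_cost (fun z => `|u z.1 - v z.2|%:E) (fun i => `|u (x i) - b (c (x i))|%R)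
  be (fun i => `|u (x i)|%R) ep.
have mfD : measurable_fun (D `*` D) (fun z : T * T => `|u z.1 - v z.2|%:E).
  apply/measurable_EFinP; apply: measurableT_comp => //; apply: measurable_funB.
    apply: (measurable_comp (F := D)) mu _ => //; first by move=> _ [z [] ? ? <-].
    by apply: measurable_funTS.
  apply: (measurable_comp (F := D)) mv _ => //; first by move=> _ [z [] ? ? <-].
  by apply: measurable_funTS.
have -> : fine (\int[nu]_(y in D) `|b (c y) - v y|%:E) = (\sum_(j < K) be j)%R.
  rewrite sum_integral; last 2 first.
  - apply/measurable_EFinP; apply: measurableT_comp => //.
    by apply: measurable_funB => //; exact: measurable_classes.
  - by move=> y _; rewrite lee_fin.
  rewrite (eq_bigr (fun j : 'I_K => (be j)%:E)) ?sumEFin// => j _.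
  by rewrite -beE; apply: eq_integral => y /set_mem[_ <-].
have -> : fine (\int[nu]_(y in D) `|v y|%:E) = (\sum_(j < K) ep j)%R.
  rewrite sum_integral; last 2 first.
  - by apply/measurable_EFinP; exact: measurableT_comp.
  - by move=> y _; rewrite lee_fin.
  by rewrite (eq_bigr (fun j : 'I_K => (ep j)%:E)) ?sumEFin.
apply: h => //.
- by move=> j; apply: fine_ge0; apply: integral_ge0 => y _; rewrite lee_fin.
- by move=> j; apply: fine_ge0; apply: integral_ge0 => y _; rewrite lee_fin.
- by move=> i j <-; exact: tri.
- move=> i j; have := @tri i j 0%R (ep j); rewrite subr0; apply.
  by rewrite -epE; apply: eq_integral => y _; rewrite sub0r normrN.
Qed.

End coupling.

(** * An upper bound for the transport distance *)

Section TL1_bound.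
Context {R : realType} {d : nat}.
Local Notation E := 'rV[R]_d.
Variables (nu : probability E R) (D : set E) (mD : measurable D).
Hypothesis nuD : nu D = 1%E.
Variables (n : nat) (x : nat -> E) (c : E -> nat) (K : nat).
Hypothesis n_gt0 : (0 < n)%N.
Hypothesis xD : forall i, D (x i).
Hypothesis cK : forall y, D y -> (c y < K)%N.
Hypothesis mQ : forall j, measurable (D `&` [set y | c y = j]).
Variable tau : R.
Hypothesis tau01 : 0 <= tau <= 1.
Hypothesis pq : forall j, (j < K)%N ->
  `|#|[pred i : 'I_n | c (x i) == j]|%:R / n%:R - fine (nu (D `&` [set y | c y = j]))|
  <= tau * fine (nu (D `&` [set y | c y = j])).

Lemma measurable_enorm_dist A : measurable A ->
  measurable_fun A (fun z : E * E => enorm (z.1 - z.2)).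
Proof.
move=> mA; rewrite /enorm; apply: measurable_funTS.
apply: measurableT_comp; first by apply: continuous_measurable_fun; exact: sqrt_continuous.
rewrite (_ : (fun z : E * E => _) =
   (fun z => \sum_(a < d) (z.1 0 a - z.2 0 a) ^+ 2)); last first.
  by apply/funext => z; apply: eq_bigr => a _; rewrite !mxE.
apply: measurable_sum => a; apply: measurable_funX; apply: measurable_funB.
  exact: (measurableT_comp (measurable_rV_coord a) measurable_fst).
exact: (measurableT_comp (measurable_rV_coord a) measurable_snd).
Qed.

(** The functions [u] and [v] are compared through the function [b \o c], which is
    constant on cells; only the small mass that changes cell pays for the diameter
    of [D] and for the norms of [u] and [v]. *)
Lemma dTL1_le (u v : E -> R) (b : nat -> R) (delta Delta : R) :
  measurable_fun D u -> nu.-integrable D (EFin \o v) ->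
  0 <= delta -> 0 <= Delta ->
  (forall y y', D y -> D y' -> c y = c y' -> enorm (y - y') <= delta) ->
  (forall y y', D y -> D y' -> enorm (y - y') <= Delta) ->
  (dTL1 D (empirical x n, u) (nu : {measure set E -> \bar R}, v) <=
   (delta + 2 * tau * Delta + (n%:R^-1 * (\sum_(i < n) `|u (x i) - b (c (x i))|)
   + fine (\int[nu]_(y in D) `|b (c y) - v y|%:E)
   + 2 * tau * (n%:R^-1 * (\sum_(i < n) `|u (x i)|) +
       fine (\int[nu]_(y in D) `|v y|%:E))))%:E)%E.
Proof.
move=> mu iv d0 D0 dd DD.
have [pi piE] : exists pi : probability (E * E)%type R,
    pi = block_coupling nu n x K mQ tau :> (set (E * E) -> \bar R).
  exact: block_coupling_probability.
apply: (@le_trans _ _ (\int[pi]_(z in D `*` D) (enorm (z.1 - z.2))%:E +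
                 \int[pi]_(z in D `*` D) `|u z.1 - v z.2|%:E)%E).
  apply: ereal_inf_lbound => /=; exists pi => //; move=> A mA; split.
    rewrite piE /= /mscale /msum/=.
    by apply: block_coupling_left.
  by rewrite piE; apply: block_coupling_right.
rewrite piE EFinD; apply: leeD.
  apply: block_coupling_dist => //.
  - by move=> z; exact: enorm_ge0.
  - by apply: measurable_enorm_dist; exact: measurableX.
by apply: block_coupling_fun.
Qed.

End TL1_bound.

(** * Completeness of L1 *)

Section L1_limit.
Context d (T : measurableType d) (R : realType).
Variables (mu : {measure set T -> \bar R}) (D : set T) (mD : measurable D).
Variables (f : nat -> T -> R) (M : R).
Hypothesis mf : forall n, measurable_fun D (f n).
Hypothesis M0 : 0 <= M.
Hypothesis f_cauchy : forall l m, (l <= m)%N ->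
  (\int[mu]_(y in D) `|f m y - f l y|%:E <= (M / 2 ^+ l)%:E)%E.

Lemma cvg_of_bounded_variation (a : nat -> R) :
  (\sum_(0 <= l <oo) `|a l.+1 - a l|%:E < +oo)%E -> cvgn a.
Proof.
move=> af.
have cs : cvgn (series (fun l => a l.+1 - a l)).
  apply: normed_cvg; apply: nondecreasing_is_cvgn.
    by apply: nondecreasing_series => n _ _; exact: normr_ge0.
  exists (fine (\sum_(0 <= l <oo) `|a l.+1 - a l|%:E)%E) => _ [n _ <-].
  rewrite -lee_fin fineK; last first.
    by rewrite ge0_fin_numE//; apply: nneseries_ge0 => i _ _; rewrite lee_fin.
  rewrite /series/= -sumEFin; apply: nneseries_lim_ge => i _ _.
  by rewrite lee_fin.
have -> : a = (fun n => a 0%N + series (fun l => a l.+1 - a l) n).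
  by apply/funext => n; rewrite /series/= telescope_sumr// addrC subrK.
by apply: is_cvgD => //; exact: is_cvg_cst.
Qed.

(** The increments being summable in [L1], the sequence has almost everywhere a
    limit, and Fatou's lemma passes the bounds to it. *)
Lemma L1_limit : exists2 v : T -> R, measurable_fun D v &
  forall l, (\int[mu]_(y in D) `|f l y - v y|%:E <= (M / 2 ^+ l)%:E)%E.
Proof.
have mdiff (g h : T -> R) : measurable_fun D g -> measurable_fun D h ->
    measurable_fun D (fun y => `|g y - h y|%:E).
  move=> mg mh; apply/measurable_EFinP; apply: measurableT_comp => //.
  exact: measurable_funB.
pose G y := (\sum_(0 <= l <oo) `|f l.+1 y - f l y|%:E)%E.
have mG : measurable_fun D G.
  apply: ge0_emeasurable_sum => [l y _ _|l _]; first by rewrite lee_fin.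
  exact: mdiff.
have G0 y : (0 <= G y)%E by apply: nneseries_ge0 => l _ _; rewrite lee_fin.
have Gfin : (\int[mu]_(y in D) G y < +oo)%E.
  rewrite integral_nneseries//; last by move=> l; exact: mdiff.
  apply: (@le_lt_trans _ _ (2 * M)%:E); last exact: ltry.
  apply: lime_le.
    by apply: is_cvg_nneseries => l _ _; apply: integral_ge0 => y _; rewrite lee_fin.
  apply: nearW => n; apply: (@le_trans _ _ (\sum_(0 <= l < n) (M / 2 ^+ l)%:E)%E).
    by apply: lee_sum => l _; exact: f_cauchy.
  rewrite sumEFin lee_fin -mulr_sumr mulrC ler_wpM2r//.
  have E m : \sum_(0 <= l < m) (2 ^+ l)^-1 = 2 - 2 / 2 ^+ m :> R.
    elim: m => [|m IH]; first by rewrite big_geq// expr0 divr1 subrr.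
    by rewrite big_nat_recr//= IH exprS; field.
  by rewrite E gerBl divr_ge0// exprn_ge0.
have aeG : {ae mu, forall y, D y -> cvgn (f^~ y)}.
  have iG : mu.-integrable D G.
    apply/integrableP; split => //.
    by rewrite (eq_integral G)// => y _; rewrite gee0_abs.
  apply: filterS (integrable_ae mD iG) => y h /h Gy.
  by apply: cvg_of_bounded_variation; rewrite -ge0_fin_numE//; exact: G0.
(* An upper limit is measurable whether or not the sequence converges. *)
pose v y := fine (limn_esup (fun l => (f l y)%:E)).
have mv : measurable_fun D v.
  apply: measurableT_comp => //; apply: measurable_fun_limn_esup => l.
  exact/measurable_EFinP.
exists v => // l.
apply: (@le_trans _ _ (\int[mu]_(y in D) limn_einf (fun m => `|f m y - f l y|%:E))%E).
  apply: ae_ge0_le_integral => //.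
  - exact: mdiff.
  - move=> y _; rewrite limn_einf_lim; apply: lime_ge; first exact: is_cvg_einfs.
    by apply: nearW => m; apply: le_ereal_inf_tmp => _ [k _ <-]; rewrite lee_fin.
  - apply: measurableT_comp => //; apply: measurable_fun_limn_esup => // m.
    by apply: measurableT_comp => //; exact: mdiff.
  apply: filterS aeG => y h /h/cvg_ex[L fL].
  have cE (a : nat -> R) r : a n @[n --> \oo] --> r ->
      (a n)%:E @[n --> \oo] --> r%:E.
    by move=> ar; apply/fine_cvgP; split => //; exact: nearW.
  have -> : v y = L.
    rewrite /v is_cvg_limn_esupE; last by apply/cvg_ex; exists L%:E; exact: cE.
    by rewrite (cvg_lim _ (cE _ _ fL)).
  have cL : (`|f m y - f l y|%:E)%E @[m --> \oo] --> (`|L - f l y|%:E)%E.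
    by apply: cE; apply: cvg_norm; apply: cvgB => //; exact: cvg_cst.
  rewrite is_cvg_limn_einfE; last by apply/cvg_ex; eexists; exact: cL.
  by rewrite (cvg_lim _ cL)// distrC.
apply: le_trans (fatou mu mD _ _) _.
- by move=> m; exact: mdiff.
- by move=> m y _; rewrite lee_fin.
rewrite limn_einf_lim; apply: lime_le; first exact: is_cvg_einfs.
apply: nearW => m; apply: le_trans (f_cauchy (leq_maxr m l)).
apply: ereal_inf_lbound; exists (maxn m l) => //=; exact: leq_maxl.
Qed.

End L1_limit.

(** * Compactness in TL1 along an ultrafilter *)

Section ultralimits.
Context {R : realType}.

Lemma cvg_finite_sum (T : Type) (F : set_system T) (FF : Filter F) (I : Type)
    (r : seq I) (f : I -> T -> R) (l : I -> R) :
  (forall i, f i t @[t --> F] --> l i) ->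
  \sum_(i <- r) f i t @[t --> F] --> \sum_(i <- r) l i.
Proof.
move=> fl; elim: r => [|i r IH].
  rewrite big_nil; under eq_fun do rewrite big_nil; exact: cvg_cst.
by rewrite big_cons; under eq_fun do rewrite big_cons; exact: cvgD.
Qed.

(** By compactness of segments. Limits along one ultrafilter replace the successive
    extractions of subsequences. *)
Lemma ultra_bounded_cvg (T : Type) (U : set_system T) (a : T -> R) (M : R) :
  UltraFilter U -> U [set n | `|a n| <= M] -> exists l : R, a @ U --> l.
Proof.
move=> UU aM.
have aI : U (a @^-1` `[- M, M]%classic).
  by move: aM; apply: filterS => n /= an; rewrite in_itv/= -ler_norml.
have [p [_ pc]] := @segment_compact _ (- M) M (a @ U) _ aI.
exists p => V Vp.
have [//|aV] := in_ultra_setVsetC (a @^-1` V) UU.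
by have [z []] := pc (~` V) V aV Vp.
Qed.

End ultralimits.

Section precompactness.
Context {R : realType} {d : nat}.
Local Notation E := 'rV[R]_d.
Variables (nu : probability E R) (D : set E) (mD : measurable D).
Hypothesis nuD : nu D = 1%E.
Variable x : nat -> E.
Hypothesis xD : forall i, D (x i).
Variables (cls : nat -> E -> nat) (K : nat -> nat).
Hypothesis clsK : forall t y, D y -> (cls t y < K t)%N.
Let Q t j : set E := D `&` [set y | cls t y = j].
Hypothesis mQ : forall t j, measurable (Q t j).
Hypothesis freq2 : forall t t' j j',
  #|[pred i : 'I_n | (cls t (x i) == j) && (cls t' (x i) == j')]|%:R / n%:R
  @[n --> \oo] --> fine (nu (Q t j `&` Q t' j')).
Hypothesis null : forall t j, nu (Q t j) = 0%E -> forall i, cls t (x i) <> j.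
Hypothesis diam : forall t y y', D y -> D y' -> cls t y = cls t y' ->
  enorm (y - y') <= d%:R / t.+1%:R.
Variable Delta : R.
Hypothesis Delta0 : 0 <= Delta.
Hypothesis diamD : forall y y', D y -> D y' -> enorm (y - y') <= Delta.
Variables (u : nat -> E -> R) (C0 : R).
Hypothesis C00 : 0 <= C0.
Hypothesis u_meas : forall n, (0 < n)%N -> measurable_fun D (u n).
Hypothesis u_bound : forall n, (0 < n)%N -> \sum_(i < n) `|u n (x i)| <= C0 * n%:R.
Hypothesis osc : forall eta : R, 0 < eta -> \forall t \near \oo, \forall n \near \oo,
  class_osc (fun i : 'I_n => cls t (x i)) (fun i : 'I_n => u n (x i)) <= eta.

Let q t j : R := fine (nu (Q t j)).
Let cnt n t j : nat := #|[pred i : 'I_n | cls t (x i) == j]|.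
Let p n t j : R := (cnt n t j)%:R / n%:R.
Let av n t j : R := (\sum_(i < n | cls t (x i) == j) u n (x i)) / (cnt n t j)%:R.

Let nuQ t j : nu (Q t j) = (q t j)%:E.
Proof. by rewrite /q fineK// fin_num_measure. Qed.

Let q_ge0 t j : 0 <= q t j. Proof. exact: fine_ge0. Qed.

Let freq t j : p n t j @[n --> \oo] --> q t j.
Proof.
have := @freq2 t t j j; rewrite setIid.
suff -> : (fun n => p n t j) = (fun n : nat =>
  #|[pred i : 'I_n | (cls t (x i) == j) && (cls t (x i) == j)]|%:R / n%:R) by [].
apply/funext => n; congr (_%:R / _); apply: eq_card => i.
by rewrite !inE andbb.
Qed.

(** Jensen's inequality for the average over each class. *)
Let dev_le n t : n%:R^-1 * \sum_(i < n) `|u n (x i) - av n t (cls t (x i))| <=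
  class_osc (fun i : 'I_n => cls t (x i)) (fun i : 'I_n => u n (x i)).
Proof.
rewrite /class_osc ler_wpM2l ?invr_ge0//; apply: ler_sum => i _.
set m := #|_|; have m0 : (0 : R) < m%:R.
  by rewrite ltr0n; apply/card_gt0P; exists i; rewrite inE eqxx.
have -> : u n (x i) - av n t (cls t (x i)) =
    m%:R^-1 * \sum_(j < n | cls t (x j) == cls t (x i)) (u n (x i) - u n (x j)).
  rewrite sumrB sumr_const -/m mulrBr -[u n (x i) *+ m]mulr_natl mulKf ?gt_eqF//.
  by rewrite /av mulrC.
have mi : 0 < m%:R^-1 :> R by rewrite invr_gt0.
rewrite normrM (gtr0_norm mi); apply: ler_wpM2l; first exact: ltW.
exact: ler_norm_sum.
Qed.

(** Step functions of two scales are compared on the intersections of their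
    classes. *)
Let pair_sum n t t' (F : nat -> nat -> R) :
  n%:R^-1 * \sum_(i < n) F (cls t (x i)) (cls t' (x i)) =
  \sum_(jj : 'I_(K t) * 'I_(K t')) F jj.1 jj.2 *
    (#|[pred i : 'I_n | (cls t (x i) == jj.1) && (cls t' (x i) == jj.2)]|%:R / n%:R).
Proof.
under [RHS]eq_bigr do rewrite mulrA [_ / _]mulrC.
rewrite -mulr_sumr; congr (_ * _).
under [RHS]eq_bigr => jj _.
  rewrite -sum1_card natr_sum mulr_sumr big_mkcond/=; over.
rewrite exchange_big/=; apply: eq_bigr => i _.
rewrite (bigD1 (Ordinal (clsK t (xD i)), Ordinal (clsK t' (xD i))))//=.
rewrite inE !eqxx/= mulr1 big1 ?addr0// => -[j j'] /=.
rewrite inE xpair_eqE -!val_eqE/= => jj; case: ifP => // /andP[/eqP e /eqP e'].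
by move: jj; rewrite e e' !eqxx.
Qed.

Let measurable_pair t t' (F : nat -> nat -> R) :
  measurable_fun D (fun y => F (cls t y) (cls t' y)).
Proof.
have -> : D = \bigcup_j Q t j.
  by apply/seteqP; split => [y Dy|y [j _ []]//]; exists (cls t y).
apply/measurable_fun_bigcup => // j.
have -> : Q t j = \bigcup_j' (Q t j `&` Q t' j').
  apply/seteqP; split => [y Qy|y [j' _ []]//]; exists (cls t' y) => //.
  by split => //; case: Qy.
apply/measurable_fun_bigcup => // [j'|j']; first exact: measurableI.
apply: (eq_measurable_fun (cst (F j j'))) => //.
by move=> y /set_mem[[_ /= ->] [_ /= ->]].
Qed.

Let pair_integral t t' (F : nat -> nat -> R) : (forall j j', 0 <= F j j') ->
  (\int[nu]_(y in D) (F (cls t y) (cls t' y))%:E =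
  (\sum_(jj : 'I_(K t) * 'I_(K t')) F jj.1 jj.2 *
     fine (nu (Q t jj.1 `&` Q t' jj.2)))%:E)%E.
Proof.
move=> F0; pose QQ (jj : 'I_(K t) * 'I_(K t')) := Q t jj.1 `&` Q t' jj.2.
have mQQ jj : measurable (QQ jj) by exact: measurableI.
have DE : D = \big[setU/set0]_(jj <- index_enum ('I_(K t) * 'I_(K t'))%type) QQ jj.
  rewrite -bigcup_seq; apply/seteqP; split => [y Dy|y [jj _ [[]]]//].
  exists (Ordinal (clsK t Dy), Ordinal (clsK t' Dy)) => //=.
  by rewrite mem_index_enum.
rewrite {1}DE ge0_integral_bigsetU//.
- rewrite -sumEFin; apply: eq_bigr => jj _.
  rewrite (eq_integral (cst (F jj.1 jj.2)%:E)); last first.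
    by move=> y /set_mem[[_ /= ->] [_ /= ->]].
  rewrite integral_cst//; rewrite EFinM fineK//; apply: fin_num_measure; exact: mQQ.
- exact: index_enum_uniq.
- apply/trivIsetP => -[i i'] -[j j'] _ _ ij; apply/seteqP; split => // y.
  move=> [[[_ /= yi] [_ /= yi']] [[_ /= yj] [_ /= yj']]].
  by move: ij; rewrite xpair_eqE -!val_eqE/= -yi -yj -yi' -yj' !eqxx.
- by rewrite -DE; apply/measurable_EFinP; exact: measurable_pair.
- by move=> y _; rewrite lee_fin.
Qed.

Let av_bounded t j : 0 < q t j ->
  \forall n \near \oo, `|av n t j| <= 2 * C0 / q t j.
Proof.
move=> q0; have q2 : q t j / 2 < q t j by lra.
have pq2 : \forall n \near \oo, q t j / 2 < p n t j.
  by have /cvgr_gt/(_ _ q2) := @freq t j.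
near=> n.
have n0 : (0 < n)%N by near: n; exact: nbhs_infty_gt.
have nR : (0 : R) < n%:R by rewrite ltr0n.
have pn : q t j / 2 < p n t j by near: n.
have c0 : (0 : R) < (cnt n t j)%:R.
  rewrite lt_neqAle ler0n andbT; apply/eqP => c0.
  by move: pn; rewrite /p -c0 mul0r; lra.
rewrite /av normrM normfV (gtr0_norm c0) ler_pdivrMr//.
apply: (@le_trans _ _ (C0 * n%:R)).
  apply: le_trans (u_bound n0); apply: le_trans (ler_norm_sum _ _ _) _.
  rewrite [leRHS](bigID (fun i : 'I_n => cls t (x i) == j))/=.
  by rewrite lerDl; apply: sumr_ge0.
rewrite (_ : _ * (cnt n t j)%:R = C0 * ((cnt n t j)%:R / (q t j / 2))); last first.
  by field; rewrite gt_eqF.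
apply: ler_wpM2l => //; rewrite ler_pdivlMr ?divr_gt0//.
by rewrite mulrC -ler_pdivlMr// ltW.
Unshelve. all: by end_near. Qed.

Variable phi : nat -> nat.
Hypothesis phi_homo : {homo phi : m n / (m < n)%N}.

Section ultrafilter.
Variable U : set_system nat.
Hypothesis UU : UltraFilter U.
Hypothesis ooU : \oo `<=` U.

Let oo_cvg (f : nat -> R) (l : R) : f n @[n --> \oo] --> l -> f n @[n --> U] --> l.
Proof. by move=> fl A /fl /ooU. Qed.

Lemma averages : exists a : nat -> nat -> R,
  forall t j, 0 < q t j -> av n t j @[n --> U] --> a t j.
Proof.
have E tj : exists l : R, 0 < q tj.1 tj.2 -> av n tj.1 tj.2 @[n --> U] --> l.
  have [q0|q0] := ltP 0 (q tj.1 tj.2); last by exists 0.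
  have [|l lP] := @ultra_bounded_cvg _ _ U (fun n => av n tj.1 tj.2)
      (2 * C0 / q tj.1 tj.2) UU.
    by apply: ooU; exact: av_bounded.
  by exists l.
by have [a aP] := choice E; exists (fun t j => a (t, j)) => t j; exact: (aP (t, j)).
Qed.

Variable a : nat -> nat -> R.
Hypothesis aP : forall t j, 0 < q t j -> av n t j @[n --> U] --> a t j.

Let q_gt0 t i : 0 < q t (cls t (x i)).
Proof.
rewrite lt_neqAle q_ge0 andbT; apply/eqP => q0.
by apply: (@null t (cls t (x i)) _ i) => //; rewrite nuQ -q0.
Qed.

Let approx t eta : 0 < eta ->
  (\forall n \near \oo, class_osc (fun i : 'I_n => cls t (x i))
     (fun i : 'I_n => u n (x i)) <= eta) ->
  U [set n | n%:R^-1 * \sum_(i < n) `|u n (x i) - a t (cls t (x i))| <= 2 * eta].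
Proof.
move=> eta0 osc_eta.
have : U [set n | forall j : 'I_(K t), 0 < q t j -> `|av n t j - a t j| <= eta].
  apply: filter_forall => j.
  have [q0|q0] := ltP 0 (q t j); last by apply: filterE.
  have /cvgrPdist_le/(_ _ eta0) := aP q0.
  by apply: filterS => n; rewrite distrC.
apply: filterS2 (ooU osc_eta) => n /= on an.
rewrite (_ : 2 * eta = eta + eta); last by ring.
apply: (@le_trans _ _ (n%:R^-1 * \sum_(i < n) `|u n (x i) - av n t (cls t (x i))| +
    n%:R^-1 * \sum_(i < n) `|av n t (cls t (x i)) - a t (cls t (x i))|)).
  rewrite -mulrDr -big_split; apply: ler_wpM2l; first by rewrite invr_ge0.
  by apply: ler_sum => i _; exact: ler_distD.
apply: lerD; first exact: le_trans (dev_le n t) on.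
have [->|n0] := posnP n; first by rewrite invr0 mul0r ltW.
rewrite mulrC ler_pdivrMr ?ltr0n// mulrC mulr_natl -[n in leRHS]card_ord.
rewrite -sumr_const; apply: ler_sum => i _.
by apply: (an (Ordinal (clsK t (xD i)))); exact: q_gt0.
Qed.

(** Both step functions are close to the same [u n] for the empirical measures,
    which converge on the intersections of classes. *)
Let cauchy t t' eta eta' : 0 < eta -> 0 < eta' ->
  (\forall n \near \oo, class_osc (fun i : 'I_n => cls t (x i))
     (fun i : 'I_n => u n (x i)) <= eta) ->
  (\forall n \near \oo, class_osc (fun i : 'I_n => cls t' (x i))
     (fun i : 'I_n => u n (x i)) <= eta') ->
  (\int[nu]_(y in D) `|a t (cls t y) - a t' (cls t' y)|%:E <=
   (2 * eta + 2 * eta')%:E)%E.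
Proof.
move=> e0 e0' oe oe'.
rewrite (@pair_integral t t' (fun j j' => `|a t j - a t' j'|))// lee_fin.
have := @cvg_finite_sum _ _ U _ _ (index_enum ('I_(K t) * 'I_(K t'))%type)
  (fun jj n => `|a t jj.1 - a t' jj.2| *
    (#|[pred i : 'I_n | (cls t (x i) == jj.1) && (cls t' (x i) == jj.2)]|%:R / n%:R))
  (fun jj => `|a t jj.1 - a t' jj.2| * fine (nu (Q t jj.1 `&` Q t' jj.2))).
move=> /(_ _) cv; apply: (cvgr_to_le (cv _)).
  by move=> jj; apply: cvgMr; apply: oo_cvg; exact: freq2.
apply: filterS2 (approx e0 oe) (approx e0' oe') => n /= h h'.
rewrite -(pair_sum n t t' (fun j j' => `|a t j - a t' j'|)).
apply: le_trans (lerD h h'); rewrite -mulrDr -big_split.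
apply: ler_wpM2l; first by rewrite invr_ge0.
by apply: ler_sum => i _; rewrite [X in _ <= X + _]distrC; exact: ler_distD.
Qed.

(** Along scales where the oscillation is at most [2 ^- l], the step functions of
    the limiting averages converge in [L1] at a geometric rate. *)
Let limit : exists2 v : E -> R, nu.-integrable D (EFin \o v) &
  forall eta : R, 0 < eta -> exists t,
    [/\ t.+1%:R^-1 <= eta,
        U [set n | n%:R^-1 * \sum_(i < n) `|u n (x i) - a t (cls t (x i))| <= eta] &
        (\int[nu]_(y in D) `|a t (cls t y) - v y|%:E <= eta%:E)%E].
Proof.
have two0 l : 0 < (2 ^+ l)^-1 :> R by rewrite invr_gt0 exprn_gt0.
have scale l : exists t, (l <= t)%N /\
    \forall n \near \oo, class_osc (fun i : 'I_n => cls t (x i))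
     (fun i : 'I_n => u n (x i)) <= (2 ^+ l)^-1.
  have [T _ oT] := osc (two0 l).
  exists (maxn l T); split; first exact: leq_maxl.
  by apply: oT => /=; exact: leq_maxr.
have [t tP] := choice scale.
pose f l y := a (t l) (cls (t l) y).
have mf l : measurable_fun D (f l).
  exact: (measurable_pair (t l) (t l) (fun j _ => a (t l) j)).
have fC l m : (l <= m)%N ->
    (\int[nu]_(y in D) `|f m y - f l y|%:E <= (4 / 2 ^+ l)%:E)%E.
  move=> lm; apply: le_trans (cauchy (two0 m) (two0 l) (tP m).2 (tP l).2) _.
  rewrite lee_fin; have : (2 ^+ m)^-1 <= (2 ^+ l)^-1 :> R.
    by rewrite lef_pV2 ?posrE ?exprn_gt0// ler_weXn2l// ler1n.
  by have := two0 l; lra.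
have [v mv fv] := @L1_limit _ _ R nu D mD f 4 mf (ler0n _ 4) fC.
exists v.
  apply/integrableP; split; first exact/measurable_EFinP.
  have mnorm (g : E -> R) : measurable_fun D g -> measurable_fun D (fun y => `|g y|%:E).
    by move=> mg; apply/measurable_EFinP; apply: measurableT_comp.
  apply: (@le_lt_trans _ _ (\int[nu]_(y in D) (`|f 0%N y - v y|%:E + `|f 0%N y|%:E))%E).
    apply: ge0_le_integral => //.
    - exact: mnorm.
    - by apply: emeasurable_funD; apply: mnorm => //; exact: measurable_funB.
    - move=> y _ /=; rewrite -EFinD lee_fin addrC.
      by rewrite -[X in `|X| <= _](subKr (f 0%N y)); exact: ler_normB.
  rewrite ge0_integralD//; last 2 first.
  - by apply: mnorm => //; exact: measurable_funB.
  - exact: mnorm.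
  apply: lte_add_pinfty; first exact: le_lt_trans (fv 0%N) (ltry _).
  by rewrite (@pair_integral (t 0%N) (t 0%N) (fun j _ => `|a (t 0%N) j|))// ltry.
move=> eta eta0; have e40 : 0 < eta / 4 by rewrite divr_gt0.
have [l _ /(_ l (leqnn l)) /= le] := near_infty_natSinv_lt (PosNum e40).
have {}le : l.+1%:R^-1 < eta / 4 := le.
have l2 : (2 ^+ l)^-1 <= l.+1%:R^-1 :> R.
  by rewrite lef_pV2 ?posrE ?exprn_gt0// -natrX ler_nat ltn_expl.
have tl : (t l).+1%:R^-1 <= l.+1%:R^-1 :> R.
  by rewrite lef_pV2 ?posrE// ler_nat ltnS; exact: (tP l).1.
move: le l2 tl; set z := l.+1%:R^-1; set z2 := (2 ^+ l)^-1 => le l2 tl.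
exists (t l); split.
- by apply: le_trans tl _; lra.
- have := approx (two0 l) (tP l).2; apply: filterS => n /= h.
  by apply: le_trans h _; rewrite -/z2; lra.
- by apply: le_trans (fv l) _; rewrite lee_fin -/z2; lra.
Qed.

Let close_classes t tau : 0 < tau -> \forall n \near \oo, forall j : nat, (j < K t)%N ->
  `|#|[pred i : 'I_n | cls t (x i) == j]|%:R / n%:R -
    fine (nu (D `&` [set y | cls t y = j]))|
  <= tau * fine (nu (D `&` [set y | cls t y = j])).
Proof.
move=> tau0.
have : \forall n \near \oo, forall j : 'I_(K t), `|p n t j - q t j| <= tau * q t j.
  apply: filter_forall => j.
  have [q0|q0] := ltP 0 (q t j).
    have tq : 0 < tau * q t j by rewrite mulr_gt0.
    have /cvgrPdist_le/(_ _ tq) := @freq t j.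
    by apply: filterS => n; rewrite distrC.
  have {}q0 : q t j = 0 by apply/eqP; rewrite eq_le q0 q_ge0.
  apply: filterE => n; rewrite q0 mulr0 subr0 /p.
  suff -> : cnt n t j = 0%N by rewrite mul0r normr0.
  apply: eq_card0 => i; rewrite inE; apply/eqP.
  by apply: (@null t j); rewrite nuQ q0.
by apply: filterS => n h j jK; exact: (h (Ordinal jK)).
Qed.

Lemma TL1_limit : exists2 v : E -> R, nu.-integrable D (EFin \o v) &
  forall e : R, 0 < e ->
    U [set n | (dTL1 D (empirical x n, u n)
                 (nu : {measure set E -> \bar R}, v) <= e%:E)%E].
Proof.
have [v iv vP] := limit; exists v => // e e0.
pose V := fine (\int[nu]_(y in D) `|v y|%:E)%E.
have V0 : 0 <= V by apply: fine_ge0; apply: integral_ge0 => y _; rewrite lee_fin.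
pose W := Delta + (C0 + V).
have W0 : 0 <= W by rewrite !addr_ge0.
have [r [r0 re]] : exists r, 0 < r /\ (d%:R + 2) * r = e / 2.
  exists (e / 2 / (d%:R + 2)); split; first by rewrite !divr_gt0// ltr_wpDl.
  by rewrite mulrC divfK// gt_eqF// ltr_wpDl.
have [t [te ut vt]] := vP _ r0.
pose tau := Num.min 1 (e / 2 / (2 * W + 1)).
have tau0 : 0 < tau by rewrite lt_min ltr01 !divr_gt0// ltr_wpDl// mulr_ge0.
have tauW : 2 * tau * W <= e / 2.
  apply: (@le_trans _ _ (e / 2 / (2 * W + 1) * (2 * W + 1))); last first.
    by rewrite divfK// gt_eqF// ltr_wpDl// mulr_ge0.
  rewrite mulrAC [2 * W * _]mulrC; apply: ler_pM.
  - exact: ltW.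
  - by rewrite mulr_ge0.
  - by rewrite ge_min lexx orbT.
  - by rewrite lerDl.
have n0 : U [set n | (0 < n)%N] by apply: ooU; exact: nbhs_infty_gt.
apply: filterS3 n0 ut (ooU (close_classes t tau0)) => n /= {}n0 un pq.
have tau01 : 0 <= tau <= 1 by rewrite ltW//= ge_min lexx.
have := @dTL1_le R d nu D mD nuD n x (cls t) (K t) n0 xD (clsK t) (mQ t) tau tau01 pq
  (u n) v (a t) (d%:R / t.+1%:R) Delta (u_meas n0) iv.
move=> /(_ _ Delta0 (@diam t) diamD) h; apply: le_trans (h _) _.
  by rewrite divr_ge0.
rewrite lee_fin -/V.
have un' : n%:R^-1 * \sum_(i < n) `|u n (x i)| <= C0.
  by rewrite mulrC ler_pdivrMr ?ltr0n//; exact: u_bound.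
have vt' : fine (\int[nu]_(y in D) `|a t (cls t y) - v y|%:E)%E <= r.
  rewrite -lee_fin fineK// ge0_fin_numE; last first.
    by apply: integral_ge0 => y _; rewrite lee_fin.
  exact: le_lt_trans vt (ltry _).
apply: (@le_trans _ _ (d%:R * r + 2 * tau * Delta + (r + r + 2 * tau * (C0 + V)))).
  apply: lerD; [apply: lerD => //; exact: ler_wpM2l|apply: lerD; first exact: lerD].
  by apply: ler_wpM2l; [rewrite mulr_ge0// ltW|rewrite lerD2r].
rewrite (_ : _ + _ = (d%:R + 2) * r + 2 * tau * W); last by rewrite /W; ring.
by rewrite re [leRHS](splitr e) lerD2l.
Qed.

End ultrafilter.

(** All the class averages converge along an ultrafilter that refines the image by
    [phi] of the tail filter. Every member of the ultrafilter contains values of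
    [phi] with arbitrarily large arguments, from which [psi] is extracted. *)
Lemma TL1_precompact :
  exists2 psi : nat -> nat, {homo psi : m n / (m < n)%N} &
  exists2 v : E -> R, nu.-integrable D (EFin \o v) &
    dTL1 D (empirical x (phi (psi j)), u (phi (psi j)))
      (nu : {measure set E -> \bar R}, v) @[j --> \oo] --> 0%E.
Proof.
have phi_ge n : (n <= phi n)%N.
  by elim: n => // n IH; apply: leq_ltn_trans IH _; exact: phi_homo.
have [U [UU phiU]] := ultraFilterLemma (fmap_proper_filter phi eventually_filter).
have ooU : \oo `<=` U.
  move=> A [N _ NA]; apply: phiU; exists N => // n /= Nn.
  by apply: NA; exact: leq_trans Nn (phi_ge n).
have [a aP] := averages UU ooU.
have [v iv vP] := TL1_limit UU ooU aP.
have step jN : exists m, (jN.2 < m)%N /\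
    (dTL1 D (empirical x (phi m), u (phi m))
      (nu : {measure set E -> \bar R}, v) <= jN.1.+2%:R^-1%:E)%E.
  have j0 : (0 : R) < jN.1.+2%:R^-1 by rewrite invr_gt0.
  have tN : U (phi @` [set m | (jN.2 < m)%N]).
    by apply: phiU; exists jN.2.+1 => // m /= Nm; exists m.
  have [y [/= + [m Nm ym]]] := filter_ex (filterI (vP _ j0) tN).
  by rewrite -ym => dm; exists m.
have [f fP] := choice step.
pose psi := fix psi j := if j is j'.+1 then f (j', psi j') else 0%N.
exists psi; first by apply: homo_ltn => [? ? ?|j]; [exact: ltn_trans|exact: (fP (j, psi j)).1].
exists v => //.
apply: (@squeeze_cvge _ _ _ _ (cst 0%E) _ (fun j => (j.+1%:R^-1)%:E)).
- exists 1%N => // -[//|j] _; apply/andP; split; last exact: (fP (j, psi j)).2.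
  apply/ereal_infP => _ [pi _ <-]; apply: adde_ge0; apply: integral_ge0 => z _.
    by rewrite lee_fin enorm_ge0.
  by rewrite lee_fin.
- exact: cvg_cst.
- apply: cvg_EFin; first exact: filterE.
  exact: cvg_harmonic.
Qed.

End precompactness.

(** * The coarse cells of the random sample *)

Section sample_averages.
Context {R : realType} {d : nat}.
Local Notation E := 'rV[R]_d.

Lemma integral_empirical (D : set E) (x : nat -> E) (n : nat) (f : E -> R) :
  measurable D -> (forall i, D (x i)) -> measurable_fun D f ->
  (\int[empirical x n]_(y in D) `|f y|%:E =
   (n%:R^-1 * \sum_(i < n) `|f (x i)|)%:E)%E.
Proof.
move=> mD xD mf; have mnf : measurable_fun D (fun y => `|f y|%:E).
  by apply/measurable_EFinP; apply: measurableT_comp.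
have f0 y : D y -> (0 <= `|f y|%:E)%E by rewrite lee_fin.
rewrite ge0_integral_mscale//= ge0_integral_measure_sum// EFinM -sumEFin.
congr (_ * _)%E; apply: eq_bigr => i _.
by rewrite integral_dirac//= diracE mem_set// mul1e.
Qed.

Lemma ereal_sup_bound (f : nat -> R) :
  (ereal_sup [set (f n)%:E | n in [set n | (0 < n)%N]] < +oo)%E ->
  exists2 C, 0 <= C & forall n, (0 < n)%N -> f n <= C.
Proof.
set S := ereal_sup _ => Soo.
have fS n : (0 < n)%N -> ((f n)%:E <= S)%E.
  by move=> n0; apply: ereal_sup_ubound; exists n.
exists (Num.max 0 (fine S)); first by rewrite le_max lexx.
move=> n n0; rewrite le_max -[X in _ || X]lee_fin fineK ?fS ?orbT//.
rewrite fin_numElt Soo andbT.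
exact: lt_le_trans (ltNyr _) (fS 1%N isT).
Qed.

End sample_averages.

Section sampled_classes.
Context {R : realType} {d : nat}.
Local Notation E := 'rV[R]_d.
Variables (D : set E) (rho : E -> R) (rho_min rho_max : R).
Hypothesis D_open : open D.
Hypothesis rho_cont : {within D, continuous rho}.
Hypothesis rho_min0 : 0 < rho_min.
Hypothesis rho_bounded : forall x, D x -> rho_min <= rho x <= rho_max.
Hypothesis rho_density : density_measure D rho setT = 1%E.
Context (dO : measure_display) (Omega : measurableType dO) (P : probability Omega R).
Variable X : nat -> {RV P >-> 'rV[R]_d}.
Hypothesis X_iid : iid X (density_measure D rho).
Local Notation nu := (density_measure D rho).
Variable B : nat.
Hypothesis DB : forall y, D y -> forall a, `|y 0 a| <= B%:R.

(** Numbering the coarse cells gives the classes of all scales labels in the same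
    type. *)
Definition coarse_rank t (y : E) : nat := enum_rank (coarse B t y).

Definition coarse_number t : nat := #|{ffun 'I_d -> 'I_(2 * (B * t.+1).+1).+1}|.

Lemma coarse_rank_lt t y : (coarse_rank t y < coarse_number t)%N.
Proof. exact: ltn_ord. Qed.

Lemma coarse_rank_inj t y y' :
  coarse_rank t y = coarse_rank t y' -> coarse B t y = coarse B t y'.
Proof. by move/val_inj/enum_rank_inj. Qed.

Let Q t j : set E := D `&` [set y | coarse_rank t y = j].

Let D_measurable : measurable D. Proof. exact: rV_open_measurable. Qed.

Lemma measurable_coarse_rank t j :
  measurable (D `&` [set y | coarse_rank t y = j]).
Proof.
have [jK|jK] := ltnP j (coarse_number t).
  suff -> : [set y | coarse_rank t y = j] =
      [set y | coarse B t y = enum_val (Ordinal jK)] by exact: measurable_coarse.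
  apply/seteqP; split => y /=; rewrite /coarse_rank => h.
    by apply: enum_rank_inj; apply: val_inj; rewrite enum_valK.
  by rewrite h enum_valK.
suff -> : [set y | coarse_rank t y = j] = set0 by rewrite setI0.
by apply/seteqP; split => // y /= yj; move: jK; rewrite -yj leqNgt coarse_rank_lt.
Qed.

Lemma ae_coarse_frequency : \forall w \ae P, forall t t' j j',
  #|[pred i : 'I_n | (coarse_rank t (X i w) == j) &&
     (coarse_rank t' (X i w) == j')]|%:R / n%:R @[n --> \oo] -->
  fine (nu (Q t j `&` Q t' j')).
Proof.
have : \forall w \ae P, forall t t' j j',
    (count_in X n (Q t j `&` Q t' j') w)%:R / n%:R @[n --> \oo] -->
    fine (nu (Q t j `&` Q t' j')).
  do 4 (apply: ae_foralln => ?).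
  have mQQ t t' j j' : measurable (Q t j `&` Q t' j').
    by apply: measurableI; exact: measurable_coarse_rank.
  by apply: (frequency_cvg X_iid) => //; apply: (nu_fin X_iid).
apply: filterS2 (ae_in_D D_open rho_density X_iid) => w wD h t t' j j'.
suff -> : (fun n : nat => #|[pred i : 'I_n | (coarse_rank t (X i w) == j) &&
     (coarse_rank t' (X i w) == j')]|%:R / n%:R : R) =
    (fun n => (count_in X n (Q t j `&` Q t' j') w)%:R / n%:R) by exact: h.
apply/funext => n; congr (_%:R / _); apply: eq_card => i; rewrite !inE.
apply/andP/idP => [[/eqP ij /eqP ij']|/set_mem[[_ /= /eqP ij] [_ /= /eqP ij']]] => //.
by apply/mem_set; do 2 split.
Qed.

Lemma ae_coarse_null : \forall w \ae P, forall t j, nu (Q t j) = 0%E ->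
  forall i, coarse_rank t (X i w) <> j.
Proof.
have : \forall w \ae P, forall t j, nu (Q t j) = 0%E -> forall i, ~ Q t j (X i w).
  apply: ae_foralln => t; apply: ae_foralln => j.
  have [Q0|Q0] := pselect (nu (Q t j) = 0%E); last by apply: filterE.
  have := ae_notin_null X_iid (measurable_coarse_rank t j) Q0.
  by apply: filterS => w h _.
apply: filterS2 (ae_in_D D_open rho_density X_iid) => w wD h t j Q0 i ij.
by apply: (h t j Q0 i); split.
Qed.

(** A coarse cell that contains a point at distance two sides from the
    complement of [D] lies in [D], so its mass is that of a whole cube. *)
Lemma coarse_frequency_ge (x : nat -> E) (t : nat) : (forall i, D (x i)) ->
  (forall j, #|[pred i : 'I_n | coarse_rank t (x i) == j]|%:R / n%:R @[n --> \oo] -->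
    fine (nu (Q t j))) ->
  \forall n \near \oo, forall i : 'I_n,
    (forall v, supclose (t.+1%:R^-1 + t.+1%:R^-1) v (x i) -> D v) ->
    rho_min / 2 ^+ d / 2 * t.+1%:R^-1 ^+ d * n%:R <=
      #|[pred j : 'I_n | coarse_rank t (x j) == coarse_rank t (x i)]|%:R.
Proof.
move=> xD freq; set s : R := t.+1%:R^-1; have s0 : 0 < s by rewrite invr_gt0.
have : \forall n \near \oo, forall j : 'I_(coarse_number t),
    fine (nu (Q t j)) / 2 * n%:R <= #|[pred i : 'I_n | coarse_rank t (x i) == j]|%:R.
  apply: filter_forall => j.
  have [q0|q0] := ltP 0 (fine (nu (Q t j))); last first.
    apply: filterE => n; apply: (@le_trans _ _ 0) => //.
    by rewrite mulr_le0_ge0// ler_pdivrMr// mul0r.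
  have q2 : fine (nu (Q t j)) / 2 < fine (nu (Q t j)) by lra.
  have /cvgr_gt/(_ _ q2) := freq j.
  apply: filterS2 (nbhs_infty_gt 0) => n n0 /ltW.
  by rewrite ler_pdivlMr// ltr0n.
apply: filterS => n h i deep.
apply: le_trans (h (Ordinal (coarse_rank_lt t (x i)))) => /=.
apply: ler_wpM2r => //.
suff : rho_min * (s / 2) ^+ d <= fine (nu (Q t (coarse_rank t (x i)))).
  rewrite expr_div_n (_ : rho_min / 2 ^+ d / 2 * s ^+ d =
    rho_min * (s ^+ d / 2 ^+ d) / 2); last by ring.
  by move=> ?; apply: ler_wpM2r.
rewrite -lee_fin -(nu_fin X_iid); last exact: measurable_coarse_rank.
have full_i : full D s (cell s (x i)).
  move=> y yx; apply: deep => a.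
  have := cell_diff y (x i) a s0; rewrite yx subrr mxE mulr0 subr0.
  by move=> /ltW/le_trans; apply; rewrite lerDl ltW.
suff -> : Q t (coarse_rank t (x i)) = cellset s (cell s (x i)).
  exact: (cell_density_ge D_open rho_cont rho_min0 rho_bounded s0 full_i).
have -> : cellset s (cell s (x i)) = D `&` cellset s (offset (coarse B t (x i))).
  rewrite -(coarse_cell DB t (xD i)) setIidr// => y; exact: full_i.
rewrite -(coarse_preimage DB); apply/seteqP; split => y [Dy] /= yx; split => //=.
  exact: coarse_rank_inj.
by rewrite /coarse_rank yx.
Qed.

End sampled_classes.

(** * Precompactness in TL1 *)

Theorem theorem2p7 (R : realType) (d : nat) (d_ge3 : (3 <= d)%N)
  (D : set 'rV[R]_d) (D_open : open D) (D_connected : connected D)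
  (D_bounded : bounded_set D) (D_lipschitz : lipschitz_boundary D)
  (rho : 'rV[R]_d -> R) (rho_min rho_max : R)
  (rho_cont : {within D, continuous rho})
  (rho_density : (density_measure D rho setT = 1)%E)
  (rho_bounds : 0 < rho_min < rho_max)
  (rho_bounded : forall x, D x -> rho_min <= rho x <= rho_max)
  (dO : measure_display) (Omega : measurableType dO) (P : probability Omega R)
  (X : nat -> {RV P >-> 'rV[R]_d}) (X_iid : iid X (density_measure D rho))
  (k : nat -> nat)
  (k_log : (k n)%:R / ln (n%:R : R) @[n --> \oo] --> +oo)
  (k_lin : (k n)%:R / n%:R @[n --> \oo] --> (0 : R)) :
  \forall w \ae P,
    let x := fun i => X i w in
    let nu_ := empirical x in
    forall u : nat -> 'rV[R]_d -> R,
    (forall n, (0 < n)%N -> (nu_ n).-integrable D (EFin \o u n)) ->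
    (ereal_sup [set \int[nu_ n]_(y in D) `|u n y|%:E | n in [set n | (0 < n)%N]]
       < +oo)%E ->
    (ereal_sup [set (GTV x n (k n) (u n))%:E | n in [set n | (0 < n)%N]]
       < +oo)%E ->
    forall phi : nat -> nat, {homo phi : m n / (m < n)%N} ->
    exists2 psi : nat -> nat, {homo psi : m n / (m < n)%N} &
    exists2 p, TL1 D p &
      dTL1 D (nu_ (phi (psi j)), u (phi (psi j))) p @[j --> \oo] --> 0%E.
Proof.
have d_gt0 : (0 < d)%N by exact: leq_trans d_ge3.
have /andP[rho_min0 rho_min_max'] := rho_bounds; have rho_min_max := ltW rho_min_max'.
have rho_max0 : 0 < rho_max by exact: lt_trans rho_min_max'.
have [N N_gt0 coneD] := uniform_cone D_open D_bounded D_lipschitz.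
have [B DB] := bounded_coord D_bounded.
have mD : measurable D by exact: rV_open_measurable.
set L : R := ((2 * (d * N.+1)).+1 ^ d)%N%:R.
have L0 : 0 < L by rewrite ltr0n expn_gt0.
have L1 : 1 <= 4 * L * (rho_max + 1).
  have L1 : 1 <= L by rewrite ler1n expn_gt0.
  by nra.
(* Small enough for the fine cells within reach of a link to hold at most [k n]
   points altogether. *)
pose c0 : R := (4 * L * (rho_max + 1))^-1.
have c0_gt0 : 0 < c0 by rewrite invr_gt0 (lt_le_trans ltr01).
pose bhi := 4 * rho_max * c0 ^+ d; pose blo := rho_min * (c0 / 2) ^+ d / 4.
pose g0 := rho_min / 2 ^+ d / 2.
have bhi_gt0 : 0 < bhi by rewrite !mulr_gt0// exprn_gt0.
have blo_gt0 : 0 < blo by rewrite !mulr_gt0// ?invr_gt0// exprn_gt0// divr_gt0.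
have g0_gt0 : 0 < g0 by rewrite !divr_gt0// exprn_gt0.
have bhi_small : L * bhi <= 1.
  have c01 : c0 ^+ d <= c0.
    have c01 : c0 <= 1 by rewrite invf_le1// (lt_le_trans ltr01).
    rewrite -(prednK d_gt0) exprS ler_piMr//; first exact: ltW.
    by rewrite exprn_ile1// ltW.
  apply: (@le_trans _ _ (4 * L * (rho_max + 1) * c0)); last first.
    by rewrite mulfV// gt_eqF// (lt_le_trans ltr01).
  rewrite /bhi mulrA; apply: ler_pM => //.
  - by rewrite !mulr_ge0// ltW.
  - by rewrite exprn_ge0// ltW.
  - by rewrite mulrA [L * 4]mulrC ler_pM2l ?lerDl// mulr_gt0.
pose nu : probability 'rV[R]_d R := distribution P (X 0%N).
have nuE A : measurable A -> nu A = density_measure D rho A.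
  exact: X_iid.2.
have nuD : nu D = 1%E by rewrite nuE// density_measure_D.
pose cls := @coarse_rank R d B; pose K := @coarse_number d B.
have mcls t j : measurable (D `&` [set y | cls t y = j]).
  exact: measurable_coarse_rank.
have cls_close t y y' : D y -> D y' -> cls t y = cls t y' ->
    supclose t.+1%:R^-1 y y'.
  by move=> Dy Dy' /coarse_rank_inj; exact: (coarse_supclose DB).
have diam t y y' : D y -> D y' -> cls t y = cls t y' ->
    enorm (y - y') <= d%:R / t.+1%:R.
  move=> Dy Dy' yy'; apply: enorm_le => [a|]; last by rewrite invr_ge0.
  by rewrite !mxE; exact: cls_close.
have diamD y y' : D y -> D y' -> enorm (y - y') <= d%:R * (B%:R + B%:R).
  move=> Dy Dy'; apply: enorm_le => [a|]; last by rewrite addr_ge0.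
  by rewrite !mxE (le_trans (ler_normB _ _))// lerD// DB.
have ae_D := ae_in_D D_open rho_density X_iid.
have ae_micro := ae_microcells d_gt0 D_open D_bounded rho_cont rho_min0 rho_min_max
  rho_bounded rho_density X_iid k_log k_lin c0_gt0.
have ae_freq := ae_coarse_frequency D_open rho_density X_iid DB.
have ae_null := ae_coarse_null D_open rho_density X_iid DB.
apply: filterS2 (filterI ae_D ae_micro) (filterI ae_freq ae_null).
move=> w [xD micro] [freq null] /= u u_int u_sup GTV_sup phi phi_homo.
set x := fun i => X i w in u_int u_sup GTV_sup *.
have u_meas n : (0 < n)%N -> measurable_fun D (u n).
  by move=> /u_int /integrableP[/measurable_EFinP].
have [C0 C00 u_bound] : exists2 C0, 0 <= C0 &
    forall n, (0 < n)%N -> \sum_(i < n) `|u n (x i)| <= C0 * n%:R.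
  have [|C0 C00 uC] := @ereal_sup_bound R (fun n => n%:R^-1 * \sum_(i < n) `|u n (x i)|).
    rewrite (_ : [set _ | n in _] = [set \int[empirical x n]_(y in D) `|u n y|%:E |
      n in [set n | (0 < n)%N]]%E)//.
    by apply: eq_imagel => n n0; rewrite integral_empirical//; exact: u_meas.
  exists C0 => // n n0; rewrite -ler_pdivrMr ?ltr0n// mulrC; exact: uC.
have [C1 C10 GTV_bound] := ereal_sup_bound GTV_sup.
have osc eta : 0 < eta -> \forall t \near \oo, \forall n \near \oo,
    class_osc (fun i : 'I_n => cls t (x i)) (fun i : 'I_n => u n (x i)) <= eta.
  apply: (@oscillation_small R d D N d_gt0 N_gt0 coneD c0 bhi blo g0 c0_gt0
    bhi_gt0 blo_gt0 g0_gt0 bhi_small k k_log k_lin (fun=> nat) cls cls_close x xD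
    _ _ u C0 C1 C10 u_bound GTV_bound).
  - apply: filterS micro => n micro_n p.
    suff -> : occ (fun i : 'I_n => cell (c0 * @eps R d k n) (x i)) p =
      count_in X n (cellset (c0 * @eps R d k n) p) w by exact: micro_n.
    apply: eq_card => i; rewrite !inE.
    by apply/eqP/idP => [ip|/set_mem//]; exact: mem_set.
  - move=> t; apply: (coarse_frequency_ge D_open rho_cont rho_min0 rho_bounded
      X_iid DB xD) => j.
    have := freq t t j j; rewrite setIid.
    suff -> : (fun n : nat => #|[pred i : 'I_n | cls t (x i) == j]|%:R / n%:R : R) =
      (fun n : nat => #|[pred i : 'I_n |
        (cls t (x i) == j) && (cls t (x i) == j)]|%:R / n%:R) by [].
    by apply/funext => n; congr (_%:R / _); apply: eq_card => i; rewrite !inE andbb.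
have [psi psi_homo [v iv cv]] : exists2 psi : nat -> nat, {homo psi : m n / (m < n)%N} &
  exists2 v, nu.-integrable D (EFin \o v) &
    dTL1 D (empirical x (phi (psi j)), u (phi (psi j)))
      (nu : {measure set _ -> \bar R}, v) @[j --> \oo] --> 0%E.
  apply: (@TL1_precompact R d nu D mD nuD x xD cls K _ mcls _ _ diam
    (d%:R * (B%:R + B%:R)) _ diamD u C0 C00 u_meas u_bound osc phi phi_homo).
  - by move=> t y _; exact: coarse_rank_lt.
  - by move=> t t' j j'; rewrite nuE; [exact: freq|exact: measurableI].
  - by move=> t j; rewrite nuE//; exact: null.
  - by rewrite mulr_ge0.
exists psi => //; exists (nu : {measure set _ -> \bar R}, v) => //.
by split => //=; exact: probability_setT.
Qed.
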